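(* Let $d\ge1$ and $n\ge0$. The class of triangulations of $C(n+2d+1,2d)$ without interior $(d+1)$-simplices is connected by bistellar flips: for any two triangulations $\mathcal{T},\mathcal{T}'$ of $C(n+2d+1,2d)$ without interior $(d+1)$-simplices there is a finite sequence $\mathcal{T}=\mathcal{T}_0,\mathcal{T}_1,\dots,\mathcal{T}_k=\mathcal{T}'$ of triangulations of $C(n+2d+1,2d)$, each without interior $(d+1)$-simplices, such that $\mathcal{T}_{j-1}$ and $\mathcal{T}_{j}$ are bistellar flips of each other for every $1\le j\le k$.
   Context: Write $N=n+2d+1$. The cyclic polytope $C(N,2d)$ is the convex hull of $N$ points $p_{t_1},\dots,p_{t_N}$ with $t_1<\dots<t_N$ on the moment curve $p_t=(t,t^2,\dots,t^{2d})$ in $\mathbb{R}^{2d}$; its vertices are labelled by $[N]$. A triangulation is a collection of $(2d+1)$-subsets of $[N]$ (''$2d$-simplices'') whose convex hulls have pairwise disjoint interiors and union $C(N,2d)$. A $k$-simplex of a triangulation $\mathcal{T}$ is a $(k+1)$-subset of $[N]$ that is a face of some $2d$-simplex of $\mathcal{T}$. A $d$-arc of $\mathcal{T}$ is a $d$-simplex of $\mathcal{T}$ not contained in a facet of $C(N,2d)$; the $d$-simplices not contained in a facet are exactly the tuples $(a_0,\dots,a_d)\in[N]^{d+1}$ with $a_{i+1}\ge a_i+2$ for $0\le i\le d-1$ and $a_d+2\le a_0+N$. An interior $(d+1)$-simplex of $\mathcal{T}$ is a $(d+1)$-simplex of $\mathcal{T}$ all of whose facets are $d$-arcs. A triangulation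 is determined by its set of $d$-arcs, and two triangulations are bistellar flips of each other if and only if their sets of $d$-arcs have all but one element in common. *)

(* Defs.v *)
From HB Require Import structures.
From mathcomp Require Import all_boot all_order all_algebra.
From mathcomp Require Import all_classical all_reals all_analysis.

Set Implicit Arguments.
Unset Strict Implicit.
Unset Printing Implicit Defensive.

Import Order.TTheory GRing.Theory Num.Theory.
Import numFieldNormedType.Exports.

Local Open Scope classical_set_scope.
Local Open Scope ring_scope.

(* Points of R^m are row vectors.  The vertices of C(N, m) are labelled by
   'I_N, i.e. by 0, ..., N-1 instead of 1, ..., N; a simplex is the finite set
   of its vertex labels, and the parameters t_1 < ... < t_N of the vertices are
   given by a function t : 'I_N -> R. *)

Definition moment_point (R : realType) (m : nat) (u : R) : 'rV[R]_m :=
  \row_(j < m) u ^+ j.+1.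

Definition hull (R : realType) (m N : nat) (t : 'I_N -> R) (A : {set 'I_N}) :
    set 'rV[R]_m :=
  [set x | exists w : 'I_N -> R,
     [/\ forall i, i \in A -> 0 <= w i,
         \sum_(i in A) w i = 1 &
         x = \sum_(i in A) w i *: moment_point m (t i)]].
Arguments hull {R} m {N} t A.

Definition cyclic_polytope (R : realType) (m N : nat) (t : 'I_N -> R) :
    set 'rV[R]_m :=
  hull m t [set: 'I_N]%SET.
Arguments cyclic_polytope {R} m {N} t.

(* T triangulates the cyclic polytope spanned by the vertices in V; for
   V = 'I_N this is C(N, m) itself, and smaller V are used for the
   sub-polytopes C(m + 2, m) in bistellar_flip. *)
Definition triangulation_on (R : realType) (m N : nat) (t : 'I_N -> R)
    (V : {set 'I_N}) (T : {set {set 'I_N}}) : Prop :=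
  [/\ forall s, s \in T -> s \subset V /\ #|s| = m.+1,
      forall s1 s2, s1 \in T -> s2 \in T -> s1 != s2 ->
        interior (hull m t s1) `&` interior (hull m t s2) = set0 &
      \bigcup_(s in [set s | s \in T]) hull m t s = hull m t V].
Arguments triangulation_on {R} m {N} t V T.

Definition triangulation (R : realType) (m N : nat) (t : 'I_N -> R)
    (T : {set {set 'I_N}}) : Prop :=
  triangulation_on m t [set: 'I_N]%SET T.
Arguments triangulation {R} m {N} t T.

Definition is_simplex (N : nat) (T : {set {set 'I_N}}) (k : nat)
    (A : {set 'I_N}) : Prop :=
  #|A| = k.+1 /\ exists2 s, s \in T & A \subset s.

(* A facet is a face, i.e. the intersection of the polytope with a supporting
   hyperplane {x | x w = c}, of dimension m - 1: it contains m affinely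
   independent points (the rows of M, in homogeneous coordinates). *)
Definition is_facet (R : realType) (m N : nat) (t : 'I_N -> R)
    (F : set 'rV[R]_m) : Prop :=
  exists (w : 'cV[R]_m) (c : R),
    [/\ w != 0,
        forall x, cyclic_polytope m t x -> (x *m w) 0 0 <= c,
        F = [set x | cyclic_polytope m t x /\ (x *m w) 0 0 = c] &
        exists M : 'M[R]_m, (forall i, F (row i M)) /\
          row_free (row_mx (const_mx 1 : 'cV[R]_m) M)].

Definition in_facet (R : realType) (m N : nat) (t : 'I_N -> R)
    (A : {set 'I_N}) : Prop :=
  exists2 F : set 'rV[R]_m, is_facet t F & hull m t A `<=` F.
Arguments in_facet {R} m {N} t A.

Definition is_arc (R : realType) (d N : nat) (t : 'I_N -> R)
    (T : {set {set 'I_N}}) (A : {set 'I_N}) : Prop :=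
  is_simplex T d A /\ ~ in_facet (2 * d) t A.
Arguments is_arc {R} d {N} t T A.

Definition interior_simplex (R : realType) (d N : nat) (t : 'I_N -> R)
    (T : {set {set 'I_N}}) (A : {set 'I_N}) : Prop :=
  is_simplex T d.+1 A /\
  forall B : {set 'I_N}, B \subset A -> #|B| = d.+1 -> is_arc d t T B.
Arguments interior_simplex {R} d {N} t T A.

Definition no_interior_simplex (R : realType) (d N : nat) (t : 'I_N -> R)
    (T : {set {set 'I_N}}) : Prop :=
  forall A : {set 'I_N}, ~ interior_simplex d t T A.
Arguments no_interior_simplex {R} d {N} t T.

(* The sub-polytope on m + 2 vertices S has exactly two triangulations (the
   lower and the upper facets of C(m + 2, m + 1)); a flip replaces one of them
   by the other and keeps all other simplices. Since any m + 1 points of the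
   moment curve are affinely independent, every circuit has m + 2 elements, so
   all bistellar flips are of this form. *)
Definition bistellar_flip (R : realType) (m N : nat) (t : 'I_N -> R)
    (T T' : {set {set 'I_N}}) : Prop :=
  exists S : {set 'I_N},
    [/\ #|S| = m.+2,
        triangulation_on m t S (T :&: powerset S)%SET,
        triangulation_on m t S (T' :&: powerset S)%SET,
        (T :&: powerset S)%SET != (T' :&: powerset S)%SET &
        (T :\: powerset S)%SET = (T' :\: powerset S)%SET].
Arguments bistellar_flip {R} m {N} t T T'.

(* Main.v *)
Require Import Defs.
From mathcomp Require Import all_classical all_reals all_analysis.
From mathcomp Require Import all_boot all_order all_algebra.
From mathcomp Require Import zify ring lra.

Set Implicit Arguments.
Unset Strict Implicit.
Unset Printing Implicit Defensive.

Import Order.TTheory GRing.Theory Num.Theory.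
Import numFieldNormedType.Exports.

(** The vertices of C(N, 2d) are placed on a circle, with [ordS] as the
successor.  A set is separated ([sep]) when it contains no two consecutive
vertices.  By Gale's evenness criterion the d-simplices that lie in no
facet are the separated (d+1)-sets, and a triangulation has no interior
(d+1)-simplex if and only if no simplex contains a separated (d+2)-set.  A
simplex s of such a triangulation then has a base: a separated (d+1)-set B with
s contained in [twin B], the union of B and its shift B + 1, of which s misses
exactly one element.

The flips that connect the class are those that move an arc one step along the
circle.  Let A be an arc, E = [twin A], and suppose that E minus {a + 1} is a
simplex for every a in A.  These simplices are one of the two triangulations
of the cyclic polytope on E; replacing them by the sets E minus {a} is a
bistellar flip ([bistellar_flip_flip]) that replaces the arc A by A + 1 and
stays in the class ([leq_card_sep_twin]).

Flipping arcs forward must be kept from going round the circle forever, so the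
arcs are lifted to the infinite cyclic cover.  A height function assigns an
integer k s to each simplex, and [level k s C] = k s + [lap_in s C] is the
sheet in which the arc C of s lies, where [lap_in s C] records whether C has
passed vertex 0 since the base of s.  The requirement ([valid_heights]) is that
adjacent simplices give their common arcs the same level.  Height functions
exist ([has_heights_admissible]): contract the edge between the vertices 1 and
2, lift the heights of the contraction, and settle the simplices that contain
both vertices by a parity count of the simplices around a codimension-two face
([agree_both]).

Now shift the heights so that all levels are negative.  Among the arcs of
negative level take one, A, for which N * level + (sum of its vertices) is
smallest.  Minimality makes A the base of every simplex that contains it
([min_weight_base]): otherwise A could retreat inside that simplex.  Going
round A through neighbours, all sets E minus {a + 1} are simplices, so A can be
flipped, and a nonnegative integer energy decreases ([flip_down]).  The process
ends when every arc of every simplex contains vertex 0 ([terminal]).  Simplices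
of two terminal triangulations never overlap: they would contain an alternating
sequence of 2d + 2 vertices, whose two halves are arcs and cannot both contain
vertex 0 ([terminal_nocross]).  Hence there is only one terminal triangulation
([terminal_uniq]); both given triangulations reach it, and flips are
reversible.

The passage from geometry to combinatorics rests on one analytic fact: weights
on the moment curve whose first K moments vanish have K sign changes
([sign_changes]).  It gives affine independence, the alternation of circuits,
and the equivalence of overlapping interiors with [cross]. *)

(** * Separated sets on a circle *)

Section Circle.
Variable M : nat.
Local Notation N := M.+1.
Implicit Types (A B C F G Z s : {set 'I_N}) (x y z : 'I_N).

Lemma val_ordS x : x != ord_max -> ordS x = x.+1 :> nat.
Proof.
move=> xM; rewrite /= modn_small // ltnS ltn_neqAle -ltnS ltn_ord andbT.
by apply: contraNN xM => /eqP e; apply/eqP/val_inj.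
Qed.

Lemma ordS_max : ordS (@ord_max M) = ord0.
Proof. by apply: val_inj; rewrite /= modnn. Qed.

Lemma ordS_inj : injective (@ordS N).
Proof. exact: can_inj (@ordSK N). Qed.

Lemma val_iter_ordS k x : iter k (@ordS N) x = (x + k) %% N :> nat.
Proof.
elim: k => [|k IH] /=; first by rewrite addn0 modn_small.
by rewrite IH -addn1 modnDml addn1 addnS.
Qed.

(** The successor acts on 'I_N as a single cycle, so an invariant that it
preserves spreads from any one vertex to all. *)
Lemma ordS_ind (P : pred 'I_N) y :
  P y -> (forall x, P x -> P (ordS x)) -> forall x, P x.
Proof.
move=> Py PS x; have -> : x = iter (x + N - y) (@ordS N) y.
  apply: ord_inj; rewrite val_iter_ordS subnKC ?modnDr ?modn_small //.
  by apply: leq_trans (leq_addl _ _); apply: ltnW.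
by elim: (x + N - y)%N => //= k; apply: PS.
Qed.

Lemma ord_pred_ind (P : pred 'I_N) y :
  P y -> (forall x, P (ordS x) -> P x) -> forall x, P x.
Proof.
move=> Py PS x; apply/negPn/negP => nPx; have /negP : ~~ P y by
  by apply: (@ordS_ind (fun u => ~~ P u) x) => // u /=; apply/contraNN/PS.
by apply.
Qed.

Definition sep A := [forall x in A, ordS x \notin A].

Lemma sepP A : reflect (forall x, x \in A -> ordS x \notin A) (sep A).
Proof. exact: forall_inP. Qed.

Lemma sepS A B : A \subset B -> sep B -> sep A.
Proof.
move=> AB /sepP sB; apply/sepP => x xA.
by apply: contraNN (sB x (subsetP AB _ xA)); apply: (subsetP AB).
Qed.

Lemma card_imset_ordS A : #|@ordS N @: A| = #|A|.
Proof. exact: card_imset ordS_inj. Qed.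

Lemma mem_imset_ordS A x : (ordS x \in @ordS N @: A) = (x \in A).
Proof. exact: mem_imset ordS_inj. Qed.

Lemma sep_disjoint A : sep A -> [disjoint A & @ordS N @: A].
Proof.
move=> /sepP sA; rewrite disjoint_sym disjoint_subset; apply/subsetP => y.
by case/imsetP => x xA ->; rewrite inE sA.
Qed.

Definition twin A := A :|: @ordS N @: A.

Lemma card_twin A : sep A -> #|twin A| = (2 * #|A|)%N.
Proof.
by move=> sA; rewrite cardsU disjoint_setI0 ?sep_disjoint // cards0 subn0 card_imset_ordS mul2n
  -addnn.
Qed.

(** The base takes every second vertex of each maximal run of s, beginning with
the first one. *)
Definition base B s := [&& sep B, B \subset s & s \subset twin B].

(** Membership in the base is decided by walking along the circle; this is what
makes the base of a proper subset unique. *)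
Lemma base_ordS B s x : base B s ->
  (ordS x \in B) = (ordS x \in s) && (x \notin B).
Proof.
case/and3P => /sepP sB Bs sT; apply/idP/andP => [xB|[xs xB]].
  split; first exact: (subsetP Bs).
  by apply: contraL xB; apply: sB.
by move/(subsetP sT): xs; rewrite inE mem_imset_ordS (negbTE xB) orbF.
Qed.

Lemma base_uniq s B B' : s != setT -> base B s -> base B' s -> B = B'.
Proof.
rewrite -subTset => /subsetPn[y _ ys] b b'.
have h : forall x, (fun x => (x \in B) == (x \in B')) x.
  apply: (@ordS_ind _ y) => [|x /eqP e]; last by rewrite (base_ordS x b) (base_ordS x b') e.
  case/and3P: b => _ /subsetP Bs _; case/and3P: b' => _ /subsetP Bs' _.
  by rewrite (contraNF (Bs y)) // (contraNF (Bs' y)).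
by apply/setP => x; apply/eqP/h.
Qed.

Lemma run_end s : s != setT -> s != set0 ->
  exists2 x, x \in s & ordS x \notin s.
Proof.
move=> sT /set0Pn[y ys]; apply/exists_inP; apply: contraR sT.
rewrite negb_exists_in => /forall_inP h; apply/eqP/setP => x; rewrite inE.
by apply: (@ordS_ind (mem s) y) => // u /h; rewrite negbK.
Qed.

(** Induction on the size of s, removing the last vertex x of a run: x joins
the base exactly when its predecessor is not in it. *)
Lemma base_exists s : s != setT -> exists B, base B s.
Proof.
have [k] := ubnP #|s|; elim: k s => // k IH s sk sT.
have [->|s0] := eqVneq s set0.
  exists set0; rewrite /base !sub0set /= andbT; apply/sepP => x.
  by rewrite inE.
have [x xs xS] := run_end sT s0.
have s1T : s :\ x != setT.
  by apply: contraNneq sT => e; rewrite -subTset -e subD1set.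
have [|B b] := IH (s :\ x) _ s1T; first by move: sk; rewrite (cardsD1 x s) xs.
case: (boolP (ord_pred x \in B)) => pB; last first.
  exists (x |: B); case/and3P: b => /sepP sB Bs sT'; apply/and3P; split.
  + apply/sepP => y; rewrite !inE => /predU1P[->|yB].
      apply/norP; split; first by apply: contraNneq xS => ->.
      by apply: contraNN xS => /(subsetP Bs); rewrite inE => /andP[].
    apply/norP; split; last exact: sB.
    by apply: contraNneq pB => <-; rewrite ordSK.
  + by rewrite subUset sub1set xs (subset_trans Bs) ?subD1set.
  + apply/subsetP => y ys; rewrite !inE.
    case: (eqVneq y x) => //= yx.
    have /(subsetP sT') : y \in s :\ x by rewrite !inE yx.
    rewrite inE => /orP[->//|]; case/imsetP => u uB ->.
    by rewrite mem_imset_ordS !inE uB orbT orbT.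
exists B; case/and3P: b => sB Bs sT'; apply/and3P; split=> //.
  by rewrite (subset_trans Bs) ?subD1set.
apply/subsetP => y ys; case: (eqVneq y x) => [->|yx].
  by rewrite inE -[x in _ || (x \in _)]ord_predK mem_imset_ordS pB orbT.
by apply: (subsetP sT'); rewrite !inE yx.
Qed.

Lemma leq_card_base B s : base B s -> (#|s| <= 2 * #|B|)%N.
Proof. by case/and3P => sB _ /subset_leq_card; rewrite card_twin. Qed.

Definition base_of s := odflt set0 [pick B | base B s].

Lemma base_ofP s : s != setT -> base (base_of s) s.
Proof.
rewrite /base_of => /base_exists[B b]; case: pickP => //= h.
by rewrite h in b.
Qed.

(** The pairs {b, b+1} with b in B cover s, and a separated set meets each of
them at most once; having |B| elements, C meets each exactly once. *)
Lemma base_transversal B s C b : base B s -> C \subset s -> sep C -> #|C| = #|B| ->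
  b \in B -> (b \in C) = (ordS b \notin C).
Proof.
move=> bs Cs sC cC bB; case/and3P: (bs) => sB Bs sT.
apply/idP/idP => [|bC]; first exact/sepP.
pose f y := if y \in B then y else ord_pred y.
have fB y : y \in C -> f y \in B.
  rewrite /f; case: ifP => // yB yC.
  by move: (subsetP sT y (subsetP Cs y yC)); rewrite inE yB /= => /imsetP[u uB ->]; rewrite ordSK.
have fi : {in C &, injective f}.
  move=> y y' yC y'C; rewrite /f; case: ifP => yB; case: ifP => y'B //.
  - by move=> e; move/sepP: sC => /(_ y yC); rewrite e ord_predK y'C.
  - by move=> e; move/sepP: sC => /(_ y' y'C); rewrite -e ord_predK yC.
  - by move/(can_inj (@ord_predK N)).
have : f @: C = B.
  apply/eqP; rewrite eqEcard card_in_imset // cC leqnn andbT.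
  by apply/subsetP => _ /imsetP[y yC ->]; apply: fB.
move/setP => /(_ b); rewrite bB => /imsetP[y yC].
rewrite /f; case: ifP => yB; first by move->.
by move=> e; rewrite e ord_predK yC in bC.
Qed.

Definition advance C x := ordS x |: (C :\ x).

Hypothesis hM : (1 < M)%N.

Lemma ordS_ordS_neq x : ordS (ordS x) != x.
Proof.
apply/eqP => /(congr1 (@nat_of_ord _)) /=.
rewrite -[in LHS]addn1 modnDml addn1 => /eqP; rewrite -{2}(modn_small (ltn_ord x)).
by rewrite -addn2 -[x in _ == x %[mod _]]addn0 eqn_modDl !modn_small.
Qed.

(** By transversality only the vertices of B can step forward inside s: a
vertex of B + 1 would leave its pair empty. *)
Lemma base_advance B s C x : base B s -> C \subset s -> sep C -> #|C| = #|B| ->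
  x \in C -> advance C x \subset s -> sep (advance C x) ->
  x \in B /\ ordS x \notin B.
Proof.
move=> bs Cs sC cC xC Ds sD.
have xS : ordS x \notin C by apply: (sepP _ sC).
have xx : x != ordS x by apply: contraNneq xS => <-.
have cD : #|advance C x| = #|B|.
  by rewrite /advance cardsU1 !inE (negbTE xS) andbF -cC (cardsD1 x C) xC.
have xB : x \in B.
  apply/negPn/negP => xB; case/and3P: (bs) => _ _ sT.
  move: (subsetP sT x (subsetP Cs x xC)); rewrite inE (negbTE xB) /= => /imsetP[u uB xu].
  have := base_transversal bs Cs sC cC uB; rewrite -xu xC => uC.
  have := base_transversal bs Ds sD cD uB; rewrite -xu !inE eqxx (negbTE xx) /=.
  rewrite uC andbF orbF => /eqP e.
  by move: (ordS_ordS_neq x); rewrite -e -xu eqxx.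
split=> //; by case/and3P: bs => /sepP sB _ _; apply: sB.
Qed.

(** Counts the passage through vertex 0 on the way from B to C: inside [twin B]
the vertices of B only step forward, so 0 lies in C but not in B exactly when
the last vertex has stepped to 0. *)
Definition lap B C : nat := (ord0 \in C) && (ord0 \notin B).

Definition lap_in s C : nat := lap (base_of s) C.

Lemma lap_advance B s C x : base B s -> C \subset s -> sep C -> #|C| = #|B| ->
  x \in C -> advance C x \subset s -> sep (advance C x) ->
  lap B (advance C x) = (lap B C + (ordS x == ord0))%N.
Proof.
move=> bs Cs sC cC xC Ds sD; have [xB xSB] := base_advance bs Cs sC cC xC Ds sD.
rewrite /lap !inE [ordS x == _]eq_sym; case: eqP => [e|_] /=.
  rewrite e xSB (_ : _ \in C = false) //.
  by apply/negbTE; apply: (sepP _ sC).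
by rewrite addn0; case: eqP => //= ->; rewrite xB /= andbF.
Qed.

(** If A' still holds an element of B where A has moved on, then some vertex of
A can step back towards A'. A step back to b' is blocked only by b'-1 in A, and
then b'-2 is another element of B where A has moved on and A' has not; a chain
of blocked steps would run round the whole circle, past a pair whose second
element is missing from s. *)
Lemma retreat_exists B s A A' b : base B s -> A \subset s -> A' \subset s ->
  sep A -> sep A' -> #|A| = #|B| -> #|A'| = #|B| -> (#|s| < 2 * #|B|)%N ->
  b \in B -> b \in A' -> b \notin A ->
  exists b', [/\ b' \in B, b' \in A', b' \notin A, ordS b' \in A &
    sep (b' |: (A :\ ordS b'))].
Proof.
move=> bs As A's sA sA' cA cA' cs bB bA' bA; case/and3P: (bs) => sB Bs sT.
pose X := [set b in B | (b \in A') && (b \notin A)].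
have bX : b \in X by rewrite !inE bB bA'.
(* The pair of v has no second element in s, so A cannot have moved on
there. *)
have [v vB vs] : exists2 v, v \in B & ordS v \notin s.
  apply/exists_inP; apply: contraLR cs; rewrite negb_exists_in -leqNgt.
  move/forall_inP => h; rewrite -card_twin // subset_leq_card //.
  by rewrite subUset Bs; apply/subsetP => _ /imsetP[u /h + ->]; rewrite negbK.
have [b' b'X b'N] : exists2 b', b' \in X & forall u, u \in X -> ordS (ordS u) != b'.
  apply: contrapT => h.
  have h' x : x \in X -> exists2 u, u \in X & x = ordS (ordS u).
    move=> xX; apply: contrapT => k; apply: h; exists x => // u uX.
    by apply/eqP => e; apply: k; exists u.
  have : forall x, (fun x => (x \in X) || (ordS x \in X)) x.
    apply: (@ord_pred_ind _ b) => [|x]; first by rewrite bX.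
    case/orP; first by move=> ->; rewrite orbT.
    by case/h' => u uX /ordS_inj/ordS_inj ->; rewrite uX.
  move=> /(_ v) /orP[]; rewrite inE; last first.
    by case/andP => /(subsetP Bs); rewrite (negbTE vs).
  case/and3P => _ _ vA; move: (base_transversal bs As sA cA vB).
  rewrite (negbTE vA) => /esym/negbFE/(subsetP As); by rewrite (negbTE vs).
move: b'X; rewrite inE => /and3P[b'B b'A' b'A].
have Sb : ordS b' \in A by move: (base_transversal bs As sA cA b'B);
  rewrite (negbTE b'A) => /esym/negbFE.
exists b'; split=> //; apply/sepP => y; rewrite !inE => /predU1P[->|/andP[yb yA]].
  by rewrite eqxx /= orbF; apply: contraNneq b'A => <-.
apply/norP; split; last by rewrite negb_and (sepP _ sA) ?orbT.
apply/eqP => e.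
have yB : y \notin B by apply: contraL b'B => /(sepP _ sB); rewrite e.
move: (subsetP sT y (subsetP As y yA)); rewrite inE (negbTE yB) /= => /imsetP[u uB yu].
have yA' : y \notin A' by apply: contraL b'A' => /(sepP _ sA'); rewrite e.
have uA' : u \in A' by rewrite (base_transversal bs A's sA' cA' uB) -yu.
have uA : u \notin A by rewrite (base_transversal bs As sA cA uB) -yu yA.
by move: (b'N u); rewrite inE uB uA' uA -yu e eqxx => /(_ isT).
Qed.

(** The graph of advances on the separated |B|-subsets of F is connected: by
[retreat_exists] the one of A, A' that is ahead at some pair can be moved back,
which shrinks their difference. *)
Lemma advance_invariant (R : Type) (h : {set 'I_N} -> R) B s F A A' :
  base B s -> (#|s| < 2 * #|B|)%N -> F \subset s ->
  (forall C x, C \subset F -> sep C -> #|C| = #|B| -> x \in C ->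
     advance C x \subset F -> sep (advance C x) -> h (advance C x) = h C) ->
  A \subset F -> A' \subset F -> sep A -> sep A' -> #|A| = #|B| -> #|A'| = #|B| ->
  h A = h A'.
Proof.
move=> bs cs Fs hh.
have [k] := ubnP #|A :\: A'|; elim: k A A' => // k IH A A' kA AF A'F sA sA' cA cA'.
have As := subset_trans AF Fs; have A's := subset_trans A'F Fs.
have step A1 A2 b : A1 \subset F -> A2 \subset F -> sep A1 -> sep A2 ->
    #|A1| = #|B| -> #|A2| = #|B| -> b \in B -> b \in A2 -> b \notin A1 ->
    exists A3, [/\ A3 \subset F, sep A3, #|A3| = #|B|, h A1 = h A3 &
      A3 :\: A2 \proper A1 :\: A2].
  move=> A1F A2F s1 s2 c1 c2 bB b2 b1.
  have [b' [b'B b'2 b'1 Sb1 s3]] := retreat_exists bs (subset_trans A1F Fs)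
     (subset_trans A2F Fs) s1 s2 c1 c2 cs bB b2 b1.
  have bSb : b' != ordS b' by apply: contraNneq b'1 => ->.
  exists (b' |: (A1 :\ ordS b')).
  have F3 : b' |: (A1 :\ ordS b') \subset F.
    by rewrite subUset sub1set (subsetP A2F) //= (subset_trans (subD1set _ _)).
  have c3 : #|b' |: (A1 :\ ordS b')| = #|B|.
    by rewrite cardsU1 !inE (negbTE b'1) andbF -c1 (cardsD1 (ordS b') A1) Sb1.
  have e : advance (b' |: (A1 :\ ordS b')) b' = A1.
    apply/setP => y; rewrite !inE; case: (eqVneq y (ordS b')) => [->|_] /=; first by rewrite Sb1.
    by case: (eqVneq y b') => //= ->; rewrite (negbTE b'1).
  split=> //; first by rewrite -[in LHS]e; apply: hh; rewrite ?e // !inE eqxx.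
  apply/properP; split.
    apply/subsetP => y; rewrite !inE => /andP[y2 /predU1P[e'|/andP[_ ->]]]; last by rewrite y2.
    by rewrite e' b'2 in y2.
  exists (ordS b'); first by rewrite !inE Sb1 (sepP _ s2).
  by rewrite !inE eqxx orbF eq_sym (negbTE bSb) andbF.
case: (boolP [exists b in B, (b \in A') (+) (b \in A)]) => [/exists_inP[b bB]|].
  case: (boolP (b \in A')) => b2 /=.
    move=> b1; have [A3 [F3 s3 c3 -> /proper_card lt3]] :=
      step A A' b AF A'F sA sA' cA cA' bB b2 b1.
    by apply: IH => //; apply: leq_trans lt3 _; rewrite -ltnS.
  move=> b1; have [A3 [F3 s3 c3 -> /proper_card lt3]] :=
    step A' A b A'F AF sA' sA cA' cA bB b1 b2.
  have cc (X Y : {set 'I_N}) : #|X| = #|Y| -> #|X :\: Y| = #|Y :\: X|.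
    by move=> e; apply/eqP; rewrite -(eqn_add2l #|X :&: Y|) cardsID [X :&: Y]setIC cardsID e.
  apply: IH => //; rewrite cc ?cA ?c3 //; apply: leq_trans lt3 _.
  by rewrite cc ?cA ?cA' // -ltnS.
rewrite negb_exists_in => /forall_inP e; congr h.
case/and3P: (bs) => sB Bs sT.
(* If A and A' agree on B, they agree on each pair {b, b+1}. *)
have half A1 A2 : A1 \subset s -> A2 \subset s -> sep A1 -> sep A2 -> #|A1| = #|B| ->
  #|A2| = #|B| ->
    (forall b, b \in B -> (b \in A1) = (b \in A2)) -> A1 \subset A2.
  move=> A1s A2s s1 s2 c1 c2 e'; apply/subsetP => y y1.
  case: (boolP (y \in B)) => yB; first by rewrite -e'.
  move: (subsetP sT y (subsetP A1s y y1)); rewrite inE (negbTE yB) /= => /imsetP[u uB yu].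
  move: (base_transversal bs A1s s1 c1 uB) (base_transversal bs A2s s2 c2 uB).
  by rewrite -yu y1 e' // => -> /esym/negbFE.
have e' b : b \in B -> (b \in A) = (b \in A').
  by move=> /e; rewrite negb_add eq_sym => /eqP.
apply/eqP; rewrite eqEsubset (half A A') ?(half A' A) // => b bB.
by rewrite e'.
Qed.
End Circle.

(** * Alternating sequences and overlapping simplices *)

Section Alternation.
Variable N : nat.
Implicit Types (A B C F G Z s : {set 'I_N}) (x y z : 'I_N).

Definition ltord : rel 'I_N := fun x y => (x < y)%N.

(** The entries of w lie in turn in s1, s2, s1, ... *)
Fixpoint alternating s1 s2 (w : seq 'I_N) : bool :=
  if w is x :: w' then (x \in s1) && alternating s2 s1 w' else true.

Lemma alternating_mono s1 s2 (u1 u2 : {set 'I_N}) w :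
  {in w, forall x, x \in s1 -> x \in u1} -> {in w, forall x, x \in s2 -> x \in u2} ->
  alternating s1 s2 w -> alternating u1 u2 w.
Proof.
elim: w s1 s2 u1 u2 => //= x w IH s1 s2 u1 u2 h1 h2 /andP[xs a].
rewrite h1 ?mem_head //=; apply: IH a => y yw; [apply: h2|apply: h1];
  by rewrite inE yw orbT.
Qed.

Lemma alternating_mem s1 s2 w : alternating s1 s2 w -> {subset w <= s1 :|: s2}.
Proof.
elim: w s1 s2 => //= x w IH s1 s2 /andP[xs /IH h] y.
by rewrite inE => /predU1P[->|/h]; rewrite !inE ?xs // orbC.
Qed.

Definition seq_rk (w : seq 'I_N) x := count (fun y => ltord y x) w.

Lemma ltord_trans : transitive ltord.
Proof. by move=> y x z; apply: ltn_trans. Qed.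

Lemma alternating_rk s1 s2 w : sorted ltord w ->
  alternating s1 s2 w = all (fun x => x \in if odd (seq_rk w x) then s2 else s1) w.
Proof.
elim: w s1 s2 => //= x w IH s1 s2 xw.
have xall : all (ltord x) w by apply: order_path_min xw; apply: ltord_trans.
rewrite IH ?(path_sorted xw) // /seq_rk /= /ltord ltnn add0n.
have -> : count (fun y : 'I_N => y < x)%N w = 0%N.
  apply/eqP; rewrite -leqn0 leqNgt -has_count -all_predC.
  by apply: sub_all xall => y; rewrite /ltord /= => xy; rewrite -leqNgt ltnW.
congr andb; apply: eq_in_all => y yw; rewrite (allP xall y yw : (x < y)%N) /=.
by case: odd.
Qed.

Definition rk Z x := #|[set y in Z | (y < x)%N]|.

Lemma sorted_enum_ltord Z : sorted ltord (enum Z).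
Proof.
rewrite /enum_mem; apply: sorted_filter ltord_trans _ _ _; rewrite -enumT.
have := iota_ltn_sorted 0 N; rewrite -val_enum_ord sorted_map.
by apply: sub_sorted.
Qed.

Lemma rk_enum Z x : seq_rk (enum Z) x = rk Z x.
Proof.
rewrite /seq_rk /rk -size_filter cardE; congr size.
by rewrite /enum_mem -filter_predI; apply: eq_filter => y; rewrite !inE andbC.
Qed.

Lemma rk_sum Z x : rk Z x = (\sum_(y in Z) (y < x))%N.
Proof.
rewrite /rk -sum1_card big_mkcond [in RHS]big_mkcond /=.
by apply: eq_bigr => y _; rewrite !inE; case: (y \in Z); case: ltnP.
Qed.

Lemma alternating_enum s1 s2 Z :
  (forall x, x \in Z -> x \in if odd (rk Z x) then s2 else s1) ->
  alternating s1 s2 (enum Z).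
Proof.
move=> h; rewrite alternating_rk ?sorted_enum_ltord //; apply/allP => x.
by rewrite rk_enum mem_enum; apply: h.
Qed.

Lemma alternating_enum_mem s1 s2 Z x : alternating s1 s2 (enum Z) -> x \in Z ->
  x \in if odd (rk Z x) then s2 else s1.
Proof.
rewrite alternating_rk ?sorted_enum_ltord // => /allP h xZ.
by move: (h x); rewrite mem_enum rk_enum; apply.
Qed.

Lemma sorted_eq_enum (w : seq 'I_N) : sorted ltord w -> w = enum [set x in w].
Proof.
move=> sw; apply: (@irr_sorted_eq _ ltord) => //; first exact: ltord_trans.
- by move=> x; apply: ltnn.
- exact: sorted_enum_ltord.
- by move=> x; rewrite mem_enum inE.
Qed.

Lemma sorted_ltord_uniq (w : seq 'I_N) : sorted ltord w -> uniq w.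
Proof. by move=> /sorted_eq_enum ->; apply: enum_uniq. Qed.

(** The circuits of points on the moment curve in dimension 2d are the
alternating (2d+2)-sets, so this is the combinatorial form of two 2d-simplices
having overlapping interiors. *)
Definition cross d s1 s2 := exists w,
  [/\ sorted ltord w, size w = (2 * d).+2 & alternating s1 s2 w || alternating s2 s1 w].

Lemma cross_sym d s1 s2 : cross d s1 s2 -> cross d s2 s1.
Proof. by case=> w [? ? h]; exists w; split=> //; rewrite orbC. Qed.

Lemma cross_mono d s1 s2 (u1 u2 : {set 'I_N}) : s1 \subset u1 -> s2 \subset u2 ->
  cross d s1 s2 -> cross d u1 u2.
Proof.
move=> /subsetP h1 /subsetP h2 [w [sw zw aw]]; exists w; split=> //.
case/orP: aw => aw; apply/orP; [left|right]; move: aw; apply: alternating_mono => i _;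
  by [apply: h1|apply: h2].
Qed.

Lemma cross_set d s1 s2 Z : #|Z| = (2 * d).+2 ->
  (forall x, x \in Z -> x \in if odd (rk Z x) then s2 else s1) -> cross d s1 s2.
Proof.
move=> cZ h; exists (enum Z); split; rewrite ?sorted_enum_ltord -?cardE //.
by rewrite alternating_enum.
Qed.

Lemma rkU1 F x y : x \notin F -> rk (x |: F) y = (rk F y + (x < y))%N.
Proof. by move=> xF; rewrite !rk_sum big_setU1 //= addnC. Qed.

(** The parity of the rank of x in F tells on which side of the facet F the
vertex x lies. Two simplices on the same side of a common facet overlap: with x
and y, F forms a set in which x and y have ranks of opposite parity, and all
other vertices lie in both simplices. *)
Lemma same_side_cross d F x y : #|F| = (2 * d)%N -> x != y -> x \notin F -> y \notin F ->
  odd (rk F x) = odd (rk F y) -> cross d (x |: F) (y |: F).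
Proof.
move=> cF; wlog xy : x y / (x < y)%N => [wl xy xF yF o|].
  have [lt|lt|e] := ltngtP x y; first exact: wl.
    by apply: cross_sym; apply: wl => //; rewrite eq_sym.
  by case/eqP: xy; apply: ord_inj.
move=> nxy xF yF o; have xyF : x \notin y |: F by rewrite !inE negb_or nxy.
have cZ : #|x |: (y |: F)| = (2 * d).+2 by rewrite !cardsU1 xyF yF cF.
have rx : rk (x |: (y |: F)) x = rk F x by rewrite !rkU1 // ltnn ltnNge (ltnW xy) /= !addn0.
have ry : rk (x |: (y |: F)) y = (rk F y).+1 by rewrite !rkU1 // ltnn xy addn0 addn1.
case ox: (odd (rk F x)).
  apply: cross_sym; apply: cross_set cZ _ => z; rewrite !inE => /or3P[/eqP->|/eqP->|zF].
  - by rewrite rx ox !inE eqxx.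
  - by rewrite ry /= -o ox /= !inE eqxx.
  - by case: odd; rewrite inE zF orbT.
apply: cross_set cZ _ => z; rewrite !inE => /or3P[/eqP->|/eqP->|zF].
- by rewrite rx ox !inE eqxx.
- by rewrite ry /= -o ox /= !inE eqxx.
- by case: odd; rewrite inE zF orbT.
Qed.

End Alternation.

Section CircleRank.
Variable M : nat.
Local Notation N := M.+1.
Implicit Types (A B C F G Z s : {set 'I_N}) (x y z : 'I_N).

Lemma rk_ordS s z : z != ord_max -> rk s (ordS z) = (rk s z + (z \in s))%N.
Proof.
move=> zM; rewrite !rk_sum val_ordS //; case: (boolP (z \in s)) => zs.
  rewrite (bigD1 z) //= [in RHS](bigD1 z) //= ltnn ltnSn add0n addnC; congr addn.
  apply: eq_bigr => y /andP[_ yz]; rewrite ltnS leq_eqVlt.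
  by rewrite -[_ == _]/(y == z) (negbTE yz).
rewrite addn0; apply: eq_bigr => y ys; rewrite ltnS leq_eqVlt.
by case: eqP => // /ord_inj e; rewrite e (negbTE zs) in ys.
Qed.

Lemma rk_twin B z : sep B ->
  rk (twin B) z = (\sum_(b in B) ((b < z) + (ordS b < z)))%N.
Proof.
move=> sB; rewrite rk_sum big_split /=.
have -> : (\sum_(b in B) (ordS b < z) = \sum_(y in @ordS N @: B) (y < z))%N.
  by rewrite big_imset //= => x y _ _ /ordS_inj.
by rewrite -bigU ?sep_disjoint //; apply: eq_bigl => x; rewrite !inE.
Qed.

Lemma even_sum (I : finType) (P : pred I) (f : I -> nat) :
  (forall i, P i -> ~~ odd (f i)) -> ~~ odd (\sum_(i | P i) f i)%N.
Proof.
by move=> h; elim/big_ind: _ => // m k om ok; rewrite oddD negb_add (negbTE om) (negbTE ok).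
Qed.

(** Gale's evenness criterion: a pair {b, b+1} lies entirely before or entirely
after z, except for the pair of the last vertex and 0, which is split by z. *)
Lemma odd_rk_twin_notin B z : sep B -> z \notin @ordS N @: B ->
  odd (rk (twin B) z) = (ord_max \in B).
Proof.
move=> sB zB; rewrite rk_twin //.
have ev b : b \in B -> b != ord_max -> ~~ odd ((b < z) + (ordS b < z))%N.
  move=> bB bM; rewrite val_ordS //; have : ordS b != z.
    by apply: contraNneq zB => <-; rewrite mem_imset_ordS.
  rewrite -val_eqE /= -[_ == _]/(nat_of_ord (ordS b) == z) val_ordS // => bz.
  have -> : (b < z)%N = (b.+1 < z)%N by move/eqP: bz; lia.
  by case: (_ < _)%N.
case: (boolP (ord_max \in B)) => mB; last first.
  apply/negbTE/even_sum => b bB; apply: ev => //; by apply: contraNneq mB => <-.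
rewrite (bigD1 ord_max) // ordS_max oddD oddD.
have -> : ((ord_max : 'I_N) < z)%N = false by apply/negbTE; rewrite -leqNgt -ltnS ltn_ord.
have -> : ((ord0 : 'I_N) < z)%N.
  rewrite lt0n; apply: contraNneq zB => z0.
  have -> : z = ordS ord_max by rewrite ordS_max; apply: ord_inj.
  by rewrite mem_imset_ordS.
by rewrite (negbTE (even_sum _)) // => b /andP[]; apply: ev.
Qed.

Lemma odd_rk_twin_ordS B b : sep B -> b \in B ->
  odd (rk (twin B) (ordS b)) = (ord_max \notin B).
Proof.
move=> sB bB; have [bM|bM] := eqVneq b ord_max.
  rewrite -bM bB bM ordS_max /rk (_ : [set _ in _ | _] = set0) ?cards0 //.
  by apply/setP => y; rewrite !inE ltn0 andbF.
have bT : b \in twin B by rewrite inE bB.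
have bS : b \notin @ordS N @: B by rewrite (disjointFr (sep_disjoint sB)).
rewrite -(odd_rk_twin_notin sB bS) /rk val_ordS //.
have -> : [set y in twin B | (y < b.+1)%N] = b |: [set y in twin B | (y < b)%N].
  apply/setP => y; rewrite !inE ltnS leq_eqVlt; case: (eqVneq y b) => [->|yb];
    first by rewrite bB eqxx.
  by rewrite -val_eqE /= in yb; rewrite (negbTE yb).
by rewrite cardsU1 inE ltnn andbF.
Qed.

(** The vertices of B and B + 1 alternate round the circle; which of them comes
first depends on whether the last vertex, whose successor is 0, belongs to
B. *)
Lemma ordS_cross d B s s' : sep B -> #|B| = d.+1 -> B \subset s ->
  @ordS N @: B \subset s' -> cross d s s'.
Proof.
move=> sB cB Bs Bs'; have cT : #|twin B| = (2 * d).+2 by rewrite card_twin // cB mulnS.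
have h x : x \in twin B -> x \in if odd (rk (twin B) x) == (ord_max \in B) then s else s'.
  rewrite inE => /orP[xB|/imsetP[b bB ->]].
    by rewrite odd_rk_twin_notin ?eqxx ?(subsetP Bs) // (disjointFr (sep_disjoint sB)).
  by rewrite odd_rk_twin_ordS //; case: (_ \in B); rewrite (subsetP Bs') ?mem_imset_ordS.
case: (boolP (ord_max \in B)) => mB.
  apply: cross_sym; apply: cross_set cT _ => x /h; rewrite mB.
  by case: odd.
apply: cross_set cT _ => x /h; rewrite (negbTE mB).
by case: odd.
Qed.

Lemma sep_subset_card k B : sep B -> (k <= #|B|)%N ->
  exists A, [/\ sep A, #|A| = k & A \subset B].
Proof.
move=> sB kB; exists [set x in take k (enum B)].
have AB : [set x in take k (enum B)] \subset B.
  by apply/subsetP => x; rewrite inE => /mem_take; rewrite mem_enum.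
split=> //; first exact: sepS AB sB.
by rewrite cardsE (card_uniqP _) ?take_uniq ?enum_uniq // size_takel // -cardE.
Qed.

(** If G had no separated (d+1)-subset, it would be the twin of its base, and
all vertices outside G would be on the same side of it: G would span a boundary
facet. *)
Lemma opposite_sides_sep d G x y : #|G| = (2 * d)%N -> x \notin G -> y \notin G ->
  odd (rk G x) != odd (rk G y) -> exists A, [/\ sep A, #|A| = d.+1 & A \subset G].
Proof.
move=> cG xG yG oxy; have [|B b] := @base_exists M G.
  by apply: contraNneq xG => ->; rewrite inE.
have cB := leq_card_base b; case/and3P: (b) => sB BG GT.
have [dB|] := ltnP d #|B|.
  have [A [sA cA AB]] := sep_subset_card sB dB.
  by exists A; split=> //; apply: subset_trans BG.
move=> Bd; case/eqP: oxy; have e : G = twin B.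
  by apply/eqP; rewrite eqEcard GT card_twin // cG leq_mul2l Bd.
have out z : z \notin G -> odd (rk G z) = (ord_max \in B).
  rewrite e => zG; apply: odd_rk_twin_notin => //.
  by apply: contraNN zG => zB; rewrite inE zB orbT.
by rewrite !out.
Qed.

End CircleRank.

(** * Admissible families and height functions *)

Section Class.
Variables (M d : nat).
Local Notation N := M.+1.
Implicit Types (A B C F G Z s : {set 'I_N}) (x y z : 'I_N) (T : {set {set 'I_N}}).

(** What is used of a triangulation without interior (d+1)-simplices: simplices
contain no separated (d+2)-set, they do not overlap, and a facet that contains
a d-arc is not on the boundary, so that a simplex lies on its other side. *)
Definition admissible T : Prop :=
  [/\ forall s, s \in T -> #|s| = (2 * d).+1,
      forall s A, s \in T -> sep A -> A \subset s -> (#|A| <= d.+1)%N,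
      forall s s', s \in T -> s' \in T -> ~ cross d s s' &
      forall s x A, s \in T -> x \in s -> sep A -> #|A| = d.+1 -> A \subset s :\ x ->
        exists2 y, y \notin s & y |: (s :\ x) \in T].

Lemma setU1_of_card F s : F \subset s -> #|s| = #|F|.+1 ->
  exists2 x, x \notin F & s = x |: F.
Proof.
move=> Fs c; have [x xD] : exists x, x \in s :\: F.
  by apply/set0Pn; rewrite -card_gt0 cardsD (setIidPr Fs) c subSn ?subnn.
move: xD; rewrite inE => /andP[xF xs]; exists x => //; apply/eqP.
by rewrite eq_sym eqEcard subUset sub1set xs Fs cardsU1 xF c /=.
Qed.

Lemma setI_setU1 (I : finType) (F : {set I}) (x y : I) : x != y -> x \notin F -> y \notin F ->
  (x |: F) :&: (y |: F) = F.
Proof.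
move=> xy xF yF; apply/setP => z; rewrite !inE; case: (boolP (z \in F)) => zF;
  rewrite ?orbT // !orbF.
by case: eqP => // ->; rewrite (negbTE xy).
Qed.

Lemma admissible_opposite T F x y : admissible T -> #|F| = (2 * d)%N -> x != y -> x \notin F ->
  y \notin F ->
  x |: F \in T -> y |: F \in T -> odd (rk F x) != odd (rk F y).
Proof.
case=> _ _ C2 _ cF xy xF yF xT yT; apply/eqP => e.
by apply: (C2 _ _ xT yT); apply: same_side_cross.
Qed.

(** Simplices sharing a facet are on different sides of it, and there are only
two sides. *)
Lemma admissible_neighbour_uniq T F s1 s2 s3 : admissible T -> #|F| = (2 * d)%N ->
  s1 \in T -> s2 \in T -> s3 \in T -> F \subset s1 -> F \subset s2 -> F \subset s3 ->
  s1 != s2 -> s1 != s3 -> s2 = s3.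
Proof.
move=> cT cF T1 T2 T3 F1 F2 F3; case: (cT) => C0 _ _ _.
have [x1 n1 e1] := setU1_of_card F1 (etrans (C0 _ T1) (congr1 succn (esym cF))).
have [x2 n2 e2] := setU1_of_card F2 (etrans (C0 _ T2) (congr1 succn (esym cF))).
have [x3 n3 e3] := setU1_of_card F3 (etrans (C0 _ T3) (congr1 succn (esym cF))).
rewrite e1 e2 e3 in T1 T2 T3 * => d12 d13.
have x12 : x1 != x2 by apply: contraNneq d12 => ->.
have x13 : x1 != x3 by apply: contraNneq d13 => ->.
have o12 := admissible_opposite cT cF x12 n1 n2 T1 T2.
have o13 := admissible_opposite cT cF x13 n1 n3 T1 T3.
apply/eqP/negPn/negP => d23; have x23 : x2 != x3 by apply: contraNneq d23 => ->.
have := admissible_opposite cT cF x23 n2 n3 T2 T3.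
by move: o12 o13; do 3!case: odd.
Qed.

Hypothesis hM : (1 < M)%N.
Hypothesis hN : ((2 * d).+2 <= N)%N.

Lemma admissible_neq_setT T s : admissible T -> s \in T -> s != setT.
Proof.
case=> C0 _ _ _ /C0 cs; apply: contraTneq hN => e.
by rewrite -ltnNge ltnS -cs e cardsT card_ord.
Qed.

Lemma admissible_base T s : admissible T -> s \in T -> base (base_of s) s /\ #|base_of s| = d.+1.
Proof.
move=> cT sT; have b := base_ofP (admissible_neq_setT cT sT); split=> //.
case: (cT) => C0 C1 _ _; case/and3P: (b) => sB Bs _; apply/eqP.
rewrite eqn_leq (C1 _ _ sT sB Bs) /=; move: (leq_card_base b); rewrite (C0 _ sT).
by rewrite ltn_mul2l /=.
Qed.

(** An advance inside both simplices passes vertex 0 in both or in neither, so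
the difference of the laps is constant on the common arcs. *)
Lemma lap_in_diff T s1 s2 A A' : admissible T -> s1 \in T -> s2 \in T ->
  sep A -> sep A' -> #|A| = d.+1 -> #|A'| = d.+1 -> A \subset s1 :&: s2 ->
  A' \subset s1 :&: s2 ->
  ((lap_in s1 A)%:Z - (lap_in s2 A)%:Z = (lap_in s1 A')%:Z - (lap_in s2 A')%:Z)%R.
Proof.
move=> cT T1 T2 sA sA' cA cA' AF A'F.
have [b1 c1] := admissible_base cT T1; have [b2 c2] := admissible_base cT T2.
case: (cT) => C0 _ _ _.
apply: (@advance_invariant _ _ (fun C => (lap_in s1 C)%:Z - (lap_in s2 C)%:Z)%R _ _ (s1 :&: s2) _
  _ b1);
  rewrite ?c1 ?subsetIl //; first by rewrite (C0 _ T1) mulnS.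
move=> C x CF sC cC xC DF sD.
have := lap_advance hM b1 (subset_trans CF (subsetIl _ _)) sC (etrans cC (esym c1)) xC
  (subset_trans DF (subsetIl _ _)) sD.
have := lap_advance hM b2 (subset_trans CF (subsetIr _ _)) sC (etrans cC (esym c2)) xC
  (subset_trans DF (subsetIr _ _)) sD.
by rewrite /lap_in => -> ->; rewrite !PoszD opprD addrACA subrr addr0.
Qed.

(** Two simplices place each of their common arcs in the same sheet of the
cyclic cover. *)
Definition agree (k : {set 'I_N} -> int) s s' := forall A, sep A -> #|A| = d.+1 ->
  A \subset s :&: s' -> (k s + (lap_in s A)%:Z = k s' + (lap_in s' A)%:Z)%R.

Lemma agree_sym (k : {set 'I_N} -> int) s1 s2 : agree k s1 s2 -> agree k s2 s1.
Proof. by move=> h A sA cA AF; apply/esym/h => //; rewrite setIC. Qed.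

(** By [lap_in_diff] a single common arc decides. *)
Lemma agree_of_one T (k : {set 'I_N} -> int) s s' A : admissible T -> s \in T -> s' \in T ->
  sep A -> #|A| = d.+1 -> A \subset s :&: s' ->
  (k s + (lap_in s A)%:Z = k s' + (lap_in s' A)%:Z)%R -> agree k s s'.
Proof.
move=> cT Ts Ts' sA cA AF e A' sA' cA' A'F.
have := lap_in_diff cT Ts Ts' sA sA' cA cA' AF A'F; lia.
Qed.

Definition valid_heights (k : {set 'I_N} -> int) T := forall s s',
  s \in T -> s' \in T -> s != s' -> #|s :&: s'| = (2 * d)%N -> agree k s s'.

Definition has_heights T := exists k, valid_heights k T.
End Class.

(** With 2d + 2 vertices the twin of an arc is the whole circle, so an arc is
the base of each simplex that contains it and all laps vanish. *)
Lemma has_heights_min d (T : {set {set 'I_(2 * d).+2}}) :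
  (0 < d)%N -> admissible d T -> has_heights d T.
Proof.
move=> d0 cT; exists (fun => 0%R) => s s' Ts Ts' ns cs A sA cA AF.
have h u : u \in T -> A \subset u -> lap_in u A = 0%N.
  move=> Tu Au; have hM : (1 < (2 * d).+1)%N by lia.
  have bA : base A u.
    rewrite /base sA Au /=; have -> : twin A = setT; last exact: subsetT.
    by apply/eqP; rewrite eqEcard subsetT cardsT card_ord card_twin // cA; lia.
  have nT : u != setT by apply: (admissible_neq_setT _ cT Tu).
  by rewrite /lap_in /lap -(base_uniq nT bA (base_ofP nT)) andbN.
by rewrite !h ?(subset_trans AF) ?subsetIl ?subsetIr.
Qed.

(** * Contracting the edge between vertices 1 and 2 *)

Section Contraction.
Variables (M d : nat).
Hypothesis hM : (1 < M)%N.
Local Notation N := M.+2.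
Local Notation V := 'I_M.+2.
Local Notation W := 'I_M.+1.
Implicit Types (A B C F G Z s u : {set V}) (x y z : V) (T : {set {set V}}).

Definition vtx1 : V := inord 1.
Definition vtx2 : V := inord 2.

Lemma val_vtx1 : vtx1 = 1%N :> nat. Proof. by rewrite inordK. Qed.
Lemma val_vtx2 : vtx2 = 2 :> nat. Proof. by rewrite inordK // ltnS ltnW. Qed.

(** Vertices 1 and 2 are merged into vertex 1 of the smaller circle. This edge
is away from vertex 0 because laps are counted there and have to survive the
contraction. *)
Definition contract x : W := inord (unbump 1 x).

Lemma val_contract x : contract x = unbump 1 x :> nat.
Proof. by rewrite inordK // /unbump; have := ltn_ord x; case: ltnP; lia. Qed.

Lemma vtx12_neq : vtx1 != vtx2.
Proof. by rewrite -val_eqE /= val_vtx1 val_vtx2. Qed.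

Lemma contract_vtx12 : contract vtx1 = contract vtx2.
Proof. by apply: ord_inj; rewrite !val_contract val_vtx1 val_vtx2. Qed.

Lemma contract_eq x y : contract x = contract y -> x != y ->
  (x == vtx1) && (y == vtx2) || (x == vtx2) && (y == vtx1).
Proof.
move/(congr1 (@nat_of_ord _)); rewrite !val_contract -!val_eqE /= val_vtx1 val_vtx2 /unbump.
by case: ltnP => ?; case: ltnP => ?; lia.
Qed.

Lemma contract_ordS x : x != vtx1 -> contract (ordS x) = ordS (contract x).
Proof.
move=> xp; have [->|xM] := eqVneq x ord_max.
  rewrite ordS_max; have -> : contract ord_max = ord_max.
    by apply: ord_inj; rewrite val_contract /unbump /=; case: ltnP; lia.
  by rewrite ordS_max; apply: ord_inj; rewrite val_contract.
have x1 : (x : nat) <> 1%N by move=> e; case/eqP: xp; apply: ord_inj; rewrite val_vtx1.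
apply: ord_inj; rewrite val_contract val_ordS // val_ordS ?val_contract /unbump; first by lia.
have xlt : (x < M.+1)%N.
  rewrite ltn_neqAle -ltnS ltn_ord andbT; apply: contra_neq xM => e.
  exact: ord_inj.
rewrite -val_eqE /= val_contract /unbump; lia.
Qed.

Lemma vtx1_neq_max : vtx1 != ord_max.
Proof. by rewrite -val_eqE /= val_vtx1; lia. Qed.

Lemma ordS_vtx1 : ordS vtx1 = vtx2.
Proof. by apply: ord_inj; rewrite val_ordS ?vtx1_neq_max // val_vtx1 val_vtx2. Qed.

Lemma contract_ordS_vtx1 : contract (ordS vtx1) = contract vtx1.
Proof. by rewrite ordS_vtx1 contract_vtx12. Qed.

Lemma contract_lt x y : (contract x < contract y)%N -> (x < y)%N.
Proof. by rewrite !val_contract /unbump; lia. Qed.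

Lemma contract_eq0 x : (contract x == ord0) = (x == ord0).
Proof. by rewrite -!val_eqE /= val_contract /unbump; lia. Qed.

Definition has12 s := (vtx1 \in s) && (vtx2 \in s).

Lemma contract_inj s : ~~ has12 s -> {in s &, injective contract}.
Proof.
move=> nb x y xs ys e; apply/eqP; apply: contraR nb => /(contract_eq e).
by case/orP => /andP[/eqP ex /eqP ey]; rewrite /has12 -ex -ey xs ys.
Qed.

(** The copy in s of a set A of contracted vertices; s is meant to contain at
most one of the vertices 1 and 2. *)
Definition pull s (A : {set W}) := s :&: contract @^-1: A.

Lemma pull_sub s (A : {set W}) : pull s A \subset s.
Proof. exact: subsetIl. Qed.

Lemma contract_pull s (A : {set W}) : A \subset contract @: s -> contract @: pull s A = A.
Proof.
move=> As; apply/eqP; rewrite eqEsubset; apply/andP; split; apply/subsetP => y.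
  by case/imsetP => x; rewrite !inE => /andP[_ xA] ->.
move=> yA; move: (subsetP As y yA) => /imsetP[x xs e].
by apply/imsetP; exists x => //; rewrite !inE xs -e.
Qed.

Lemma pull_card s (A : {set W}) : ~~ has12 s -> A \subset contract @: s -> #|pull s A| = #|A|.
Proof.
move=> nb As; rewrite -[in RHS](contract_pull As) card_in_imset //.
by move=> x y xs ys; apply: (contract_inj nb); apply: (subsetP (pull_sub s A)).
Qed.

Lemma pull_sep s (A : {set W}) : ~~ has12 s -> sep A -> sep (pull s A).
Proof.
move=> nb /sepP sA; apply/sepP => x xA; apply/negP => xSA.
have [xp|xp] := eqVneq x vtx1.
  rewrite xp in xA xSA; have e : vtx1 = ordS vtx1.
    apply: (contract_inj nb (subsetP (pull_sub _ _) _ xA) (subsetP (pull_sub _ _) _ xSA)).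
    by rewrite contract_ordS_vtx1.
  by move: (ordS_ordS_neq (M := M.+1) (ltnW hM) vtx1); rewrite -e -e eqxx.
move: xA xSA; rewrite !inE contract_ordS // => /andP[_ /sA h] /andP[_ h'].
by rewrite h' in h.
Qed.

Lemma pull0 s (A : {set W}) : A \subset contract @: s -> (ord0 \in pull s A) = (ord0 \in A).
Proof.
move=> As; rewrite !inE; have -> : contract ord0 = ord0 by apply/eqP; rewrite contract_eq0.
rewrite andb_idl // => /(subsetP As)/imsetP[x xs e].
by have/eqP := esym e; rewrite contract_eq0 => /eqP <-.
Qed.

(** Simplices that contain the contracted edge degenerate and disappear. *)
Definition contract_all T : {set {set W}} :=
  [set contract @: (s : {set V}) | s in T & ~~ has12 s].

Lemma contract_allP T (s' : {set W}) : reflect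
  (exists s : {set V}, [/\ s \in T, ~~ has12 s & s' = contract @: s]) (s' \in contract_all T).
Proof.
apply: (iffP imsetP) => [[s]|[s [sT nb ->]]].
  by rewrite inE => /andP[sT nb] ->; exists s.
by exists s => //; rewrite inE sT.
Qed.

Lemma alternating_lift (s1 s2 : {set V}) (w : seq W) :
  alternating (contract @: s1) (contract @: s2) w -> sorted (@ltord _) w ->
  exists w', [/\ alternating s1 s2 w', sorted (@ltord _) w' & map contract w' = w].
Proof.
elim: w s1 s2 => [|y w IH] s1 s2 /=; first by exists [::].
case/andP=> /imsetP[x xs ->] aw pw.
have [w' [a' so e]] := IH _ _ aw (path_sorted pw).
exists (x :: w'); split; rewrite /= ?xs ?e //.
case: w' e so {a'} => //= z w' e -> ; rewrite andbT.
by move: pw; rewrite -e /= => /andP[/contract_lt].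
Qed.

Lemma contract_setD1 s x : ~~ has12 s -> x \in s ->
  contract @: (s :\ x) = contract @: s :\ contract x.
Proof.
move=> nb xs; apply/setP => y; rewrite !inE; apply/imsetP/andP => [[z]|[yx /imsetP[z zs e]]].
  rewrite !inE => /andP[zx zs] ->; split; last exact: imset_f.
  by apply: contra_neq zx => /(contract_inj nb zs xs).
by exists z => //; rewrite !inE zs andbT; apply: contra_neq yx => <-.
Qed.

Lemma contract_drop12 s : has12 s -> contract @: (s :\ vtx1) = contract @: s /\
  contract @: (s :\ vtx2) = contract @: s.
Proof.
case/andP=> ps qs; split; apply/eqP; rewrite eqEsubset imsetS ?subD1set //=.
  apply/subsetP => _ /imsetP[x xs ->]; have [->|xp] := eqVneq x vtx1.
    by rewrite contract_vtx12 imset_f // !inE qs eq_sym vtx12_neq.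
  by rewrite imset_f // !inE xp.
apply/subsetP => _ /imsetP[x xs ->]; have [->|xp] := eqVneq x vtx2.
  by rewrite -contract_vtx12 imset_f // !inE ps vtx12_neq.
by rewrite imset_f // !inE xp.
Qed.

(** The vertex x would be opposite to 1 with respect to s minus 1, and opposite
to 2 with respect to s minus 2. As 1 and 2 are consecutive, the parities of
their ranks differ, while x has the same rank in both facets (or precedes both
vertices). *)
Lemma no_twist T s x : admissible d T -> s \in T -> has12 s -> x \notin s ->
  x |: (s :\ vtx1) \in T -> x |: (s :\ vtx2) \in T -> False.
Proof.
move=> cT Ts /andP[ps qs] xs T1 T2; case: (cT) => C0 _ _ _.
have xp : vtx1 != x by apply: contraNneq xs => <-.
have xq : vtx2 != x by apply: contraNneq xs => <-.
have cF e : e \in s -> #|s :\ e| = (2 * d)%N.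
  by move=> es; have := C0 _ Ts; rewrite (cardsD1 e) es => -[].
have h e : e \in s -> e != x -> x |: (s :\ e) \in T -> odd (rk (s :\ e) e) != odd (rk (s :\ e) x).
  move=> es ex Te; apply: (admissible_opposite cT) => //; rewrite ?cF ?inE ?eqxx ?setD1K //.
  by rewrite (negbTE xs) andbF.
have := h _ qs xq T2; have := h _ ps xp T1.
have rD e y : e \in s -> rk s y = (rk (s :\ e) y + (e < y))%N.
  by move=> es; rewrite -{1}(setD1K es) rkU1 // !inE eqxx.
have := rD vtx1 vtx1 ps; have := rD vtx2 vtx2 qs; have := rD vtx1 x ps; have := rD vtx2 x qs.
rewrite !ltnn !addn0 => h1 h2 <- <-.
have -> : rk s vtx2 = (rk s vtx1).+1.
  by rewrite -{1}ordS_vtx1 rk_ordS ?ps ?addn1 // vtx1_neq_max.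
have [x0|x0] := posnP x.
  have ex : x = ord0 by apply: ord_inj.
  have -> : rk s vtx1 = 0%N.
    have e : vtx1 = ordS ord0 by apply: ord_inj; rewrite val_ordS ?val_vtx1.
    rewrite e rk_ordS // -ex (negbTE xs) addn0 ex /rk (_ : [set _ in _ | _] = set0) ?cards0 //.
    by apply/setP => y; rewrite !inE ltn0 andbF.
  move: h2; rewrite {1}/rk (_ : [set _ in _ | _] = set0) ?cards0 ?ex //; last first.
    by apply/setP => y; rewrite !inE ltn0 andbF.
  by move=> /esym/eqP; rewrite addn_eq0 => /andP[/eqP-> _].
have xv : (2 < x)%N.
  move: xp xq; rewrite -!val_eqE /= val_vtx1 val_vtx2; lia.
rewrite val_vtx1 (ltnW xv) addn1 in h2; rewrite val_vtx2 xv addn1 in h1.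
have : rk (s :\ vtx1) x = rk (s :\ vtx2) x by move: h1; rewrite h2 => -[].
move=> -> /=; by do 2!case: odd.
Qed.

(** Only the existence of neighbours needs an argument. If the neighbour u of s
does not contain the edge, its image is the neighbour; if it does, u collapses
onto the facet, and the neighbour of u across the other facet with the same
image takes its place. *)
Lemma contract_admissible T : admissible d T -> admissible d (contract_all T).
Proof.
move=> cT; case: (cT) => C0 C1 C2 C3; split.
- move=> _ /contract_allP[s [sT nb ->]]; rewrite card_in_imset ?C0 //; exact: contract_inj.
- move=> _ A /contract_allP[s [sT nb ->]] sA As; rewrite -(pull_card nb As).
  by apply: C1 sT _ (pull_sub _ _); apply: pull_sep.
- move=> _ _ /contract_allP[s [sT nb ->]] /contract_allP[s' [s'T nb' ->]] [w [so sz /orP[] a]].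
    have [w' [a' so' e]] := alternating_lift a so; apply: (C2 _ _ sT s'T).
    by exists w'; split; rewrite ?a' // -(size_map contract) e.
  have [w' [a' so' e]] := alternating_lift a so; apply: (C2 _ _ sT s'T).
  by exists w'; split; rewrite ?a' ?orbT // -(size_map contract) e.
move=> _ x' A /contract_allP[s [sT nb ->]] /imsetP[x xs ->] sA cA As.
have nbD : ~~ has12 (s :\ x).
  by apply: contraNN nb => /andP[]; rewrite !inE /has12 => /andP[_ ->] /andP[].
rewrite -contract_setD1 // in As *.
have [y ys yT] : exists2 y, y \notin s & y |: (s :\ x) \in T.
  apply: C3 sT xs (pull_sep nbD sA) _ (pull_sub _ _); by rewrite pull_card.
have yx : y != x by apply: contraNneq ys => ->.
have ysx : y \notin s :\ x by rewrite !inE (negbTE ys) andbF.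
have xsx : x \notin s :\ x by rewrite !inE eqxx.
have cF : #|s :\ x| = (2 * d)%N.
  by have := C0 _ sT; rewrite (cardsD1 x) xs => -[].
(* If contract y were in the image of s, then, as u lacks the edge, {x, y}
would be the edge; but x and y are on opposite sides of the facet, while 1 and
2 are on the same side of a facet that contains neither. *)
have [bu|nbu] := boolP (has12 (y |: (s :\ x))); last first.
  exists (contract y); last by apply/contract_allP; exists (y |: (s :\ x)); rewrite imsetU1.
  apply/imsetP => -[z zs e]; have yz : y != z by apply: contraNneq ys => ->.
  have := contract_eq e yz.
  have [zx|zx] := eqVneq z x; last first.
    case/orP=> /andP[/eqP ey /eqP ez]; move: nbu; rewrite /has12 -ey -ez !inE eqxx zs zx ?orbT //.
  rewrite zx => h.
  have xT : x |: (s :\ x) \in T by rewrite setD1K.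
  have := admissible_opposite cT cF yx ysx xsx yT xT.
  have rr : vtx1 \notin s :\ x -> rk (s :\ x) vtx1 = rk (s :\ x) vtx2.
    by move=> /negbTE np; rewrite -ordS_vtx1 rk_ordS ?np ?addn0 // vtx1_neq_max.
  case/orP: h => /andP[/eqP ey /eqP ex]; rewrite ey ex in ysx xsx rr *.
    by rewrite rr ?eqxx.
  by rewrite rr ?eqxx.
set u := y |: (s :\ x) in bu yT *.
(* y is one end e of the edge, and its other end e' is in s. *)
have [e [e' [eu e'u eT]]] : exists e e', [/\ y = e, e' \in s :\ x &
   ((e == vtx1) && (e' == vtx2)) || ((e == vtx2) && (e' == vtx1))].
  have [pu qu] := andP bu; move: pu qu; rewrite /u !in_setU1.
  have [ey|yp] := eqVneq vtx1 y.
    by rewrite -ey eq_sym (negbTE vtx12_neq) /= => _ qs; exists vtx1, vtx2; rewrite !eqxx.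
  have [ey|yq] := eqVneq vtx2 y.
    by move=> /= ps _; exists vtx2, vtx1; rewrite !eqxx orbT.
  rewrite !inE /= => /andP[_ ps] /andP[_ qs].
  by case/negP: nb; rewrite /has12 ps qs.
have e'y : e' != y by apply: contraNneq ysx => <-.
have nbue : ~~ has12 (u :\ e').
  by case/orP: eT => /andP[_ /eqP->]; rewrite /has12 !inE eqxx ?andbF.
have eim : contract @: (u :\ e') = contract @: (s :\ x).
  have -> : contract @: (u :\ e') = contract @: u.
    by case/orP: eT => /andP[_ /eqP->]; case: (contract_drop12 bu).
  rewrite /u imsetU1; apply/setUidPr; rewrite sub1set.
  have -> : contract y = contract e'.
    by rewrite eu; case/orP: eT => /andP[/eqP-> /eqP->]; rewrite contract_vtx12.
  exact: imset_f.
have e'U : e' \in u by rewrite !inE; move: e'u; rewrite !inE => ->; rewrite orbT.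
have [z zu zT] : exists2 z, z \notin u & z |: (u :\ e') \in T.
  apply: C3 yT e'U (pull_sep nbue sA) _ (pull_sub _ A); by rewrite pull_card ?eim.
have zp : z != vtx1 by apply: contraNneq zu => ->; case/andP: bu.
have zq : z != vtx2 by apply: contraNneq zu => ->; case/andP: bu.
have ze' : z != e' by apply: contraNneq zu => ->.
exists (contract z); last first.
  apply/contract_allP; exists (z |: (u :\ e')); rewrite imsetU1 eim; split=> //.
  by case/orP: eT => /andP[_ /eqP e'E]; rewrite /has12 !inE -e'E eqxx (eq_sym e') (negbTE ze')
    ?andbF.
(* If z were in s it would be x, and then u would have the twisted pair of
neighbours. *)
apply/imsetP => -[v vs e1]; have zv : z = v.
  apply/eqP; apply: contraT => /(contract_eq e1).
  by rewrite (negbTE zp) (negbTE zq).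
rewrite -zv in vs; have zx : z = x.
  by apply/eqP; apply: contraNT zu => zx; rewrite !inE vs zx orbT.
have sE : x |: (u :\ y) \in T.
  by rewrite /u setU1K // setD1K.
rewrite zx in zT zu.
apply: (no_twist cT yT bu zu).
  by case/orP: eT => /andP[/eqP e0 /eqP e'0]; [move: sE; rewrite eu e0|move: zT; rewrite e'0].
by case/orP: eT => /andP[/eqP e0 /eqP e'0]; [move: zT; rewrite e'0|move: sE; rewrite eu e0].
Qed.

(** Bases are computed by walking along the circle, and contraction respects
steps other than the one from 1 to 2. A discrepancy at 0 would propagate
backwards to all other vertices, so that each contracted vertex would be in the
base of s or of its image; then the image of s would be the whole circle. *)
Lemma base_of_contract T s : ((2 * d).+2 <= M.+1)%N -> admissible d T -> s \in T -> ~~ has12 s ->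
  (ord0 \in base_of s) = (ord0 \in base_of (contract @: s)).
Proof.
move=> hN cT sT nb; have cT' := contract_admissible cT.
have sT' : contract @: s \in contract_all T by apply/contract_allP; exists s.
have b := base_ofP (admissible_neq_setT (leqW hN) cT sT).
have b' := base_ofP (admissible_neq_setT hN cT' sT').
have c0 : contract ord0 = ord0 by apply/eqP; rewrite contract_eq0.
apply/eqP/negPn/negP => n0.
pose P x := (x == vtx1) || ((x \in base_of s) != (contract x \in base_of (contract @: s))).
have memS x : x != vtx1 -> ordS x != vtx1 -> x != ord0 ->
    (ordS x \in s) = (ordS (contract x) \in contract @: s).
  move=> xp Sp x0; rewrite -contract_ordS //; apply/idP/imsetP => [xs|[z zs e]];
    first by exists (ordS x).
  have [->//|zx] := eqVneq (ordS x) z.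
  have := contract_eq e zx; rewrite (negbTE Sp) /= => /andP[/eqP e2 _].
  by move: e2; rewrite -ordS_vtx1 => /ordS_inj/eqP; rewrite (negbTE xp).
have all x : P x.
  apply: (@ord_pred_ind _ P ord0) => [|{}x]; first by rewrite /P c0 n0 orbT.
  rewrite /P; have [//|xp /=] := eqVneq x vtx1.
  have [->|x0] := eqVneq x ord0; first by rewrite c0 n0.
  have Sp : ordS x != vtx1.
    apply: contra_neq x0 => e; have : ordS x = ordS ord0.
      by rewrite e; apply: ord_inj; rewrite val_ordS ?val_vtx1.
    exact: ordS_inj.
  rewrite (negbTE Sp) /= (base_ordS x b) contract_ordS // (base_ordS _ b') memS //.
  by apply: contra_neq => ->.
have : contract @: s = setT.
  apply/setP => y'; rewrite inE.
  have e : contract (lift vtx1 y') = y'.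
    by apply: ord_inj; rewrite val_contract /= val_vtx1 bumpK.
  have := all (lift vtx1 y'); rewrite /P e eq_sym (negbTE (neq_lift _ _)) /=.
  case/and3P: b => _ /subsetP bs _; case/and3P: b' => _ /subsetP bs' _.
  have [/bs ls _|_] := boolP (lift vtx1 y' \in base_of s).
    by apply/imsetP; exists (lift vtx1 y').
  by rewrite eq_sym eqbF_neg negbK => /bs'.
by apply/eqP; apply: (admissible_neq_setT hN cT' sT').
Qed.
End Contraction.

(** * Existence of height functions *)

Section HeightStep.
Variables (M d : nat).
Hypothesis hM : (1 < M)%N.
Hypothesis hN : ((2 * d).+2 <= M.+1)%N.
Hypothesis d0 : (0 < d)%N.
Local Notation V := 'I_M.+2.
Local Notation W := 'I_M.+1.
Variable T : {set {set V}}.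
Hypothesis cT : admissible d T.
Variable k' : {set W} -> int.
Hypothesis hk' : valid_heights d k' (contract_all T).
Implicit Types (A B C F G Z s u : {set V}) (x y z : V).
Local Notation c s := (@contract M @: s).
Local Notation has12 := (@has12 M).

Let hM' : (1 < M.+1)%N := ltnW hM.
Let hN' : ((2 * d).+2 <= M.+2)%N := leqW hN.

Let contract_mem s : s \in T -> ~~ has12 s -> c s \in contract_all T.
Proof. by move=> sT nb; apply/contract_allP; exists s. Qed.

Let cardT s : s \in T -> #|s| = (2 * d).+1.
Proof. by case: cT => C0 _ _ _; apply: C0. Qed.

Lemma lap_in_contract s F (A : {set W}) : s \in T -> ~~ has12 s -> A \subset c F ->
  lap_in s (pull F A) = lap_in (c s) A.
Proof.
by move=> sT nb AF; rewrite /lap_in /lap (pull0 hM AF) (base_of_contract hM hN cT sT nb).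
Qed.

Lemma adjacent_split s1 s2 : s1 \in T -> s2 \in T -> s1 != s2 -> #|s1 :&: s2| = (2 * d)%N ->
  exists x y, [/\ x != y, x \notin s1 :&: s2, y \notin s1 :&: s2,
    s1 = x |: (s1 :&: s2) & s2 = y |: (s1 :&: s2)].
Proof.
move=> T1 T2 n cF.
have [x xF e1] := setU1_of_card (subsetIl s1 s2) (etrans (cardT T1) (congr1 succn (esym cF))).
have [y yF e2] := setU1_of_card (subsetIr s1 s2) (etrans (cardT T2) (congr1 succn (esym cF))).
exists x, y; split=> //; apply: contra_neq n => xy.
by rewrite e1 [in RHS]e2 xy.
Qed.

(** Adjacent simplices of the contraction lie on opposite sides of their common
facet G, so G contains an arc, and there the heights agree. *)
Lemma agree_contracted s1 s2 x y (G : {set W}) : s1 \in T -> s2 \in T ->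
  ~~ has12 s1 -> ~~ has12 s2 -> c s1 = contract x |: G -> c s2 = contract y |: G ->
  #|G| = (2 * d)%N -> contract x \notin G -> contract y \notin G -> contract x != contract y ->
  exists A : {set W}, [/\ sep A, #|A| = d.+1, A \subset G &
    (k' (c s1) + (lap_in (c s1) A)%:Z = k' (c s2) + (lap_in (c s2) A)%:Z)%R].
Proof.
move=> T1 T2 b1 b2 e1 e2 cG xG yG xy.
have cT' := contract_admissible hM cT.
have T1' := contract_mem T1 b1; have T2' := contract_mem T2 b2.
have o : odd (rk G (contract x)) != odd (rk G (contract y)).
  by apply: (admissible_opposite cT'); rewrite -?e1 -?e2.
have [A [sA cA AG]] := opposite_sides_sep cG xG yG o; exists A; split=> //.
have eG : c s1 :&: c s2 = G by rewrite e1 e2 setI_setU1.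
apply: (hk' T1' T2') => //; rewrite ?eG //.
by rewrite e1 e2; apply: contraNneq xG => /setP/(_ (contract x));
  rewrite !inE eqxx (negbTE xy) /= => <-.
Qed.

Definition pulled_height s := k' (c s).

Lemma agree_neither s1 s2 : s1 \in T -> s2 \in T -> s1 != s2 -> #|s1 :&: s2| = (2 * d)%N ->
  ~~ has12 s1 -> ~~ has12 s2 -> agree d pulled_height s1 s2.
Proof.
move=> T1 T2 n cF b1 b2.
have [e A sA cA AF|ne] := eqVneq (c s1) (c s2).
  by rewrite /pulled_height /lap_in /lap !(base_of_contract hM hN cT) // e.
have [x [y [xy xF yF e1 e2]]] := adjacent_split T1 T2 n cF.
set F := s1 :&: s2 in cF xF yF e1 e2.
have bF : ~~ has12 F by apply: contraNN b1 => /andP[p q]; rewrite /has12 e1 !in_setU1 p q !orbT.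
have ce1 : c s1 = contract x |: c F by rewrite [in LHS]e1 imsetU1.
have ce2 : c s2 = contract y |: c F by rewrite [in LHS]e2 imsetU1.
have cF' : #|c F| = (2 * d)%N by rewrite card_in_imset //; apply: contract_inj.
have cxF s z : ~~ has12 s -> s = z |: F -> z \notin F -> contract z \notin c F.
  move=> bs es zF; apply/imsetP => -[v vF e]; case/negP: zF.
  by rewrite (contract_inj hM bs _ _ e) // es in_setU1 ?eqxx ?vF ?orbT.
have xF' := cxF _ _ b1 e1 xF; have yF' := cxF _ _ b2 e2 yF.
have xy' : contract x != contract y by apply: contra_neq ne => e; rewrite ce1 ce2 e.
have [A [sA cA AG eq]] := agree_contracted T1 T2 b1 b2 ce1 ce2 cF' xF' yF' xy'.
apply: (agree_of_one hM' hN' cT T1 T2 (A := pull F A)).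
- exact: pull_sep.
- by rewrite pull_card.
- exact: pull_sub.
- by rewrite !lap_in_contract.
Qed.

(** A neighbour f.1 of s that does not contain the edge, with an arc f.2 in the
common facet; it forces the height of s to be [witness_height s f]. *)
Definition witness s (f : {set V} * {set V}) :=
  [&& f.1 \in T, ~~ has12 f.1, #|s :&: f.1| == (2 * d)%N, sep f.2, #|f.2| == d.+1 &
      f.2 \subset s :&: f.1].

Definition witness_height s (f : {set V} * {set V}) : int :=
  (pulled_height f.1 + (lap_in f.1 f.2)%:Z - (lap_in s f.2)%:Z)%R.

Lemma facet_cases s s' : s \in T -> has12 s -> ~~ has12 s' -> #|s :&: s'| = (2 * d)%N ->
  s :&: s' = s :\ vtx1 M \/ s :&: s' = s :\ vtx2 M.
Proof.
move=> Ts /andP[ps qs] b c; have cD e : e \in s -> #|s :\ e| = (2 * d)%N.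
  by move=> es; have := cardT Ts; rewrite (cardsD1 e) es => -[].
move: b; rewrite /has12 negb_and => /orP[]h; [left|right]; apply/eqP.
  by rewrite eqEcard c cD // leqnn andbT subsetD1 subsetIl !inE (negbTE h) andbF.
by rewrite eqEcard c cD // leqnn andbT subsetD1 subsetIl !inE (negbTE h) andbF.
Qed.

(** The neighbours of s across s minus 1 and across s minus 2 become adjacent
when s is contracted to their common facet, so the values that they force are
the same; they are distinct after the contraction by [no_twist]. *)
Lemma witness_height12 s f g : s \in T -> has12 s -> witness s f -> witness s g ->
  s :&: f.1 = s :\ vtx1 M -> s :&: g.1 = s :\ vtx2 M -> witness_height s f = witness_height s g.
Proof.
move=> Ts bs; case: f => s2 A2; case: g => s3 A3 /=.
case/and5P=> /= T2 b2 /eqP c2 sA2 /andP[/eqP cA2 A2s].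
case/and5P=> /= T3 b3 /eqP c3 sA3 /andP[/eqP cA3 A3s] e2 e3.
have [ps qs] := andP bs.
have ext s' e : s' \in T -> ~~ has12 s' -> e \in s -> #|s :&: s'| = (2 * d)%N ->
  s :&: s' = s :\ e ->
    exists2 x, x \notin s & s' = x |: (s :\ e).
  move=> T' b' es c' e'.
  have [x xF ex] := setU1_of_card (subsetIr s s') (etrans (cardT T') (congr1 succn (esym c'))).
  rewrite e' in xF ex; exists x => //; apply: contraNN b' => xs.
  have xe : x = e by move: xF; rewrite !inE xs andbT negbK => /eqP.
  by rewrite ex xe setD1K.
have [x xs ex] := ext _ _ T2 b2 ps c2 e2.
have [y ys ey] := ext _ _ T3 b3 qs c3 e3.
have nxy : x != y.
  apply/eqP => xy; rewrite -xy in ey.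
  by apply: (no_twist hM cT Ts bs xs); rewrite -?ex -?ey.
have nin z : z \notin s -> (z == vtx1 M = false) * (z == vtx2 M = false).
  by move=> zs; split; apply/negbTE; apply: contraNneq zs => ->.
have [cp cq] := contract_drop12 hM bs.
have bp : ~~ has12 (s :\ vtx1 M) by rewrite /has12 !inE eqxx.
have bq : ~~ has12 (s :\ vtx2 M) by rewrite /has12 !inE eqxx andbF.
have cG : #|c s| = (2 * d)%N.
  by rewrite -cp card_in_imset -?e2 //; rewrite e2; apply: contract_inj.
have cout z : z \notin s -> contract z \notin c s.
  move=> zs; apply/imsetP => -[v vs e].
  have zv : z != v by apply: contraNneq zs => ->.
  by have := contract_eq hM e zv; rewrite !(nin _ zs).
have cxy : contract x != contract y.
  by apply/eqP => e; have := contract_eq hM e nxy; rewrite !(nin _ xs).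
have ce2 : c s2 = contract x |: c s by rewrite ex imsetU1 cp.
have ce3 : c s3 = contract y |: c s by rewrite ey imsetU1 cq.
have [A [sA cA AG eq]] := agree_contracted T2 T3 b2 b3 ce2 ce3 cG (cout _ xs) (cout _ ys) cxy.
have Ap : A \subset c (s :\ vtx1 M) by rewrite cp.
have Aq : A \subset c (s :\ vtx2 M) by rewrite cq.
rewrite -!(lap_in_contract T2 b2 Ap) -!(lap_in_contract T3 b3 Aq) in eq.
have os : lap_in s (pull (s :\ vtx1 M) A) = lap_in s (pull (s :\ vtx2 M) A).
  by rewrite /lap_in /lap !(pull0 hM).
have h2 := lap_in_diff hM' hN' cT Ts T2 sA2 (pull_sep hM bp sA) cA2
  (etrans (pull_card hM bp Ap) cA) A2s.
rewrite e2 pull_sub in h2; have {h2} := h2 isT.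
have h3 := lap_in_diff hM' hN' cT Ts T3 sA3 (pull_sep hM bq sA) cA3
  (etrans (pull_card hM bq Aq) cA) A3s.
rewrite e3 pull_sub in h3; have {h3} := h3 isT.
move: eq; rewrite os /witness_height /pulled_height /=; clear.
set a := k' _; set b := k' _; move: a b => a b.
move: (lap_in s2 _) (lap_in s3 _) (lap_in s _) (lap_in s _) (lap_in s2 _) (lap_in s _)
  (lap_in s3 _) => *; lia.
Qed.

(** Two witnesses with the same facet are the same simplex; with different
facets, [witness_height12] applies. *)
Lemma witness_height_uniq s f g : s \in T -> has12 s -> witness s f -> witness s g ->
  witness_height s f = witness_height s g.
Proof.
move=> Ts bs vf vg.
have cf : #|s :&: f.1| = (2 * d)%N by case/and5P: vf => _ _ /eqP.
have cg : #|s :&: g.1| = (2 * d)%N by case/and5P: vg => _ _ /eqP.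
have bf : ~~ has12 f.1 by case/and5P: vf.
have bg : ~~ has12 g.1 by case/and5P: vg.
have Tf : f.1 \in T by case/and5P: vf.
have Tg : g.1 \in T by case/and5P: vg.
have same : s :&: f.1 = s :&: g.1 -> witness_height s f = witness_height s g.
  move=> e; have efg : f.1 = g.1.
    apply: (admissible_neighbour_uniq (F := s :&: f.1) cT cf Ts Tf Tg);
      rewrite ?subsetIl ?subsetIr //.
    - by rewrite e subsetIr.
    - by apply: contraNneq bf => <-.
    - by apply: contraNneq bg => <-.
  case/and5P: vf => _ _ _ sA2 /andP[/eqP cA2 A2s].
  case/and5P: vg => _ _ _ sA3 /andP[/eqP cA3 A3s].
  rewrite -e in A3s.
  have := lap_in_diff hM' hN' cT Ts Tf sA2 sA3 cA2 cA3 A2s A3s.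
  rewrite /witness_height /pulled_height -efg; clear; set a := k' _; move: a => a.
  move: (lap_in s _) (lap_in s _) (lap_in f.1 _) (lap_in f.1 _) => *; lia.
have [ef|ef] := facet_cases Ts bs bf cf; have [eg|eg] := facet_cases Ts bs bg cg.
- by apply: same; rewrite ef eg.
- exact: witness_height12.
- by apply/esym; apply: witness_height12.
- by apply: same; rewrite ef eg.
Qed.

(** A simplex with the edge but without witness has no arc in its facets
towards simplices that lack the edge, and the value 0 is a default. *)
Definition height s : int :=
  if has12 s then if [pick f | witness s f] is Some f then witness_height s f else 0%R else
    pulled_height s.

Lemma agree_left s1 s2 : s1 \in T -> s2 \in T -> #|s1 :&: s2| = (2 * d)%N ->
  has12 s1 -> ~~ has12 s2 -> agree d height s1 s2.
Proof.
move=> T1 T2 cF b1 b2 A sA cA AF.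
have v : witness s1 (s2, A) by rewrite /witness /= T2 b2 cF sA cA AF !eqxx.
rewrite /height b1 (negbTE b2); case: pickP => [f vf|/(_ (s2, A))]; last by rewrite v.
by rewrite (witness_height_uniq T1 b1 vf v) /witness_height /= subrK.
Qed.

Lemma agree_not_both s1 s2 : s1 \in T -> s2 \in T -> s1 != s2 -> #|s1 :&: s2| = (2 * d)%N ->
  ~~ (has12 s1 && has12 s2) -> agree d height s1 s2.
Proof.
move=> T1 T2 n cF; case: (boolP (has12 s1)) => b1 /= b2.
  exact: agree_left.
case: (boolP (has12 s2)) => b2'.
  by apply: agree_sym; apply: agree_left => //; rewrite setIC.
have := agree_neither T1 T2 n cF b1 b2'.
by move=> h A sA cA AF; rewrite /height (negbTE b1) (negbTE b2'); apply: h.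
Qed.

(** Let e be an end of the edge outside the arc A, let K be the common facet
minus e, and let X be the set of simplices that contain K and give A the same
level as s1. Count the pairs (u, z) with u in X and z in u minus K. Each u has
two such z. For z other than e, as K + z contains A, it lies in no simplex of X
or in exactly two simplices; these do not both contain the edge, so they agree,
and both are in X if one is. If s2 were not in X, then z = e would occur in s1
only, and the total would be odd. *)
Lemma agree_both s1 s2 : s1 \in T -> s2 \in T -> s1 != s2 -> #|s1 :&: s2| = (2 * d)%N ->
  has12 s1 -> has12 s2 -> agree d height s1 s2.
Proof.
move=> T1 T2 n cF b1 b2 A sA cA AF.
pose g u : int := (height u + (lap_in u A)%:Z)%R; rewrite -/(g s1) -/(g s2).
set F := s1 :&: s2 in cF AF.
have [e [eA eF be]] : exists e, [/\ e \notin A, e \in F & forall u, has12 u -> e \in u].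
  have [pA|pA] := boolP (vtx1 M \in A); last first.
    by exists (vtx1 M); split=> // [|u /andP[]//]; rewrite inE; case/andP: b1 => ->;
      case/andP: b2 => ->.
  exists (vtx2 M); split=> // [||u /andP[]//]; first by rewrite -(ordS_vtx1 hM) (sepP _ sA).
  by rewrite inE; case/andP: b1 => _ ->; case/andP: b2 => _ ->.
(* A codimension-two face that contains A but not the edge. *)
pose K := F :\ e.
have eK : e \notin K by rewrite !inE eqxx.
have AK : A \subset K by rewrite subsetD1 AF.
have cK : #|K|.+1 = (2 * d)%N by rewrite -cF (cardsD1 e F) eF.
have KF : e |: K = F by rewrite setD1K.
have KS s : s \in T -> K \subset s -> #|s :\: K| = 2.
  move=> Ts Ks; rewrite cardsD (setIidPr Ks) (cardT Ts) -cK.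
  by rewrite subSn ?leqnSn // subSnn.
pose X := [set u in T | (K \subset u) && (g u == g s1)].
apply/eqP; rewrite eq_sym; apply: contraT => ne.
have s1X : s1 \in X by rewrite inE T1 eqxx andbT (subset_trans (subD1set _ _)) ?subsetIl.
have K2 : K \subset s2 by rewrite (subset_trans (subD1set _ _)) ?subsetIr.
have s2X : s2 \notin X by rewrite inE T2 K2.
pose nn z := #|[set u in X | z \in u]|.
(* Only s1 and s2 contain K + e, and s2 is not in X. *)
have ne1 : nn e = 1%N.
  rewrite /nn -(cards1 s1); apply: eq_card => u; rewrite !inE.
  apply/idP/eqP => [/andP[/and3P[Tu Ku gu] eu]|->]; last first.
    by move: s1X; rewrite inE => ->; move: eF; rewrite inE => /andP[].
  have Fu : F \subset u by rewrite -KF subUset sub1set eu.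
  apply/eqP; apply: contraT => us; have e2 : u = s2.
    have := admissible_neighbour_uniq cT cF T1 Tu T2 (subsetIl _ _) Fu (subsetIr _ _).
    by rewrite eq_sym us n => /(_ isT isT).
  by rewrite e2 (negbTE ne) in gu.
have nev z : z \notin K -> z != e -> ~~ odd (nn z).
  move=> zK ze; rewrite /nn; set Y := [set _ in _ | _].
  have [->|/set0Pn[u]] := eqVneq Y set0; first by rewrite cards0.
  rewrite inE => /andP[uX zu]; move: (uX); rewrite inE => /and3P[Tu Ku gu].
  have cKz : #|z |: K| = (2 * d)%N by rewrite cardsU1 zK add1n.
  have Kzu : z |: K \subset u by rewrite subUset sub1set zu.
  have [t tK ut] := setU1_of_card Kzu (etrans (cardT Tu) (congr1 succn (esym cKz))).
  have tu : t \in u by rewrite ut !inE eqxx.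
  have ut' : u :\ t = z |: K by rewrite ut setU1K.
  have AKz : A \subset z |: K by apply: subset_trans AK (subsetUr _ _).
  case: (cT) => _ _ _ C3; have [|y yu u'T] := C3 u t A Tu tu sA cA; first by rewrite ut'.
  rewrite ut' in u'T; set u' := y |: (z |: K) in u'T.
  have yt : t != y by apply: contraNneq yu => <-.
  have yK : y \notin z |: K by apply: contraNN yu; apply: (subsetP Kzu).
  have cap : u :&: u' = z |: K by rewrite ut /u' setI_setU1.
  have uu' : u != u' by apply: contraNneq yu => ->; rewrite !inE eqxx.
  have nb : ~~ (has12 u && has12 u').
    apply/negP => /andP[/be eu /be eu'].
    have et : e = t by move: eu; rewrite ut !in_setU1 eq_sym (eq_sym e z) (negbTE ze) (negbTE eK)
      /= orbF => /eqP.
    have ey : e = y by move: eu'; rewrite /u' !in_setU1 (eq_sym e z) (negbTE ze) (negbTE eK) /=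
      orbF => /eqP.
    by rewrite -et -ey eqxx in yt.
  have gg : g u = g u'.
    by apply: (agree_not_both Tu u'T uu' _ nb); rewrite ?cap.
  suff -> : Y = [set u; u'] by rewrite cards2 uu'.
  have Ku' : z |: K \subset u' by apply: subsetUr.
  apply/setP => w; rewrite !inE; apply/idP/orP => [/andP[/and3P[Tw Kw gw] zw]|].
    have [->|wu] := eqVneq w u; first by left.
    right; apply/eqP; apply: (admissible_neighbour_uniq cT cKz Tu Tw u'T) => //;
      last by rewrite eq_sym.
    by rewrite subUset sub1set zw.
  case=> /eqP->; first by rewrite Tu Ku gu zu.
  by rewrite u'T (subset_trans (subsetUr _ _) Ku') -gg gu !inE eqxx orbT.
(* Double counting. *)
have : (\sum_(u in X) #|u :\: K| = \sum_(z in ~: K) nn z)%N.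
  have -> : (\sum_(u in X) #|u :\: K| = \sum_(u in X) \sum_(z in ~: K) (z \in u))%N.
    apply: eq_bigr => u _; rewrite -sum1_card big_mkcond [in RHS]big_mkcond /=.
    by apply: eq_bigr => z _; rewrite in_setD in_setC; case: (z \in K) => //=; case: (z \in u).
  rewrite exchange_big /=; apply: eq_bigr => z _.
  rewrite /nn -sum1_card big_mkcond [in RHS]big_mkcond /=.
  by apply: eq_bigr => u _; rewrite !inE; case: (_ && _); case: (z \in u).
rewrite [in RHS](bigD1 e) /=; last by rewrite in_setC.
rewrite ne1 (eq_bigr (fun _ => 2)); last by move=> u; rewrite inE => /and3P[Tu Ku _]; apply: KS.
rewrite sum_nat_const => /(congr1 odd); rewrite oddM andbF oddD /=.
rewrite (negbTE (even_sum _)) //= => z /andP[]; rewrite in_setC => zK ze.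
exact: nev.
Qed.

Lemma has_heights_step : has_heights d T.
Proof.
exists height => s s' Ts Ts' n cF; case: (boolP (has12 s && has12 s')) => [/andP[b b']|nb].
  exact: agree_both.
exact: agree_not_both.
Qed.
End HeightStep.

(** Induction on the number of vertices, down to 2d + 2. *)
Lemma has_heights_admissible M d (T : {set {set 'I_M.+1}}) :
  (0 < d)%N -> ((2 * d).+2 <= M.+1)%N -> admissible d T -> has_heights d T.
Proof.
move=> d0; elim: M T => [|M IH] T; first by lia.
rewrite leq_eqVlt => /predU1P[e|hN] cT.
  by case: e => e; move: T cT {IH}; rewrite -e => T; apply: has_heights_min.
have hM : (1 < M)%N by lia.
have [k' hk'] := IH _ hN (contract_admissible hM cT).
exact: (has_heights_step hM hN cT hk').
Qed.

(** * Sign changes and circuits on the moment curve *)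

Section Moments.
Local Open Scope ring_scope.
Variables (R : realType) (N : nat) (t : 'I_N -> R).
Hypothesis ht : forall i j : 'I_N, (i < j)%N -> t i < t j.
Implicit Types (c : 'I_N -> R) (A E s : {set 'I_N}) (i j : 'I_N).

Definition moment (w : 'I_N -> R) k := \sum_i w i * t i ^+ k.

(** For K = m + 1 these are the affine dependences of the points of the moment
curve in dimension m. *)
Definition dependence K c := forall k, (k < K)%N -> moment c k = 0.

Definition pos_supp c := [set i | 0 < c i].
Definition neg_supp c := [set i | c i < 0].

Lemma moment_lin a c c' k : moment (fun i => c i + a * c' i) k = moment c k + a * moment c' k.
Proof.
rewrite /moment mulr_sumr -big_split; apply: eq_bigr => i _ /=.
by rewrite mulrDl mulrA.
Qed.

Lemma moment_unit i k : moment (fun j => (j == i)%:R) k = t i ^+ k.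
Proof.
rewrite /moment (bigD1 i) //= eqxx mul1r big1 ?addr0 // => j /negbTE->.
by rewrite mul0r.
Qed.

Lemma momentN c k : moment (fun i => - c i) k = - moment c k.
Proof. by rewrite /moment -sumrN; apply: eq_bigr => i _; rewrite mulNr. Qed.

Lemma dependenceN K c : dependence K c -> dependence K (fun i => - c i).
Proof. by move=> h k kK; rewrite momentN h // oppr0. Qed.

Lemma dependenceD K c c' a : dependence K c -> dependence K c' ->
  dependence K (fun i => c i + a * c' i).
Proof. by move=> h h' k kK; rewrite moment_lin h // h' // mulr0 addr0. Qed.

Lemma pos_suppN c : pos_supp (fun i => - c i) = neg_supp c.
Proof. by apply/setP => i; rewrite !inE oppr_gt0. Qed.

Lemma neg_suppN c : neg_supp (fun i => - c i) = pos_supp c.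
Proof. by apply/setP => i; rewrite !inE oppr_lt0. Qed.

Lemma t_le i j : (i <= j)%N -> t i <= t j.
Proof.
rewrite leq_eqVlt => /orP[/eqP/ord_inj->//|/ht/ltW//].
Qed.

Lemma t_inj : injective t.
Proof.
move=> i j e; apply: ord_inj; case: (ltngtP i j) => // /ht; by rewrite e ltxx.
Qed.

Lemma cut_point (j : 'I_N) : (0 < j)%N ->
  exists2 r, r < t j & forall i : 'I_N, (i < j)%N -> t i < r.
Proof.
move=> j0; have pj : (j.-1 < N)%N by rewrite (leq_ltn_trans (leq_pred j)).
have := @ht (Ordinal pj) j; rewrite /= prednK // leqnn => /(_ isT) lt.
exists ((t (Ordinal pj) + t j) / 2); first by lra.
move=> i ij; have : t i <= t (Ordinal pj) by apply: t_le; rewrite /= -ltnS prednK.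
by lra.
Qed.

(** Induction on K. Let the first nonzero weight be positive, let j be the
first index of negative weight, and let r separate t j from the points before
it. The weights times t - r have one vanishing moment less; they are
nonpositive up to j and keep their signs after j, so exactly the first sign
change is lost. *)
Lemma sign_changes K c : dependence K c -> (exists i, c i != 0) ->
  exists w : seq 'I_N, [/\ sorted (@ltord N) w, size w = K.+1 &
    alternating (pos_supp c) (neg_supp c) w || alternating (neg_supp c) (pos_supp c) w].
Proof.
elim: K c => [|K IH] c dc [i ci].
  exists [:: i]; split=> //=; rewrite !inE !andbT.
  by rewrite -neq_lt eq_sym.
(* Up to a global sign, the first nonzero weight is positive. *)
have key c' (i0 : 'I_N) : dependence K.+1 c' -> 0 < c' i0 ->
  (forall i : 'I_N, (i < i0)%N -> c' i = 0) ->
  exists w : seq 'I_N, [/\ sorted (@ltord N) w, size w = K.+2 &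
    alternating (pos_supp c') (neg_supp c') w || alternating (neg_supp c') (pos_supp c') w].
  move=> {dc ci i}{}dc ci0 c0.
  have [j0 cj0] : exists j, c' j < 0.
    apply: contrapT => h; have rest : 0 <= \sum_(i | i != i0) c' i * t i ^+ 0.
      apply: sumr_ge0 => i _; rewrite expr0 mulr1 leNgt; apply/negP => ci; by apply: h; exists i.
    have := dc 0%N isT; rewrite /moment (bigD1 i0) //= expr0 mulr1; move: rest ci0.
    by set S := \sum_(i | _) _; move: (c' i0) S => a S; lra.
  case: (arg_minnP (P := fun j => c' j < 0) (fun j : 'I_N => j : nat) cj0) => j cj jmin.
  have cge (i : 'I_N) : (i < j)%N -> 0 <= c' i.
    by move=> ij; rewrite leNgt; apply: contraL ij => /jmin; rewrite -leqNgt.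
  have i0j : (i0 < j)%N.
    rewrite ltnNge; apply/negP; rewrite leq_eqVlt => /orP[/eqP/ord_inj e|/c0 e].
      by rewrite e in cj; rewrite ltNge (ltW ci0) in cj.
    by rewrite e ltxx in cj.
  have [r rj rlt] := cut_point (leq_ltn_trans (leq0n _) i0j).
  have rge (i : 'I_N) : (j <= i)%N -> 0 < t i - r.
    by move=> /t_le h; rewrite subr_gt0; apply: lt_le_trans h.
  have rlt' (i : 'I_N) : (i < j)%N -> t i - r < 0 by move=> /rlt; rewrite subr_lt0.
  pose c1 i := c' i * (t i - r).
  have d1 : dependence K c1.
    move=> k kK; have -> : moment c1 k = moment c' k.+1 - r * moment c' k.
      rewrite /moment mulr_sumr -sumrB; apply: eq_bigr => i _; rewrite /c1 exprS; ring.
    by rewrite (dc k.+1 kK) (dc k (leqW kK)) mulr0 subr0.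
  have pos1 i : i \in pos_supp c1 -> (j < i)%N && (i \in pos_supp c').
    rewrite !inE /c1; case: (ltnP i j) => ij.
      by rewrite nmulr_lgt0 ?rlt' // ltNge cge.
    rewrite pmulr_lgt0 ?rge // => h; rewrite h andbT ltn_neqAle ij andbT.
    by apply: contraTneq h => /ord_inj <-; rewrite ltNge (ltW cj).
  have neg1 i : i \in neg_supp c1 -> (i < j)%N || (i \in neg_supp c').
    rewrite !inE /c1; case: (ltnP i j) => //= ij.
    by rewrite pmulr_llt0 ?rge.
  have [|w [sw zw aw]] := IH c1 d1.
    by exists j; apply: mulf_neq0; [apply: ltr0_neq0 | apply: lt0r_neq0; apply: rge].
  case: w sw zw aw => // x w /= pw [zw].
  have sw := path_sorted pw.
  have tail : {in w, forall i : 'I_N, (j < i)%N} ->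
      (alternating (pos_supp c1) (neg_supp c1) w -> alternating (pos_supp c') (neg_supp c') w) /\
      (alternating (neg_supp c1) (pos_supp c1) w -> alternating (neg_supp c') (pos_supp c') w).
    move=> jw; split; apply: alternating_mono => i iw.
    - by move=> /pos1/andP[].
    - by move=> /neg1; rewrite ltnNge (ltnW (jw i iw)).
    - by move=> /neg1; rewrite ltnNge (ltnW (jw i iw)).
    - by move=> /pos1/andP[].
  case/orP=> /andP[xs aw].
    have /andP[jx xp] := pos1 x xs.
    have jw : {in w, forall i : 'I_N, (j < i)%N}.
      move=> i iw; apply: ltn_trans jx _.
      by have /allP := order_path_min (@ltord_trans N) pw; apply.
    exists [:: j, x & w]; split; rewrite /= ?zw //; first by rewrite /ltord jx.
    have [_ h] := tail jw; apply/orP; right.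
    by rewrite inE cj xp h.
  have jw : {in w, forall i : 'I_N, (j < i)%N}.
    case: w aw sw {pw zw tail} => // y w /= /andP[/pos1/andP[jy _] _] pw i.
    rewrite inE => /predU1P[->//|iw]; apply: ltn_trans jy _.
    by have /allP := order_path_min (@ltord_trans N) pw; apply.
  have [h _] := tail jw.
  case: (ltnP x j) => xj.
    exists [:: i0, j & w]; split; rewrite /= ?zw //.
      rewrite /ltord i0j /=; case: (w) jw sw => //= y w' -> ; rewrite ?mem_head //.
    by apply/orP; left; rewrite !inE ci0 cj h.
  exists [:: i0, x & w]; split; rewrite /= ?zw //.
    by rewrite pw /ltord (leq_trans i0j).
  apply/orP; left; rewrite inE ci0 h //= andbT.
  by have := neg1 x xs; rewrite ltnNge xj.
case: (arg_minnP (P := fun j => c j != 0) (fun j : 'I_N => j : nat) ci) => i0 ci0 imin.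
have c0 (i1 : 'I_N) : (i1 < i0)%N -> c i1 = 0.
  by move=> h; apply/eqP; apply: contraLR h => /imin; rewrite -leqNgt.
case: (ltrgtP (c i0) 0) ci0 => // ci0 _; last exact: key ci0 c0.
have [||w [sw zw aw]] := key (fun i => - c i) i0 (dependenceN dc).
- by rewrite oppr_gt0.
- by move=> i1 /c0 ->; rewrite oppr0.
by exists w; split=> //; rewrite pos_suppN neg_suppN orbC in aw.
Qed.

Lemma dependence_eq0 K c A : dependence K c -> (forall i, c i != 0 -> i \in A) -> (#|A| <= K)%N ->
  forall i, c i = 0.
Proof.
move=> dc cA AK i; apply/eqP; apply: contraT => ci.
have [w [sw zw aw]] := sign_changes dc (ex_intro _ i ci).
have wA : {subset w <= A}.
  move=> x xw; apply: cA; case/orP: aw => /alternating_mem/(_ x xw); rewrite !inE;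
  by case: ltrgtP.
have := uniq_leq_size (sorted_ltord_uniq sw) (fun x xw => etrans (mem_enum _ x) (wA x xw)).
by rewrite zw -cardE ltnNge AK.
Qed.

(** The Vandermonde matrix of K points of the curve is invertible, so weights
on these points with prescribed first K moments exist and depend linearly on
the moments. *)
Lemma dual_coords K s : #|s| = K -> exists l : 'I_N -> 'I_K -> R,
  (forall i k, i \notin s -> l i k = 0) /\
  forall (v : 'I_K -> R) k, v k = moment (fun i => \sum_k' v k' * l i k') k.
Proof.
move=> cs; pose f (a : 'I_K) : 'I_N := enum_val (cast_ord (esym cs) a).
have fi : injective f by move=> a b /enum_val_inj/cast_ord_inj.
have fs a : f a \in s by apply: enum_valP.
pose V := \matrix_(a < K, k < K) t (f a) ^+ k.
have sumf (u : 'I_K -> R) (g : 'I_N -> R) :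
    \sum_i (\sum_(a | f a == i) u a) * g i = \sum_a u a * g (f a).
  rewrite (partition_big f predT) //=; apply: eq_bigr => i _.
  by rewrite mulr_suml; apply: eq_bigr => a /eqP->.
have cf (u : 'I_K -> R) a : \sum_(b | f b == f a) u b = u a.
  by rewrite (big_pred1 a) // => b /=; rewrite (inj_eq fi).
have Vu : V \in unitmx.
  rewrite -row_free_unit; apply: inj_row_free => u uV; apply/rowP => a; rewrite mxE.
  pose c i := \sum_(b | f b == i) u 0 b.
  rewrite -[LHS](cf (fun b => u 0 b) a) -/(c (f a)).
  apply: (@dependence_eq0 K c s); rewrite ?cs //.
    move=> k kK; rewrite /moment sumf; move/rowP: uV => /(_ (Ordinal kK)).
    by rewrite !mxE => e; rewrite -[RHS]e; apply: eq_bigr => b _; rewrite mxE.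
  move=> i; apply: contraR => is_; apply/eqP; rewrite /c big_pred0 // => b.
  by apply: contraNF is_ => /eqP <-.
exists (fun i k => \sum_(a | f a == i) invmx V k a); split=> [i k is_|v k].
  rewrite big_pred0 // => a; by apply: contraNF is_ => /eqP <-.
have -> : v k = (\row_j v j *m invmx V *m V) 0 k by rewrite mulmxKV // mxE.
rewrite mxE.
under eq_bigr do rewrite !mxE.
rewrite -(sumf (fun a => \sum_j (\row_j v j) 0 j * invmx V j a) (fun i => t i ^+ k)).
rewrite /moment; apply: eq_bigr => i _; congr (_ * _).
rewrite exchange_big /=; apply: eq_bigr => j _.
by rewrite -mulr_sumr mxE.
Qed.

(** K + 1 points carry a dependence; by [sign_changes] it needs all of them,
and alternates in sign. *)
Lemma alternating_circuit K (w : seq 'I_N) : sorted (@ltord N) w -> size w = K.+1 ->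
  exists c, [/\ dependence K c, forall i, c i != 0 -> i \in w &
    forall x, x \in w -> if odd (seq_rk w x) then c x < 0 else 0 < c x].
Proof.
move=> sw zw; case ew : w => [|e w']; first by rewrite ew in zw.
rewrite -ew; pose s := [set x in w'].
have cs : #|s| = K.
  rewrite cardsE (card_uniqP _); first by move: zw; rewrite ew => -[].
  by have := sorted_ltord_uniq sw; rewrite ew => /andP[].
have es : e \notin s by rewrite inE; have := sorted_ltord_uniq sw; rewrite ew => /andP[].
have [l [ls lv]] := dual_coords cs.
pose c i := (if i == e then 1 else 0) - \sum_(k < K) t e ^+ k * l i k.
have ce : c e = 1.
  by rewrite /c eqxx big1 ?subr0 // => k _; rewrite ls ?mulr0.
have dc : dependence K c.
  move=> k kK; have := lv (fun k => t e ^+ k) (Ordinal kK) => /= h.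
  rewrite /moment /c; under eq_bigr do rewrite mulrBl.
  rewrite sumrB -[X in _ - X]/(moment _ k) -h (bigD1 e) //= eqxx mul1r big1 ?addr0 ?subrr //.
  by move=> i /negbTE ->; rewrite mul0r.
have cw i : c i != 0 -> i \in w.
  apply: contraR => iw; rewrite /c; move: iw; rewrite ew inE negb_or => /andP[/negbTE-> iw'].
  by rewrite big1 ?subr0 // => k _; rewrite ls ?mulr0 // inE.
have [z [sz zz az]] := sign_changes dc (ex_intro _ e
  (eq_ind_r (fun x => x != 0) (oner_neq0 _) ce)).
have zwE : z = w.
  apply: (@irr_sorted_eq _ (@ltord N)) => //; first exact: ltord_trans.
    by move=> x; apply: ltnn.
  have zw' : {subset z <= w}.
    move=> x xz; apply: cw; case/orP: az => /alternating_mem/(_ x xz); rewrite !inE;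
      by case: ltrgtP.
  by have [] := uniq_min_size (sorted_ltord_uniq sz) zw' _; rewrite ?zw ?zz.
rewrite zwE in az; case/orP: az => az.
  exists c; split=> // x xw; move: az; rewrite alternating_rk // => /allP/(_ x xw).
  by case: odd; rewrite inE.
exists (fun i => - c i); split; first exact: dependenceN.
  by move=> i; rewrite oppr_eq0; apply: cw.
move=> x xw; move: az; rewrite alternating_rk // => /allP/(_ x xw).
by case: odd; rewrite inE ?oppr_lt0 ?oppr_gt0.
Qed.
End Moments.

(** * Simplices on the moment curve *)

Section CommonEps.
Local Open Scope ring_scope.
Lemma common_eps (R : realType) (I : finType) (P : I -> R -> Prop) :
  (forall i, exists2 e, 0 < e & forall x, 0 < x -> x <= e -> P i x) ->
  exists2 e, 0 < e & forall i x, 0 < x -> x <= e -> P i x.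
Proof.
move=> h; have : forall l : seq I, exists2 e, 0 < e &
    forall i x, i \in l -> 0 < x -> x <= e -> P i x.
  elim=> [|i l [e e0 he]]; first by exists 1.
  have [e' e'0 he'] := h i; exists (Num.min e e'); first by rewrite lt_min e0.
  move=> k x; rewrite inE le_min => /predU1P[->|kl] x0 /andP[xe xe']; first exact: he'.
  exact: he.
move=> /(_ (enum I))[e e0 he]; exists e => // i x; apply: he.
by rewrite mem_enum.
Qed.
End CommonEps.

Section Hull.
Local Open Scope ring_scope.
Variables (R : realType) (N : nat) (t : 'I_N -> R).
Hypothesis ht : forall i j : 'I_N, (i < j)%N -> t i < t j.
Variable m : nat.
Implicit Types (w : 'I_N -> R) (A B s : {set 'I_N}) (i j : 'I_N) (x y z : 'rV[R]_m).

(** Homogeneous coordinates: the coordinate of index 0 is 1, so that weights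
representing x are weights whose moments are the coordinates of x. *)
Definition hcoord x (k : nat) : R :=
  if k is j.+1 then (if insub j is Some j' then x 0 (j' : 'I_m) else 0) else 1.

Lemma hcoordS x (j : 'I_m) : hcoord x j.+1 = x 0 j.
Proof. by rewrite /= valK. Qed.

Definition weights A x w := [/\ forall i, 0 <= w i, forall i, i \notin A -> w i = 0 &
  forall k, (k < m.+1)%N -> moment t w k = hcoord x k].

Lemma hull_weightsP A x : hull m t A x <-> exists w, weights A x w.
Proof.
have sumA (f : 'I_N -> R) (g : 'I_N -> R) :
    \sum_i (if i \in A then f i else 0) * g i = \sum_(i in A) f i * g i.
  by rewrite [RHS]big_mkcond; apply: eq_bigr => i _; case: ifP => // _; rewrite mul0r.
split=> [[w [w0 w1 ->]]|[w [w0 wA wm]]].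
  exists (fun i => if i \in A then w i else 0); split.
  - by move=> i; case: ifP => // /w0.
  - by move=> i /negbTE->.
  - case=> [_|k km].
      by rewrite /moment sumA -[RHS]w1; apply: eq_bigr => i _; rewrite expr0 mulr1.
    rewrite (hcoordS _ (Ordinal (km : (k < m)%N))) /moment sumA summxE; apply: eq_bigr => i _.
    by rewrite !mxE.
exists w; split=> //.
- have := wm 0%N isT; rewrite /moment /= => <-; rewrite [LHS]big_mkcond; apply: eq_bigr => i _.
  by rewrite expr0 mulr1; case: ifP => // /negbT/wA.
- apply/rowP => j; rewrite summxE -hcoordS -wm ?ltnS ?ltn_ord // /moment [RHS]big_mkcond.
  apply: eq_bigr => i _; rewrite !mxE; case: ifP => // /negbT/wA ->.
  by rewrite mul0r.
Qed.

Lemma hull_vertex A i : i \in A -> hull m t A (moment_point m (t i)).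
Proof.
move=> iA; exists (fun j => (j == i)%:R); split.
- by move=> j _; rewrite ler0n.
- by rewrite (bigD1 i) //= eqxx big1 ?addr0 // => j /andP[_ /negbTE->].
- rewrite (bigD1 i) //= eqxx scale1r big1 ?addr0 // => j /andP[_ /negbTE->].
  by rewrite scale0r.
Qed.

Lemma weightsS A B x w : A \subset B -> weights A x w -> weights B x w.
Proof.
move=> AB [w0 wA wm]; split=> // i iB; apply: wA.
by apply: contraNN iB; apply: (subsetP AB).
Qed.

Lemma hullS A B x : A \subset B -> hull m t A x -> hull m t B x.
Proof. by move=> AB /hull_weightsP[w h]; apply/hull_weightsP; exists w; apply: weightsS h. Qed.

Lemma weights_dependence A B x w1 w2 : weights A x w1 -> weights B x w2 ->
  dependence t m.+1 (fun i => w1 i - w2 i).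
Proof.
move=> [_ _ h1] [_ _ h2] k km; rewrite /moment; under eq_bigr do rewrite mulrBl.
by rewrite sumrB -/(moment t w1 k) -/(moment t w2 k) h1 // h2 // subrr.
Qed.

(** The point represented by weights of total 1. *)
Definition weighted_point w : 'rV[R]_m := \row_j moment t w j.+1.

Lemma hcoord_weighted_point w k : moment t w 0 = 1 -> (k < m.+1)%N ->
  hcoord (weighted_point w) k = moment t w k.
Proof.
by move=> w1; case: k => [|k] km //; rewrite (hcoordS _ (Ordinal (km : (k < m)%N))) mxE.
Qed.

Lemma hcoord_line x y a k : (k < m.+1)%N ->
  hcoord (x + a *: (y - x)) k = hcoord x k + a * (hcoord y k - hcoord x k).
Proof.
case: k => [|k] km; first by rewrite /= subrr mulr0 addr0.
by rewrite !(hcoordS _ (Ordinal (km : (k < m)%N))) !mxE.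
Qed.

Definition uniform_weight A : 'I_N -> R := fun i => if i \in A then #|A|%:R^-1 else 0.

Lemma moment0_uniform_weight A : (0 < #|A|)%N -> moment t (uniform_weight A) 0 = 1.
Proof.
move=> cA; rewrite /moment /uniform_weight (eq_bigr
  (fun i => if i \in A then #|A|%:R^-1 else 0 : R)).
  rewrite -big_mkcond sumr_const -[_ *+ _]mulr_natl divff //.
  by rewrite pnatr_eq0 -lt0n.
by move=> i _; rewrite expr0 mulr1.
Qed.

Lemma weights_uniform A : (0 < #|A|)%N -> weights A (weighted_point (uniform_weight A))
  (uniform_weight A).
Proof.
move=> cA; split.
- by move=> i; rewrite /uniform_weight; case: ifP => // _; rewrite invr_ge0.
- by move=> i /negbTE; rewrite /uniform_weight => ->.
- by move=> k km; rewrite hcoord_weighted_point ?moment0_uniform_weight.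
Qed.

(** The weights on s that represent a point are a linear function of the point,
so they stay positive nearby. *)
Lemma weights_pos_interior s x w : #|s| = m.+1 -> weights s x w ->
  (forall i, i \in s -> 0 < w i) ->
  interior (hull m t s) x.
Proof.
move=> cs hw wp; have [l [ls lv]] := dual_coords ht cs.
pose L i := \sum_(k < m.+1) `|l i k|.
have L0 i : 0 <= L i by apply: sumr_ge0.
pose cw y i := \sum_(k < m.+1) hcoord y k * l i k.
have cwm y k : (k < m.+1)%N -> moment t (cw y) k = hcoord y k.
  by move=> km; rewrite (lv (fun k : 'I_m.+1 => hcoord y k) (Ordinal km)).
have cwx i : cw x i = w i.
  apply/eqP; rewrite -subr_eq0; apply/eqP; apply:
    (@dependence_eq0 _ _ _ ht m.+1 (fun i => cw x i - w i) s); rewrite ?cs //.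
    move=> k km; rewrite /moment; under eq_bigr do rewrite mulrBl.
    rewrite sumrB -/(moment t (cw x) k) -/(moment t w k) cwm //.
    by case: hw => _ _ ->; rewrite ?subrr.
  move=> j; apply: contraR => js; case: hw => _ /(_ j js) -> _.
  by rewrite /cw big1 ?subr0 // => k _; rewrite ls // mulr0.
have [e e0 he] : exists2 e, 0 < e & forall i a, 0 < a -> a <= e -> i \in s -> a * L i < w i.
  apply: common_eps => i; case: (boolP (i \in s)) => is_; last by exists 1.
  have wi := wp i is_; have L1 : 0 < 1 + L i by rewrite ltr_pwDl.
  exists (w i / (1 + L i)); first by rewrite divr_gt0.
  move=> a a0; rewrite ler_pdivlMr // => h _; apply: lt_le_trans h.
  by rewrite mulrDr mulr1 ltrDr.
apply/nbhs_ballP; exists e => //= y xy.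
apply/hull_weightsP; exists (cw y).
have close (k : 'I_m.+1) : `|hcoord y k - hcoord x k| <= e.
  case: k => -[|k] km; first by rewrite /= subrr normr0 ltW.
  rewrite !(hcoordS _ (Ordinal (km : (k < m)%N))) distrC ltW //.
  by case: xy => _ /(_ 0 (Ordinal (km : (k < m)%N))).
have pos i : i \in s -> 0 < cw y i.
  move=> is_; have : `|cw y i - w i| <= e * L i.
    rewrite -cwx /cw -sumrB mulr_sumr; apply: le_trans (ler_norm_sum _ _ _) _.
    by apply: ler_sum => k _; rewrite -mulrBl normrM ler_wpM2r.
  have := he i e e0 (lexx _) is_; rewrite ler_norml => h /andP[h' _].
  by move: h h'; move: (e * _) => b; lra.
have out i : i \notin s -> cw y i = 0.
  by move=> is_; rewrite /cw big1 // => k _; rewrite ls // mulr0.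
split=> // [i|k]; last exact: cwm.
by case: (boolP (i \in s)) => [/pos/ltW|/out->].
Qed.

Lemma line_nbhs (A : set 'rV[R]_m) x v : nbhs x A ->
  exists2 e, 0 < e & forall a, `|a| <= e -> A (x + a *: v).
Proof.
move=> /nbhs_ballP[e /= e0 he]; pose S := \sum_j `|v 0 j|.
have S0 : 0 <= S by apply: sumr_ge0.
exists (e / (1 + S)); first by rewrite divr_gt0 // ltr_pwDl.
move=> a; rewrite ler_pdivlMr ?ltr_pwDl // => ae; apply: he; split=> // i j.
rewrite /ball /= !mxE opprD addrA subrr sub0r normrN normrM.
have [->|a0] := eqVneq a 0; first by rewrite normr0 mul0r.
apply: lt_le_trans ae; rewrite ltr_pM2l ?normr_gt0 //.
rewrite ord1 (le_lt_trans (y := S)) ?ltrDr // /S (bigD1 j) //= lerDl.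
by apply: sumr_ge0.
Qed.

(** From an interior point x one can move a little away from the vertex i
without leaving the simplex; this lowers the weight at i, which is therefore
positive. *)
Lemma interior_weights_pos s x w : #|s| = m.+1 -> interior (hull m t s) x -> weights s x w ->
  forall i, i \in s -> 0 < w i.
Proof.
move=> cs xi hw i is_; pose di j : R := (j == i)%:R.
have di1 k : moment t di k = t i ^+ k by apply: moment_unit.
have [e e0 he] := line_nbhs (weighted_point di - x) xi.
have ee : `|- e| <= e by rewrite normrN gtr0_norm.
have /hull_weightsP[u hu] := he (- e) ee.
have dd : dependence t m.+1 (fun j => (u j - (1 + e) * w j) + e * di j).
  move=> k km; rewrite (moment_lin t e) di1.
  have -> : moment t (fun j => u j - (1 + e) * w j) k = moment t u k - (1 + e) * moment t w k.
    by rewrite -mulNr -moment_lin; apply: eq_bigr => j _; rewrite mulNr.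
  case: hu => _ _ ->//; case: hw => _ _ -> //;
    rewrite hcoord_line // hcoord_weighted_point ?di1 ?expr0 //.
  by ring.
have := dependence_eq0 ht dd (A := s); rewrite cs leqnn => /(_ _ isT i).
rewrite /di eqxx mulr1 => h; have {}h : u i - (1 + e) * w i + e = 0.
  apply: h => j; apply: contraR => js.
  case: hu => _ /(_ j js) -> _; case: hw => _ /(_ j js) -> _.
  have -> : (j == i) = false by apply: contraNF js => /eqP->.
  by rewrite !mulr0 subrr addr0.
have u0 : 0 <= u i by case: hu.
have : 0 < (1 + e) * w i by move: h u0 e0; move: (_ * _) (u i) => a b; lra.
by rewrite pmulr_rgt0 // addr_gt0.
Qed.

(** Moving from x towards the barycentre of s1 enters the interior of s1 at
once and stays in the interior of s2 for a while. *)
Lemma interior_meet s1 s2 x : #|s1| = m.+1 -> hull m t s1 x -> interior (hull m t s2) x ->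
  exists z, interior (hull m t s1) z /\ interior (hull m t s2) z.
Proof.
move=> c1 /hull_weightsP[w hw] x2; pose b := uniform_weight s1.
have hb : weights s1 (weighted_point b) b by apply: weights_uniform; rewrite c1.
have [e e0 he] := line_nbhs (weighted_point b - x) (nbhs_interior x2).
pose a := Num.min e (1 / 2).
have a0 : 0 < a by rewrite lt_min e0 /=; lra.
have a1 : a < 1 by rewrite gt_min; apply/orP; right; lra.
exists (x + a *: (weighted_point b - x)); split; last first.
  by apply: he; rewrite gtr0_norm // ge_min lexx.
apply: (@weights_pos_interior s1 _ (fun i => w i + a * (b i - w i))) => //.
  split.
  - move=> i; case: hw => /(_ i) w0 _ _; case: hb => /(_ i) b0 _ _.
    have -> : w i + a * (b i - w i) = (1 - a) * w i + a * b i by ring.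
    by rewrite addr_ge0 // mulr_ge0 // ?subr_ge0 ltW.
  - move=> i is_; case: hw => _ /(_ i is_) -> _; case: hb => _ /(_ i is_) -> _.
    by rewrite subrr mulr0 addr0.
  - move=> k km; rewrite moment_lin hcoord_line //; congr (_ + _ * _);
    first by case: hw => _ _ ->.
    rewrite /moment; under eq_bigr do rewrite mulrBl.
    rewrite sumrB -/(moment t b k) -/(moment t w k).
    by case: hb => _ _ -> //; case: hw => _ _ -> //.
move=> i is_; have -> : w i + a * (b i - w i) = (1 - a) * w i + a * b i by ring.
apply: ltr_wpDl; first by apply: mulr_ge0; [rewrite subr_ge0 ltW | case: hw].
by rewrite mulr_gt0 // /b /uniform_weight is_ invr_gt0 c1 ltr0Sn.
Qed.

End Hull.

(** * Overlapping is crossing *)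

Section Crossing.
Local Open Scope ring_scope.
Variables (R : realType) (N : nat) (t : 'I_N -> R).
Hypothesis ht : forall i j : 'I_N, (i < j)%N -> t i < t j.
Variable d : nat.
Local Notation m := (2 * d)%N.
Implicit Types (w : 'I_N -> R) (A B s : {set 'I_N}) (i j : 'I_N) (x y z : 'rV[R]_m).

(** The difference of two representations of x is a dependence whose positive
part is in A and whose negative part is in B. *)
Lemma weights_cross A B x w1 w2 : weights t A x w1 -> weights t B x w2 ->
  (exists i, w1 i != w2 i) ->
  cross d A B.
Proof.
move=> h1 h2 [i ni]; have := sign_changes ht (weights_dependence h1 h2).
case; first by exists i; rewrite subr_eq0.
move=> u [su zu au]; exists u; split=> //.
have hp j : j \in pos_supp (fun i => w1 i - w2 i) -> j \in A.
  rewrite inE subr_gt0; apply: contraTT => jA; case: h1 => _ -> // _.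
  by rewrite -leNgt; case: h2.
have hn j : j \in neg_supp (fun i => w1 i - w2 i) -> j \in B.
  rewrite inE subr_lt0; apply: contraTT => jB; case: h2 => _ -> // _.
  by rewrite -leNgt; case: h1.
case/orP: au => au; apply/orP; [left|right]; move: au; apply: alternating_mono => j _;
  by [apply: hp|apply: hn].
Qed.

(** Start with weight 1 on every vertex of s1, and of s2. The moments of these
two differ; the difference is corrected by weights e on the alternating
sequence, which are split between s1 and s2 after adding a large multiple of
the alternating circuit c, so that positive parts go to s1 and negative parts
to s2. The resulting positive weights on s1 and s2 represent the same point. *)
Lemma cross_meet s1 s2 : #|s1| = m.+1 -> #|s2| = m.+1 -> cross d s1 s2 ->
  exists x, interior (hull m t s1) x /\ interior (hull m t s2) x.
Proof.
suff key (u1 u2 : {set 'I_N}) : #|u1| = m.+1 -> #|u2| = m.+1 ->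
    (exists w : seq 'I_N, [/\ sorted (@ltord N) w, size w = m.+2 & alternating u1 u2 w]) ->
    exists x, interior (hull m t u1) x /\ interior (hull m t u2) x.
  move=> c1 c2 [w [sw zw /orP[] aw]]; first by apply: key => //; exists w.
  have [|x [x1 x2]] := key s2 s1 c2 c1; first by exists w.
  by exists x.
move: u1 u2 => {}s1 {}s2 c1 c2 [u [su zu au]].
have [c [dc cu cs]] := alternating_circuit ht su zu.
have us i : i \in u -> i \in if odd (seq_rk u i) then s2 else s1.
  by move=> iu; move: au; rewrite alternating_rk // => /allP/(_ i iu).
have cpos i : 0 < c i -> i \in s1.
  move=> ci; have iu : i \in u by apply: cu; rewrite gt_eqF.
  by have := us i iu; have := cs i iu; case: odd => // h; rewrite ltNge (ltW h) in ci.
have cneg i : c i < 0 -> i \in s2.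
  move=> ci; have iu : i \in u by apply: cu; rewrite lt_eqF.
  by have := us i iu; have := cs i iu; case: odd => // h; rewrite ltNge (ltW h) in ci.
have cnz i : i \in u -> c i != 0.
  by move=> /cs; case: odd => h; rewrite ?(lt_eqF h) ?(gt_eqF h).
case eu : u => [|e0 u']; first by rewrite eu in zu.
pose s := [set x in u'].
have cs' : #|s| = m.+1.
  rewrite cardsE (card_uniqP _); first by move: zu; rewrite eu => -[].
  by have := sorted_ltord_uniq su; rewrite eu => /andP[].
have [l [ls lv]] := dual_coords ht cs'.
pose D k := moment t (fun i => (i \in s1)%:R) k - moment t (fun i => (i \in s2)%:R) k.
pose e i := \sum_(k < m.+1) D k * l i k.
have em k : (k < m.+1)%N -> moment t e k = D k.
  by move=> km; rewrite (lv (fun k : 'I_m.+1 => D k) (Ordinal km)).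
have eout i : i \notin u -> e i = 0.
  rewrite eu inE negb_or => /andP[_ iu]; rewrite /e big1 // => k _.
  by rewrite ls ?mulr0 // inE.
(* K c dominates e wherever c is not 0. *)
pose K := \sum_i `|e i| / `|c i|.
have Kbig i : c i != 0 -> `|e i| <= K * `|c i|.
  move=> ci; rewrite -ler_pdivrMr ?normr_gt0 // /K (bigD1 i) //= lerDl.
  by apply: sumr_ge0 => j _; rewrite divr_ge0.
pose g i := (i \in s1)%:R + (if 0 < c i then K * c i - e i else 0).
pose h i := (i \in s2)%:R + (if c i < 0 then e i - K * c i else 0).
have gp i : i \in s1 -> 0 < g i.
  move=> is1; rewrite /g is1 mulr1n; case: ifP => ci; last by rewrite addr0.
  have := Kbig i (lt0r_neq0 ci); rewrite (gtr0_norm ci) ler_norml => /andP[].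
  by move: (K * _) => a; lra.
have hp i : i \in s2 -> 0 < h i.
  move=> is2; rewrite /h is2 mulr1n; case: ifP => ci; last by rewrite addr0.
  have := Kbig i (ltr0_neq0 ci); rewrite (ltr0_norm ci) ler_norml mulrN => /andP[].
  by move: (K * _) => a; lra.
have g0 i : i \notin s1 -> g i = 0.
  move=> is1; rewrite /g (negbTE is1); case: ifP => [/cpos|]; last by rewrite addr0.
  by rewrite (negbTE is1).
have h0 i : i \notin s2 -> h i = 0.
  move=> is2; rewrite /h (negbTE is2); case: ifP => [/cneg|]; last by rewrite addr0.
  by rewrite (negbTE is2).
have gh k : (k < m.+1)%N -> moment t g k = moment t h k.
  move=> km; apply/eqP; rewrite -subr_eq0.
  have -> : moment t g k - moment t h k = D k - moment t e k + K * moment t c k.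
    rewrite /D /moment mulr_sumr -!sumrB -big_split /=; apply: eq_bigr => i _.
    rewrite /g /h; case: (ltrgtP (c i) 0) => ci; try ring.
    by rewrite ci eout ?eqxx //; [ring|apply/negP => /cnz; rewrite ci eqxx].
  by rewrite em // dc // mulr0 addr0 subrr.
pose S := moment t g 0.
have S0 : 0 < S.
  have [i is1] : exists i, i \in s1 by apply/set0Pn; rewrite -card_gt0 c1.
  rewrite /S /moment (bigD1 i) //= expr0 mulr1 ltr_pwDl ?gp // sumr_ge0 // => j _.
  by rewrite expr0 mulr1; case: (boolP (j \in s1)) => [/gp/ltW|/g0->].
have momZ f k : moment t (fun i => S^-1 * f i) k = S^-1 * moment t f k.
  by rewrite /moment mulr_sumr; apply: eq_bigr => i _; rewrite mulrA.
have one : moment t (fun i => S^-1 * g i) 0 = 1 by rewrite momZ mulVf // gt_eqF.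
exists (weighted_point t m (fun i => S^-1 * g i)).
have Si : 0 < S^-1 by rewrite invr_gt0.
split.
  apply: (@weights_pos_interior _ _ _ ht _ s1 _ (fun i => S^-1 * g i)) => //.
    split=> [i|i /g0 ->|k km]; rewrite ?mulr0 ?hcoord_weighted_point //.
    by apply: mulr_ge0; [exact: ltW | case: (boolP (i \in s1)) => [/gp/ltW|/g0->]].
  by move=> i is1; rewrite mulr_gt0 ?gp.
apply: (@weights_pos_interior _ _ _ ht _ s2 _ (fun i => S^-1 * h i)) => //.
  split=> [i|i /h0 ->|k km]; rewrite ?mulr0 ?hcoord_weighted_point //.
    by apply: mulr_ge0; [exact: ltW | case: (boolP (i \in s2)) => [/hp/ltW|/h0->]].
  by rewrite !momZ gh.
by move=> i is2; rewrite mulr_gt0 ?hp.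
Qed.

Lemma cross_self s : #|s| = m.+1 -> ~ cross d s s.
Proof.
move=> cs [u [su zu au]]; have us : {subset u <= s}.
  by move=> i iu; case/orP: au => /alternating_mem/(_ i iu); rewrite inE orbb.
have := uniq_leq_size (sorted_ltord_uniq su) (fun i iu => etrans (mem_enum _ i) (us i iu)).
by rewrite zu -cardE cs ltnn.
Qed.

End Crossing.

(** * Arcs and boundary facets *)

Section Functional.
Local Open Scope ring_scope.
Variables (R : realType) (N : nat) (t : 'I_N -> R).
Hypothesis ht : forall i j : 'I_N, (i < j)%N -> t i < t j.
Implicit Types (w c : 'I_N -> R) (A B E F s : {set 'I_N}) (i j : 'I_N).

Lemma sum_horner_moment c (p : {poly R}) : \sum_i c i * p.[t i] = \sum_(k < size p) p`_k * moment
  t c k.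
Proof.
under eq_bigr do rewrite horner_coef mulr_sumr.
rewrite exchange_big; apply: eq_bigr => k _; rewrite /moment mulr_sumr.
by apply: eq_bigr => i _; rewrite mulrCA.
Qed.

Lemma dependence_horner K c (p : {poly R}) : dependence t K c -> (size p <= K)%N ->
  \sum_i c i * p.[t i] = 0.
Proof.
move=> dc pK; rewrite sum_horner_moment big1 // => k _; rewrite dc ?mulr0 //.
exact: leq_trans pK.
Qed.

Definition vanish F : {poly R} := \prod_(f <- enum F) ('X - (t f)%:P).

Lemma vanishE F i : (vanish F).[t i] = \prod_(f in F) (t i - t f).
Proof.
rewrite horner_prod big_enum; apply: eq_bigr => f _.
by rewrite hornerXsubC.
Qed.

Lemma size_vanish F : size (vanish F) = #|F|.+1.
Proof. by rewrite /vanish size_prod_XsubC -cardE. Qed.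

Lemma vanish_eq0 F i : ((vanish F).[t i] == 0) = (i \in F).
Proof.
rewrite vanishE; apply/idP/idP => [/prodf_eq0|iF].
  by case=> f fF; rewrite subr_eq0 => /eqP/(t_inj ht)->.
by rewrite (bigD1 i) //= subrr mul0r.
Qed.

(** The sign at t i is the parity of the number of roots above t i, which for
an even number of roots is the parity of the number below. *)
Lemma vanish_sign F i : ~~ odd #|F| -> i \notin F ->
  0 < (-1) ^+ odd (rk F i) * (vanish F).[t i].
Proof.
move=> eF iF; have -> : odd (rk F i) = odd (\sum_(f in F) ~~ (f < i)%N).
  apply/eqP; rewrite -negb_add -oddD rk_sum -big_split /=.
  rewrite (eq_bigr (fun=> 1%N)) ?sum1_card // => f _; by case: (_ < _)%N.
rewrite signr_odd expr_sum vanishE -big_split /=; apply: prodr_gt0 => f fF.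
case: (ltngtP f i) => [fi|fi|e] /=.
- by rewrite expr0 mul1r subr_gt0 ht.
- by rewrite expr1 mulN1r opprB subr_gt0 ht.
- by rewrite -(ord_inj e) fF in iF.
Qed.
End Functional.

Section CircleGeo.
Local Open Scope ring_scope.
Variables (R : realType) (M : nat).
Local Notation N := M.+1.
Variable t : 'I_N -> R.
Hypothesis ht : forall i j : 'I_N, (i < j)%N -> t i < t j.
Variable d : nat.
Hypothesis d0 : (0 < d)%N.
Local Notation m := (2 * d)%N.
Implicit Types (w c : 'I_N -> R) (A B D E F G s : {set 'I_N}) (i j : 'I_N) (x y z : 'rV[R]_m)
  (p : {poly R}).

(** The circuit on the twin of an arc is positive on A and negative on A + 1:
this is the circuit of the flip at A. *)
Lemma twin_circuit A : sep A -> #|A| = d.+1 -> exists c,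
  [/\ dependence t m.+1 c, forall i, c i != 0 -> i \in twin A,
      forall i, i \in A -> 0 < c i & forall i, i \in A -> c (ordS i) < 0].
Proof.
move=> sA cA; have cE : size (enum (twin A)) = m.+2 by rewrite -cardE card_twin // cA mulnS.
have [c [dc cE' cs]] := alternating_circuit ht (sorted_enum_ltord (twin A)) cE.
have cT i : c i != 0 -> i \in twin A by move=> /cE'; rewrite mem_enum.
have out i : i \in A -> (i \in enum (twin A)) * (odd (rk (twin A) i) = (ord_max \in A)).
  move=> iA; rewrite mem_enum inE iA odd_rk_twin_notin //.
  by rewrite (disjointFr (sep_disjoint sA)).
have suc i : i \in A -> (ordS i \in enum (twin A)) *
  (odd (rk (twin A) (ordS i)) = (ord_max \notin A)).
  by move=> iA; rewrite mem_enum inE mem_imset_ordS iA orbT odd_rk_twin_ordS.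
case: (boolP (ord_max \in A)) => mA; last first.
  exists c; split=> // i iA.
    by have := cs i (out i iA).1; rewrite rk_enum (out i iA).2 (negbTE mA).
  by have := cs _ (suc i iA).1; rewrite rk_enum (suc i iA).2 mA.
exists (fun i => - c i); split=> [|i|i iA|i iA]; first exact: dependenceN.
- by rewrite oppr_eq0; apply: cT.
- by have := cs i (out i iA).1; rewrite rk_enum (out i iA).2 mA oppr_gt0.
- by have := cs _ (suc i iA).1; rewrite rk_enum (suc i iA).2 mA oppr_lt0.
Qed.

(** The affine function on the space whose restriction to the moment curve is
the polynomial p of degree at most m. *)
Definition eval_at (p : {poly R}) x : R := \sum_(k < m.+1) p`_k * hcoord x k.

Lemma eval_at_weights p A x w : (size p <= m.+1)%N -> weights t A x w ->
  eval_at p x = \sum_i w i * p.[t i].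
Proof.
move=> sp [_ _ wm]; rewrite sum_horner_moment /eval_at.
rewrite [RHS](big_ord_widen m.+1 (fun k => p`_k * moment t w k)) // [RHS]big_mkcond /=.
apply: eq_bigr => k _; case: ltnP => h; first by rewrite wm.
by rewrite nth_default // mul0r.
Qed.

Lemma weights_vertex i : weights t [set i] (moment_point m (t i)) (fun j => (j == i)%:R).
Proof.
split=> [j|j|k km]; first by rewrite ler0n.
  by rewrite inE => /negbTE->.
rewrite moment_unit; case: k km => [|k] km; first by rewrite expr0.
by rewrite (hcoordS _ (Ordinal (km : (k < m)%N))) mxE.
Qed.

Lemma eval_at_vertex p i : (size p <= m.+1)%N -> eval_at p (moment_point m (t i)) = p.[t i].
Proof.
move=> sp; rewrite (eval_at_weights sp (weights_vertex i)) (bigD1 i) //= eqxx mul1r big1 ?addr0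
  // => j /negbTE->.
by rewrite mul0r.
Qed.

Lemma eval_at_affine p x : eval_at p x = p`_0 + \sum_(j < m) p`_j.+1 * x 0 j.
Proof.
rewrite /eval_at big_ord_recl /= mulr1; congr (_ + _); apply: eq_bigr => j _.
by rewrite /bump /= add1n valK.
Qed.

(** By Gale's evenness criterion the polynomial with roots at [twin D] has
constant sign on the vertices, so it defines a supporting hyperplane. *)
Lemma twin_sub_in_facet D A : sep D -> #|D| = d -> A \subset twin D -> in_facet m t A.
Proof.
move=> sD cD AD; pose p := vanish t (twin D).
have cG : #|twin D| = m by rewrite card_twin // cD.
have sp : size p = m.+1 by rewrite size_vanish cG.
have spl : (size p <= m.+1)%N by rewrite sp.
pose sg : R := (-1) ^+ (ord_max \in D).
have ps i : 0 <= sg * p.[t i].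
  case: (boolP (i \in twin D)) => iD; first by move: iD; rewrite -(vanish_eq0 ht) => /eqP->;
    rewrite mulr0.
  have := vanish_sign ht _ iD; rewrite cG mul2n odd_double => /(_ isT).
  rewrite odd_rk_twin_notin // ; first exact: ltW.
  by apply: contraNN iD => h; rewrite inE h orbT.
have pe x A' w : weights t A' x w -> 0 <= sg * eval_at p x.
  move=> hw; rewrite (eval_at_weights spl hw) mulr_sumr; apply: sumr_ge0 => i _.
  by rewrite mulrCA mulr_ge0 //; case: hw.
pose wv : 'cV[R]_m := \col_j (- sg * p`_j.+1).
have xw x : (x *m wv) 0 0 = sg * p`_0 - sg * eval_at p x.
  rewrite eval_at_affine mulrDr opprD addrA subrr sub0r mxE mulr_sumr -sumrN.
  by apply: eq_bigr => j _; rewrite mxE; ring.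
pose F := [set x : 'rV[R]_m | cyclic_polytope m t x /\ (x *m wv) 0 0 = sg * p`_0]%classic.
have F_twin A' x : A' \subset twin D -> hull m t A' x -> F x.
  move=> AT hx; split; first by apply: (hullS _ hx); apply: subsetT.
  rewrite xw; case/hull_weightsP: hx => w hw; rewrite (eval_at_weights spl hw) big1 ?mulr0 ?subr0
    // => i _.
  case: (boolP (i \in A')) => iA; last by case: hw => _ -> //; rewrite mul0r.
  by move: (subsetP AT i iA); rewrite -(vanish_eq0 ht) => /eqP->; rewrite mulr0.
exists F; last by move=> x; apply: F_twin.
exists wv, (sg * p`_0); split=> //.
- have lastm : (m.-1 < m)%N by rewrite prednK ?muln_gt0.
  apply/eqP => /colP/(_ (Ordinal lastm)); rewrite !mxE /= prednK ?muln_gt0 //.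
  have -> : p`_m = 1.
    by have := monic_prod_XsubC (enum (twin D)) predT t => /monicP;
      rewrite /lead_coef -/(vanish t (twin D)) -/p sp.
  by move/eqP; rewrite mulr1 oppr_eq0 signr_eq0.
- by move=> x /hull_weightsP[w hw]; rewrite xw lerBlDr lerDl; apply: pe hw.
pose f (a : 'I_m) : 'I_N := enum_val (cast_ord (esym cG) a).
have fi : injective f by move=> a b /enum_val_inj/cast_ord_inj.
have fs a : f a \in twin D by apply: enum_valP.
(* The 2d points of [twin D] are affinely independent. *)
exists (\matrix_(a < m) moment_point m (t (f a))); split.
  move=> a; rewrite rowK; apply: (F_twin (twin D)) => //; exact: hull_vertex.
apply: inj_row_free => u; rewrite mul_mx_row => uV.
have [u1 u2] := eq_row_mx (etrans uV (esym (row_mx0 _ _ _ _))).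
pose c i := \sum_(a | f a == i) u 0 a.
have sumf (g : 'I_N -> R) : \sum_i c i * g i = \sum_a u 0 a * g (f a).
  rewrite (partition_big f predT) //=; apply: eq_bigr => i _.
  by rewrite mulr_suml; apply: eq_bigr => a /eqP->.
have cf a : c (f a) = u 0 a.
  by rewrite /c (big_pred1 a) // => b /=; rewrite (inj_eq fi).
apply/rowP => a; rewrite mxE -cf.
apply: (@dependence_eq0 _ _ _ ht m c (twin D)); rewrite ?cG //.
  case=> [_|k km]; rewrite /moment sumf.
    move/matrixP: u1 => /(_ 0 0); rewrite !mxE => e; rewrite -[RHS]e.
    by apply: eq_bigr => b _; rewrite expr0 !mxE.
  move/matrixP: u2 => /(_ 0 (Ordinal (ltnW km))); rewrite !mxE => e; rewrite -[RHS]e.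
  by apply: eq_bigr => b _; rewrite !mxE.
move=> i; apply: contraR => iD; apply/eqP; rewrite /c big_pred0 // => b.
by apply: contraNF iD => /eqP <-.
Qed.

(** A supporting affine function restricts to a polynomial q of degree at most
2d, nonnegative on the vertices and zero on B. The circuit of [twin B] is
negative off B, so it forces q to vanish on B + 1 too, hence at 2d + 2
points. *)
Lemma sep_not_in_facet B : sep B -> #|B| = d.+1 -> ~ in_facet m t B.
Proof.
move=> sB cB [F [wv [cc [wn0 wle FE _]]] BF].
have [c [dc cE cpos cneg]] := twin_circuit sB cB.
pose q : {poly R} := \poly_(k < m.+1)
  (if k is j.+1 then - (if insub j is Some j' then wv (j' : 'I_m) 0 else 0) else cc).
have qE i : q.[t i] = cc - (moment_point m (t i) *m wv) 0 0.
  rewrite horner_poly big_ord_recl /= expr0 mulr1 mxE -sumrN; congr (_ + _).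
  by apply: eq_bigr => j _; rewrite /bump /= add1n valK mxE mulNr mulrC.
have q0 i : 0 <= q.[t i].
  by rewrite qE subr_ge0; apply: wle; apply: hull_vertex; rewrite inE.
have qB i : i \in B -> q.[t i] = 0.
  move=> iB; have := BF _ (hull_vertex t m iB); rewrite FE => -[_ e].
  by rewrite qE e subrr.
have sq : (size q <= m.+1)%N by apply: size_poly.
have sum0 : \sum_i - (c i * q.[t i]) = 0.
  by rewrite sumrN (dependence_horner dc sq) oppr0.
have term i : 0 <= - (c i * q.[t i]).
  have [->|/cE] := eqVneq (c i) 0; first by rewrite mul0r oppr0.
  rewrite inE => /orP[/qB->|/imsetP[b bB ->]]; first by rewrite mulr0 oppr0.
  by rewrite -mulNr mulr_ge0 // oppr_ge0 ltW // cneg.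
have all0 i : c i * q.[t i] = 0.
  apply/eqP; rewrite -oppr_eq0; have := psumr_eq0P (fun i _ => term i) sum0.
  by move=> /(_ i isT) ->.
have qT i : i \in twin B -> q.[t i] = 0.
  rewrite inE => /orP[/qB//|/imsetP[b bB ->]].
  by move/eqP: (all0 (ordS b)); rewrite mulf_eq0 (lt_eqF (cneg b bB)) /= => /eqP.
have q00 : q = 0.
  apply/eqP; apply: contraT => qn0.
  have := @max_poly_roots _ q [seq t i | i <- enum (twin B)] qn0.
  rewrite size_map -cardE card_twin // cB => /(_ _ _) h.
  have := leq_trans (h _ _) sq; rewrite ltnS => h2.
  suff : (2 * d.+1 <= m)%N by rewrite mulnS; lia.
  apply: h2; last by rewrite map_inj_uniq ?enum_uniq //; apply: (t_inj ht).
  by apply/allP => _ /mapP[i + ->]; rewrite mem_enum => /qT; rewrite /root => ->.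
case/eqP: wn0; apply/colP => j; rewrite mxE.
have : q`_j.+1 = 0 by rewrite q00 coef0.
by rewrite coef_poly ltnS ltn_ord valK => /eqP; rewrite oppr_eq0 => /eqP.
Qed.
End CircleGeo.

(** * From triangulations to admissible families *)

Section Slide.
Local Open Scope ring_scope.
Variables (R : realType) (N : nat) (t : 'I_N -> R).
Hypothesis ht : forall i j : 'I_N, (i < j)%N -> t i < t j.
Variable m : nat.
Implicit Types (w c : 'I_N -> R) (A B E s : {set 'I_N}) (i j : 'I_N) (x y z : 'rV[R]_m).

(** Weights are affine along the line, so a negative weight at x would remain
negative near x. *)
Lemma hull_closed_line s x y : #|s| = m.+1 ->
  (forall e, 0 < e -> exists a, [/\ 0 < a, a <= e & hull m t s (x + a *: (y - x))]) ->
  hull m t s x.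
Proof.
move=> cs h; have [l [ls lv]] := dual_coords ht cs.
pose cw z i := \sum_(k < m.+1) hcoord z k * l i k.
have cwm z k : (k < m.+1)%N -> moment t (cw z) k = hcoord z k.
  by move=> km; rewrite (lv (fun k : 'I_m.+1 => hcoord z k) (Ordinal km)).
have cwo z i : i \notin s -> cw z i = 0.
  by move=> is_; rewrite /cw big1 // => k _; rewrite ls ?mulr0.
have cwl a i : cw (x + a *: (y - x)) i = cw x i + a * (cw y i - cw x i).
  rewrite /cw -sumrB mulr_sumr -big_split /=; apply: eq_bigr => k _.
  by rewrite hcoord_line //; ring.
have cwu z w : weights t s z w -> forall i, w i = cw z i.
  move=> hw i; apply/eqP; rewrite -subr_eq0; apply/eqP.
  apply: (@dependence_eq0 _ _ _ ht m.+1 (fun i => w i - cw z i) s); rewrite ?cs //.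
    move=> k km; rewrite /moment; under eq_bigr do rewrite mulrBl.
    rewrite sumrB -/(moment t (cw z) k) -/(moment t w k) cwm //.
    by case: hw => _ _ ->; rewrite ?subrr.
  move=> j; apply: contraR => js; case: hw => _ /(_ j js) -> _.
  by rewrite cwo // subrr.
apply/hull_weightsP; exists (cw x); split=> [i|i|k]; [|exact: cwo|exact: cwm].
rewrite leNgt; apply/negP => ci; pose D := `|cw y i - cw x i|.
have D0 : 0 < 1 + D by rewrite ltr_pwDl // normr_ge0.
have [|a [a0 ae /hull_weightsP[w hw]]] := h (- cw x i / (1 + D)) _.
  by rewrite divr_gt0 // oppr_gt0.
have : 0 <= w i by case: hw.
rewrite (cwu _ _ hw) cwl; move: ae; rewrite ler_pdivlMr // mulrDr mulr1 => ae.
have : a * (cw y i - cw x i) <= a * D by rewrite ler_pM2l // ler_norm.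
by move: (a * D) (a * _) ae a0 ci => u v; lra.
Qed.

(** Adding multiples of the dependence c to the weights of x keeps the point;
the first weight to reach 0 sits at some b with c b < 0. *)
Lemma hull_slide c E x w : dependence t m.+1 c -> (forall i, c i != 0 -> i \in E) ->
  (exists i, c i < 0) ->
  weights t E x w -> exists2 b, c b < 0 & hull m t (E :\ b) x.
Proof.
move=> dc cE [b0 cb0] hw.
case: (@arg_minP _ _ _ b0 (fun b => c b < 0) (fun b => w b / - c b) cb0) => b cb bmin.
exists b => //; apply/hull_weightsP; pose a := w b / - c b; exists (fun i => w i + a * c i).
have a0 : 0 <= a by apply: divr_ge0; [case: hw | rewrite oppr_ge0 ltW].
case: hw => w0 wE wm; split.
- move=> i; case: (ltP (c i) 0) => ci; last by rewrite addr_ge0 // mulr_ge0.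
  have := bmin i ci; rewrite ler_pdivlMr ?oppr_gt0 // -/a mulrN => h.
  by move: h; move: (a * _) => u; lra.
- move=> i; rewrite !inE negb_and negbK => /predU1P[->|iE].
    by rewrite /a invrN mulrN mulNr -mulrA mulVf ?lt_eqF // mulr1 subrr.
  rewrite wE // add0r; have [->|/cE] := eqVneq (c i) 0; first by rewrite mulr0.
  by rewrite (negbTE iE).
- by move=> k km; rewrite moment_lin wm // dc // mulr0 addr0.
Qed.
End Slide.

Section Triang.
Local Open Scope ring_scope.
Variables (R : realType) (M : nat).
Local Notation N := M.+1.
Variable t : 'I_N -> R.
Hypothesis ht : forall i j : 'I_N, (i < j)%N -> t i < t j.
Variable d : nat.
Hypothesis d0 : (0 < d)%N.
Local Notation m := (2 * d)%N.
Implicit Types (w c : 'I_N -> R) (A B D E F G s : {set 'I_N}) (i j : 'I_N) (x y z : 'rV[R]_m)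
  (T : {set {set 'I_N}}).

Lemma triangulation_nocross V T s s' : triangulation_on m t V T -> s \in T -> s' \in T ->
  ~ cross d s s'.
Proof.
move=> [C0 C1 _] sT s'T cr; have [_ cs] := C0 _ sT; have [_ cs'] := C0 _ s'T.
have [e|n] := eqVneq s s'; first by rewrite -e in cr; apply: cross_self cs cr.
have [x [x1 x2]] := cross_meet ht cs cs' cr.
suff : (classical_sets.set0 : set 'rV[R]_m) x by [].
by rewrite -(C1 _ _ sT s'T n).
Qed.

(** Since F contains an arc, some vertex j lies strictly beyond F; start from
the barycentre q of F and move towards j. One of the finitely many simplices
contains points of this segment arbitrarily near q, hence q; it contains F
because it does not overlap s, and it is not s because it reaches beyond F. *)
Lemma triangulation_neighbour T s i A : triangulation m t T -> s \in T -> i \in s -> sep A ->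
  #|A| = d.+1 -> A \subset s :\ i -> exists2 j, j \notin s & j |: (s :\ i) \in T.
Proof.
move=> hT sT is_ sA cA AF; set F := s :\ i in AF *; pose p := vanish t F.
case: (hT) => C0 _ C2; have [_ cs] := C0 _ sT.
have cF : #|F| = m by have := cs; rewrite (cardsD1 i s) is_ => -[].
have sp : (size p <= m.+1)%N by rewrite size_vanish cF.
have iF : i \notin F by rewrite !inE eqxx.
have pi0 : p.[t i] != 0 by rewrite (vanish_eq0 ht).
have pF j : j \in F -> p.[t j] = 0 by rewrite -(vanish_eq0 ht) => /eqP.
(* If all vertices were on the side of i, the circuit of [twin A] would force
[twin A] into F, which is too small. *)
have [j pj] : exists j, p.[t i] * p.[t j] < 0.
  apply: contrapT => h; have ge j : 0 <= p.[t i] * p.[t j].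
    by rewrite leNgt; apply/negP => hj; apply: h; exists j.
  have [c [dc cE cpos cneg]] := twin_circuit ht sA cA.
  have sum0 : \sum_j - (c j * (p.[t i] * p.[t j])) = 0.
    rewrite sumrN; under eq_bigr do rewrite mulrCA.
    by rewrite -mulr_sumr (dependence_horner dc sp) mulr0 oppr0.
  have term j : 0 <= - (c j * (p.[t i] * p.[t j])).
    have [->|/cE] := eqVneq (c j) 0; first by rewrite mul0r oppr0.
    rewrite inE => /orP[/(subsetP AF)/pF->|/imsetP[b bA ->]]; first by rewrite !mulr0 oppr0.
    by rewrite -mulNr mulr_ge0 // oppr_ge0 ltW // cneg.
  have : twin A \subset F.
    rewrite subUset AF; apply/subsetP => _ /imsetP[b bA ->].
    have := psumr_eq0P (fun j _ => term j) sum0 => /(_ (ordS b) isT)/eqP.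
    by rewrite oppr_eq0 !mulf_eq0 (negbTE pi0) (lt_eqF (cneg b bA)) /= (vanish_eq0 ht).
  move/subset_leq_card; rewrite card_twin // cA cF mulnS; lia.
have cF0 : (0 < #|F|)%N by rewrite cF muln_gt0.
pose q := weighted_point t m (uniform_weight R F);
  have hq : weights t F q (uniform_weight R F) by apply: weights_uniform.
pose y := moment_point m (t j); pose u a := q + a *: (y - q).
have hu a : 0 <= a -> a <= 1 -> exists w, weights t [set: 'I_N] (u a) w.
  move=> a0 a1; pose dj k : R := (k == j)%:R.
  exists (fun k => uniform_weight R F k + a * (dj k - uniform_weight R F k)); split.
  - move=> k; have -> : uniform_weight R F k + a * (dj k - uniform_weight R F k) = (1 - a) *
    uniform_weight R F k + a * dj k by ring.
    by apply: addr_ge0; apply: mulr_ge0; rewrite ?subr_ge0 ?ler0n //; case: hq.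
  - by move=> k; rewrite inE.
  - move=> k km; rewrite moment_lin hcoord_line //; congr (_ + _ * _);
    first by case: hq => _ _ ->.
    rewrite /moment; under eq_bigr do rewrite mulrBl.
    rewrite sumrB -/(moment t dj k) -/(moment t (uniform_weight R F) k).
    by case: (weights_vertex t d j) => _ _ -> //; case: hq => _ _ -> //.
have [e e0 he] : exists2 e, 0 < e & forall s' a, 0 < a -> a <= e ->
    s' \in T -> hull m t s' (u a) -> hull m t s' q.
  apply: common_eps => s'; have [hs|hs] := pselect (s' \in T -> hull m t s' q).
    by exists 1 => // a _ _ s'T _; apply: hs.
  have [s'T nh] : s' \in T /\ ~ hull m t s' q.
    by split; [apply: contrapT => h; apply: hs|move=> h; apply: hs].
  have [_ cs'] := C0 _ s'T.
  have [e e0 he] : exists2 e, 0 < e & forall a, 0 < a -> a <= e -> ~ hull m t s' (u a).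
    apply: contrapT => ne; apply: nh; apply: (hull_closed_line ht (y := y) cs') => e e0.
    apply: contrapT => h; apply: ne; exists e => // a a0 ae ha; apply: h; by exists a.
  by exists e => // a a0 ae _ /(he a a0 ae).
pose a := Num.min e 1; have a0 : 0 < a by rewrite lt_min e0 ltr01.
have [s' s'T hs'] : exists2 s', s' \in T & hull m t s' (u a).
  have : hull m t [set: 'I_N] (u a).
    by apply/hull_weightsP; apply: hu; [apply: ltW|rewrite ge_min lexx orbT].
  by rewrite -C2 => -[s' /= s'T h]; exists s'.
have hqs' : hull m t s' q.
  by apply: he hs' => //; rewrite ge_min lexx.
have [_ cs'] := C0 _ s'T.
have Fs' : F \subset s'.
  apply/subsetP => f fF; apply: contraT => fs'; have /hull_weightsP[w2 hw2] := hqs'.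
  have : cross d F s'.
    apply: (weights_cross ht hq hw2); exists f; case: hw2 => _ -> // _.
    by rewrite /uniform_weight fF invr_eq0 pnatr_eq0 -lt0n.
  by move/(cross_mono (subD1set s i) (subxx s'))/(triangulation_nocross hT sT s'T).
have /hull_weightsP[g hg] := hs'.
have ev : eval_at p (u a) = a * p.[t j].
  have -> : eval_at p (u a) = eval_at p q + a * (eval_at p y - eval_at p q).
    rewrite /eval_at -sumrB mulr_sumr -big_split /=; apply: eq_bigr => k _.
    by rewrite hcoord_line //; ring.
  have -> : eval_at p q = 0.
    rewrite (eval_at_weights sp hq) big1 // => k _; case: (boolP (k \in F)) => kF;
      first by rewrite pF ?mulr0.
    by rewrite /uniform_weight (negbTE kF) mul0r.
  by rewrite eval_at_vertex // subr0 add0r.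
have nss' : s' != s.
  apply/eqP => e1; rewrite e1 in hg; move: ev;
    rewrite (eval_at_weights sp hg) (bigD1 i) //= big1 ?addr0.
    move=> e2; have : 0 <= p.[t i] * (g i * p.[t i]).
      by rewrite mulrCA mulr_ge0 ?sqr_ge0 //; case: hg.
    by rewrite e2 mulrCA leNgt pmulr_rlt0 // pj.
  move=> k ki; case: (boolP (k \in s)) => ks; last by case: hg => _ -> //; rewrite mul0r.
  by rewrite pF ?mulr0 // !inE ki.
have [k kF ek] := setU1_of_card Fs' (etrans cs' (congr1 succn (esym cF))).
exists k; last by rewrite -ek.
apply: contraNN nss' => ks; move: kF; rewrite !inE ks andbT negbK => /eqP ki.
by rewrite ek ki setD1K.
Qed.

Lemma admissible_of_triangulation T : triangulation m t T -> no_interior_simplex d t T ->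
  admissible d T.
Proof.
move=> hT hn; case: (hT) => C0 _ _; split.
- by move=> s /C0[].
- move=> s A sT sA As; rewrite leqNgt; apply/negP => dA.
  have [B [sB cB BA]] := sep_subset_card sA dA.
  apply: (hn B); split; first by split=> //; exists s => //; apply: subset_trans As.
  move=> B' B'B cB'; have sB' := sepS B'B sB.
  split; first by split=> //; exists s => //; apply: subset_trans B'B (subset_trans BA As).
  exact: (sep_not_in_facet ht d0 sB' cB').
- by move=> s s' sT s'T; apply: triangulation_nocross hT sT s'T.
- by move=> s i A sT is_ sA cA AF; apply: triangulation_neighbour hT sT is_ sA cA AF.
Qed.

(** A simplex s has a base element v with v+1 outside s, so s minus v lies in
the twin of a d-set, that is, in a boundary facet. A (d+1)-simplex of s has a
d-face that avoids v. *)
Lemma no_interior_simplex_of_sep T : (m.+2 <= N)%N -> (forall s, s \in T -> #|s| = m.+1) ->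
  (forall s A, s \in T -> sep A -> A \subset s -> (#|A| <= d.+1)%N) ->
  no_interior_simplex d t T.
Proof.
move=> hN C0 C1 A [[cA [s sT As]] hA].
have sn : s != setT by apply: contraTneq hN => e; rewrite -ltnNge -(C0 _ sT) e cardsT card_ord.
have b := base_ofP sn; case/and3P: (b) => sB Bs sB2.
have cB : #|base_of s| = d.+1.
  apply/eqP; rewrite eqn_leq (C1 s (base_of s) sT sB Bs) /=.
  by move: (leq_card_base b); rewrite (C0 _ sT) ltn_mul2l.
have [v vB vs] : exists2 v, v \in base_of s & ordS v \notin s.
  apply: contrapT => h; have : twin (base_of s) \subset s.
    rewrite subUset Bs; apply/subsetP => _ /imsetP[u uB ->]; apply: contrapT => /negP us.
    by apply: h; exists u.
  by move/subset_leq_card; rewrite card_twin // cB C0 // mulnS; lia.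
have sv : s :\ v \subset twin (base_of s :\ v).
  apply/subsetP => u; rewrite in_setD1 => /andP[uv us]; move: (subsetP sB2 u us).
  rewrite !inE uv /= => /orP[->//|/imsetP[b' bB eu]]; rewrite eu mem_imset_ordS !inE bB andbT.
  by apply/orP; right; apply: contraNneq vs => <-; rewrite -eu.
have cD : #|base_of s :\ v| = d by move: cB; rewrite (cardsD1 v) vB => -[].
have sD : sep (base_of s :\ v) by apply: sepS sB; apply: subD1set.
have [B [BA cB' BD]] : exists B, [/\ B \subset A, #|B| = d.+1 & B \subset s :\ v].
  have [vA|vA] := boolP (v \in A).
    exists (A :\ v); split; rewrite ?subD1set ?setSD //.
    by move: cA; rewrite (cardsD1 v) vA => -[].
  have [a aA] : exists a, a \in A by apply/set0Pn; rewrite -card_gt0 cA.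
  exists (A :\ a); split; rewrite ?subD1set //.
    by move: cA; rewrite (cardsD1 a) aA => -[].
  by rewrite subsetD1 !inE (negbTE vA) andbF andbT (subset_trans _ As) ?subD1set.
have [_ nf] := hA B BA cB'; apply: nf.
exact: (twin_sub_in_facet ht d0 sD cD (subset_trans BD sv)).
Qed.

(** The barycentre of a simplex s of T lies in some s' of T', and then s is
contained in s', since s and s' would cross otherwise. *)
Lemma nocross_triangulation_sub T T' : triangulation m t T -> triangulation m t T' ->
  (forall s s', s \in T -> s' \in T' -> ~ cross d s s') -> T \subset T'.
Proof.
move=> [C0 _ _] [C0' _ C2'] nc; apply/subsetP => s sT; have [_ cs] := C0 _ sT.
have cs0 : (0 < #|s|)%N by rewrite cs.
have hb := weights_uniform t m cs0.
have : hull m t [set: 'I_N] (weighted_point t m (uniform_weight R s)).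
  by apply/hull_weightsP; exists (uniform_weight R s); apply: weightsS (subsetT s) hb.
rewrite -C2' => -[s' /= s'T /hull_weightsP[w hw]]; have [_ cs'] := C0' _ s'T.
suff -> : s = s' by [].
apply/eqP; rewrite eqEcard cs cs' leqnn andbT; apply/subsetP => i is_.
apply: contraT => is'; case: (nc _ _ sT s'T).
apply: (weights_cross ht hb hw); exists i; case: hw => _ -> // _.
by rewrite /uniform_weight is_ invr_eq0 pnatr_eq0 cs.
Qed.

(** * Flipping an arc *)

Section Flip.
Variables (T : {set {set 'I_N}}) (A : {set 'I_N}).
Hypotheses (hT : triangulation m t T) (sA : sep A) (cA : #|A| = d.+1).
Let E := twin A.
Hypothesis hE : forall a, a \in A -> E :\ ordS a \in T.

(** The two triangulations of the cyclic polytope on E correspond to the two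
signs of its circuit, which is positive on A and negative on A + 1: the
simplices of one omit an element of A + 1, those of the other an element of
A. *)
Definition lower_half := [set E :\ ordS a | a in A].
Definition upper_half := [set E :\ a | a in A].
Definition flip := (T :\: lower_half) :|: upper_half.

Let cE : #|E| = m.+2. Proof. by rewrite card_twin // cA mulnS. Qed.
Let AE a : a \in A -> a \in E. Proof. by move=> aA; rewrite inE aA. Qed.
Let SE a : a \in A -> ordS a \in E. Proof. by move=> aA; rewrite inE mem_imset_ordS aA orbT. Qed.
Let cEe e : e \in E -> #|E :\ e| = m.+1.
Proof. by move=> eE; have := cE; rewrite (cardsD1 e) eE => -[]. Qed.
Let dis a : a \in A -> a \notin @ordS N @: A.
Proof. by move=> aA; rewrite (disjointFr (sep_disjoint sA)). Qed.
Let disS a : a \in A -> ordS a \notin A.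
Proof. exact: (sepP _ sA). Qed.

Let A0 : exists a, a \in A.
Proof. by apply/set0Pn; rewrite -card_gt0 cA. Qed.

Lemma sub_lower_half a : a \in A -> A \subset E :\ ordS a.
Proof. by move=> aA; rewrite subsetD1 subsetUl disS. Qed.

Lemma succ_sub_upper_half a : a \in A -> @ordS N @: A \subset E :\ a.
Proof. by move=> aA; rewrite subsetD1 subsetUr dis. Qed.

(** The arcs A and A + 1 cross, so they cannot both belong to T. *)
Lemma upper_half_notin a : a \in A -> E :\ a \notin T.
Proof.
move=> aA; apply/negP => aT.
apply: (triangulation_nocross hT (hE aA) aT); exact:
  (ordS_cross sA cA (sub_lower_half aA) (succ_sub_upper_half aA)).
Qed.

(** A simplex inside E omits a single vertex of E, and those that omit an
element of A overlap the lower half. *)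
Lemma setI_powerset_twin : (T :&: powerset E)%SET = lower_half.
Proof.
apply/setP => s; rewrite inE powersetE; apply/andP/imsetP => [[sT sE]|[a aA ->]]; last first.
  by rewrite hE // subD1set.
case: hT => /(_ s sT)[_ cs] _ _.
have [e eD] : exists e, e \in E :\: s.
  by apply/set0Pn; rewrite -card_gt0 cardsD (setIidPr sE) cE cs subSn ?subnn.
move: eD; rewrite inE => /andP[es eE]; have es' : s = E :\ e.
  by apply/eqP; rewrite eqEcard cEe // cs leqnn andbT subsetD1 sE.
move: (eE); rewrite inE => /orP[eA|/imsetP[a aA ea]]; last by exists a; rewrite // es' ea.
by rewrite es' (negbTE (upper_half_notin eA)) in sT.
Qed.

Lemma flip_setI_powerset : (flip :&: powerset E)%SET = upper_half.
Proof.
apply/setP => s; rewrite !inE; apply/andP/idP => [[/orP[/andP[nl sT]|//] sE]|su].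
  by move: nl; rewrite -setI_powerset_twin !inE sT /= sE.
by rewrite su orbT; split=> //; case/imsetP: su => a _ ->; rewrite subD1set.
Qed.

Lemma lower_half_cover x : hull m t E x -> exists2 a, a \in A & hull m t (E :\ ordS a) x.
Proof.
move=> /hull_weightsP[w hw]; have [c [dc cT cp cn]] := twin_circuit ht sA cA.
have [|b cb hb] := hull_slide dc cT _ hw.
  by have [a aA] := A0; exists (ordS a); apply: cn.
have cb0 : c b != 0 by rewrite lt_eqF.
have := cT b cb0; rewrite inE => /orP[/cp|/imsetP[a aA ba]].
  by rewrite ltNge (ltW cb).
by exists a; rewrite // -ba.
Qed.

Lemma upper_half_cover x : hull m t E x -> exists2 a, a \in A & hull m t (E :\ a) x.
Proof.
move=> /hull_weightsP[w hw]; have [c [dc cT cp cn]] := twin_circuit ht sA cA.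
have cT' i : - c i != 0 -> i \in E by rewrite oppr_eq0; apply: cT.
have [|b cb hb] := hull_slide (dependenceN dc) cT' _ hw.
  by have [a aA] := A0; exists a; rewrite oppr_lt0 cp.
rewrite oppr_lt0 in cb; have cb0 : c b != 0 by rewrite gt_eqF.
have := cT b cb0; rewrite inE => /orP[bA|/imsetP[a aA ba]]; first by exists b.
by have := cn a aA; rewrite -ba ltNge (ltW cb).
Qed.

(** Two representations of a common point, on E minus a and on E minus a',
differ by a multiple of the circuit. The circuit has the same sign at a and a',
where the difference of the weights has opposite signs. *)
Lemma upper_half_disjoint a a' x : a \in A -> a' \in A -> a != a' ->
  interior (hull m t (E :\ a)) x -> interior (hull m t (E :\ a')) x -> False.
Proof.
move=> aA a'A n i1 i2; have [c [dc cT cp cn]] := twin_circuit ht sA cA.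
have /hull_weightsP[g hg] := interior_subset i1; have /hull_weightsP[h hh] := interior_subset i2.
have ga : 0 < g a' by apply: (interior_weights_pos ht (cEe (AE aA)) i1 hg);
  rewrite !inE eq_sym n a'A.
have ha : 0 < h a by apply: (interior_weights_pos ht (cEe (AE a'A)) i2 hh); rewrite !inE n aA.
have dd : dependence t m.+1 (fun i => (g i - h i) + h a / c a * c i) by apply: dependenceD
  (weights_dependence hg hh) dc.
have ga0 : g a = 0 by case: hg => _ -> //; rewrite !inE eqxx.
have ha0 : h a' = 0 by case: hh => _ -> //; rewrite !inE eqxx.
have zero := dependence_eq0 ht dd (A := E :\ a) _ _ a'.
have : g a' - h a' + h a / c a * c a' = 0.
  apply: zero; last by rewrite cEe // AE.
  move=> i; apply: contraR; rewrite in_setD1 negb_and negbK => /predU1P[->|iE].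
    by rewrite ga0; have := lt0r_neq0 (cp a aA); move: (h a) (c a) => u v v0; apply/eqP; field.
  have ci : c i = 0 by apply/eqP; apply: contraNT iE => /cT.
  have gi : g i = 0 by case: hg => _ -> //; rewrite in_setD1 negb_and iE orbT.
  have hi : h i = 0 by case: hh => _ -> //; rewrite in_setD1 negb_and iE orbT.
  by rewrite ci gi hi subrr mulr0 addr0.
rewrite ha0 subr0; have : 0 < h a / c a * c a' by rewrite mulr_gt0 ?divr_gt0 ?cp.
by move: (_ * _) ga => u; lra.
Qed.

Lemma triangulation_lower_half : triangulation_on m t E lower_half.
Proof.
case: hT => _ C1 _; split.
- by move=> _ /imsetP[a aA ->]; rewrite subD1set cEe ?SE.
- by move=> _ _ /imsetP[a aA ->] /imsetP[b bA ->]; apply: C1; apply: hE.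
rewrite predeqE => x; split=> [[s /= /imsetP[a aA ->]]|/lower_half_cover[a aA h]].
  by apply: hullS; apply: subD1set.
by exists (E :\ ordS a) => //=; apply: imset_f.
Qed.

Lemma triangulation_upper_half : triangulation_on m t E upper_half.
Proof.
split.
- by move=> _ /imsetP[a aA ->]; rewrite subD1set cEe ?AE.
- move=> _ _ /imsetP[a aA ->] /imsetP[b bA ->] n; rewrite predeqE => x; split=> // -[i1 i2].
  by case: (upper_half_disjoint aA bA _ i1 i2); apply: contraNneq n => ->.
rewrite predeqE => x; split=> [[s /= /imsetP[a aA ->]]|/upper_half_cover[a aA h]].
  by apply: hullS; apply: subD1set.
by exists (E :\ a) => //=; apply: imset_f.
Qed.

(** A simplex that overlaps the upper half overlaps the polytope on E, hence
one of the simplices of the lower half. *)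
Lemma old_new_disjoint s a x : s \in T -> s \notin lower_half -> a \in A ->
  interior (hull m t s) x -> interior (hull m t (E :\ a)) x -> False.
Proof.
move=> sT sU aA i1 i2; have hx : hull m t E x.
  by apply: hullS (subD1set _ _) (interior_subset i2).
have [b bA hb] := lower_half_cover hx.
have [z [z1 z2]] := interior_meet ht (cEe (SE bA)) hb i1.
have n : E :\ ordS b != s by apply: contraNneq sU => <-; apply: imset_f.
case: hT => _ C1 _; suff : (classical_sets.set0 : set 'rV[R]_m) z by [].
by rewrite -(C1 _ _ (hE bA) sT n).
Qed.

Lemma triangulation_flip : triangulation m t flip.
Proof.
case: (hT) => C0 C1 C2; case: triangulation_upper_half => U0 U1 U2; split.
- move=> s; rewrite !inE => /orP[/andP[_ /C0//]|/U0[_ cs]].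
  by split=> //; apply: subsetT.
- move=> s s'; rewrite !inE => /orP[/andP[n1 s1]|s1] /orP[/andP[n2 s2]|s2].
  + exact: C1.
  + move=> _; rewrite predeqE => x; split=> // -[i1]; case/imsetP: s2 => a aA ->.
    by move=> i2; case: (old_new_disjoint s1 n1 aA i1 i2).
  + move=> _; rewrite predeqE => x; split=> // -[]; case/imsetP: s1 => a aA ->.
    by move=> i2 i1; case: (old_new_disjoint s2 n2 aA i1 i2).
  + exact: U1.
rewrite predeqE => x; split=> [[s /= _]|]; first by apply: hullS; apply: subsetT.
move=> hx; have : hull m t [set: 'I_N] x by [].
rewrite -C2 => -[s /= sT hs]; have [sU|sU] := boolP (s \in lower_half); last first.
  by exists s => //=; rewrite !inE sU sT.
have : hull m t E x.
  by case/imsetP: sU hs => a _ ->; apply: hullS; apply: subD1set.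
case/upper_half_cover => a aA ha; exists (E :\ a) => //=.
by rewrite !inE (_ : _ \in upper_half) ?orbT //; apply: imset_f.
Qed.

Lemma bistellar_flip_flip : bistellar_flip m t T flip.
Proof.
exists E; rewrite setI_powerset_twin flip_setI_powerset; split=> //.
- exact: triangulation_lower_half.
- exact: triangulation_upper_half.
- have [a aA] := A0; apply/eqP => /setP/(_ (E :\ ordS a)).
  rewrite (_ : (_ \in lower_half) = true); last exact: imset_f.
  move=> /esym/imsetP[a' a'A e]; have := upper_half_notin a'A.
  by rewrite -e hE.
apply/setP => s; rewrite !in_setD in_setU in_setD powersetE.
have [sE|nE] /= := boolP (s \subset E); first by [].
have -> : s \notin lower_half by apply: contraNN nE => /imsetP[a _ ->]; apply: subD1set.
have -> : s \in upper_half = false by apply: contraNF nE => /imsetP[a _ ->]; apply: subD1set.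
by rewrite orbF.
Qed.

End Flip.

Lemma bistellar_flip_sym T T' : bistellar_flip m t T T' -> bistellar_flip m t T' T.
Proof. by case=> S [? ? ? n ?]; exists S; split=> //; rewrite eq_sym. Qed.
End Triang.

(** * Flipping towards vertex 0 *)

Section ShiftSum.
Local Open Scope ring_scope.
Variable M : nat.
Local Notation N := M.+1.
Implicit Types (A B C s : {set 'I_N}).

(** Transversality: a separated set of more than |A| elements would have two in
one pair {a, a+1}. *)
Lemma leq_card_sep_twin A C : sep A -> sep C -> C \subset twin A -> (#|C| <= #|A|)%N.
Proof.
move=> sA sC CE; rewrite leqNgt; apply/negP => lt.
have [C' [sC' cC' C'C]] := sep_subset_card sC (ltnW lt).
have bA : base A (twin A) by rewrite /base sA subsetUl subxx.
have C'E := subset_trans C'C CE.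
have [x xD] : exists x, x \in C :\: C'.
  by apply/set0Pn; rewrite -card_gt0 cardsD (setIidPr C'C) cC' subn_gt0.
move: xD; rewrite inE => /andP[xC' xC]; move: (subsetP CE x xC).
rewrite inE => /orP[xA|/imsetP[u uA xu]].
  have := base_transversal bA C'E sC' cC' xA; rewrite (negbTE xC') => /esym/negbFE/(subsetP C'C).
  by rewrite (negbTE (sepP _ sC x xC)).
have := base_transversal bA C'E sC' cC' uA; rewrite -xu xC' => /(subsetP C'C)/(sepP _ sC).
by rewrite -xu xC.
Qed.

(** From A to C some vertices step forward; each step adds 1 to the sum of the
labels in the cyclic cover, and N * lap accounts for the step from the last
vertex to 0. *)
Lemma val_sum_lap_lt A C : sep A -> sep C -> C \subset twin A -> #|C| = #|A| -> C != A ->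
  (\sum_(x in A) x < N * lap A C + \sum_(x in C) x)%N.
Proof.
move=> sA sC CE cC CA; have bA : base A (twin A) by rewrite /base sA subsetUl subxx.
pose f a := if a \in C then a else ordS a.
have tr a : a \in A -> (a \in C) = (ordS a \notin C) by apply: base_transversal bA CE sC cC.
have fi : {in A &, injective f}.
  move=> a b aA bA'; rewrite /f; case: ifP => aC; case: ifP => bC //.
  - by move=> e; move: (sepP _ sA b bA'); rewrite -e aA.
  - by move=> e; move: (sepP _ sA a aA); rewrite e bA'.
  - exact: ordS_inj.
have fC : f @: A = C.
  apply/eqP; rewrite eqEcard card_in_imset // cC leqnn andbT; apply/subsetP => _ /imsetP[a aA ->].
  by rewrite /f; case: ifP => // aC; move: (tr a aA); rewrite aC => /esym/negbFE.
have -> : (\sum_(x in C) x = \sum_(a in A) f a)%N by rewrite -fC big_imset.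
have [a0 a0A a0C] : exists2 a, a \in A & a \notin C.
  by apply/subsetPn; apply: contraNN CA => h; rewrite eq_sym eqEcard h cC /= leqnn.
case: (boolP ((ord_max \in A) && (ord_max \notin C))) => [/andP[mA mC]|nm].
  have zC : ord0 \in C by move: (tr _ mA); rewrite ordS_max (negbTE mC) => /esym/negbFE.
  have zA : ord0 \notin A by rewrite -ordS_max (sepP _ sA).
  rewrite /lap zC zA /= muln1 (bigD1 ord_max) //= [X in (_ < _ + X)%N](bigD1 ord_max) //=.
  have -> : f ord_max = ord0 by rewrite /f (negbTE mC) ordS_max.
  rewrite /= add0n -addSn leq_add2l; apply: leq_sum => a /andP[aA am].
  by rewrite /f; case: ifP => // _; rewrite val_ordS.
apply: leq_trans (leq_addl _ _); have ge a : a \in A -> (a <= f a)%N.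
  move=> aA; rewrite /f; case: ifP => // aC; rewrite val_ordS //.
  by apply: contraNneq nm => <-; rewrite aA aC.
rewrite (bigD1 a0) //= [X in (_ < X)%N](bigD1 a0) //= -addSn; apply: leq_add.
  rewrite /f (negbTE a0C) val_ordS //.
  by apply: contraNneq nm => <-; rewrite a0A a0C.
by apply: leq_sum => a /andP[aA _]; apply: ge.
Qed.
End ShiftSum.

Section Main.
Local Open Scope ring_scope.
Variables (R : realType) (M : nat).
Local Notation N := M.+1.
Variable t : 'I_N -> R.
Hypothesis ht : forall i j : 'I_N, (i < j)%N -> t i < t j.
Variable d : nat.
Hypothesis d0 : (0 < d)%N.
Local Notation m := (2 * d)%N.
Implicit Types (A B C D E F G s : {set 'I_N}) (i j : 'I_N) (T : {set {set 'I_N}})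
  (k : {set 'I_N} -> int).

(** By [good_no_interior] and [good_admissible] these are the triangulations
without interior (d+1)-simplices. *)
Definition good T := triangulation m t T /\
  forall s A, s \in T -> sep A -> A \subset s -> (#|A| <= d.+1)%N.

Inductive flips : {set {set 'I_N}} -> {set {set 'I_N}} -> Prop :=
| flips_refl T : good T -> flips T T
| flips_step T T1 T2 : good T -> bistellar_flip m t T T1 -> flips T1 T2 -> flips T T2.

Lemma flips_good T T' : flips T T' -> good T /\ good T'.
Proof. by elim=> // T1 T2 T3 g _ _ [_ ?]. Qed.

Lemma flips_trans T1 T2 T3 : flips T1 T2 -> flips T2 T3 -> flips T1 T3.
Proof. by elim=> // A B C g b _ IH /IH; apply: flips_step. Qed.

Lemma flips_sym T T' : flips T T' -> flips T' T.
Proof.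
elim=> [A g|A B C g b f IH]; first exact: flips_refl.
apply: flips_trans IH _; apply: flips_step (bistellar_flip_sym b) (flips_refl g).
by case: (flips_good f).
Qed.

Lemma flips_seq T T' : flips T T' -> exists (k : nat) (Ts : nat -> {set {set 'I_N}}),
  [/\ Ts 0%N = T, Ts k = T', forall j : nat, (j <= k)%N -> good (Ts j) &
      forall j : nat, (1 <= j <= k)%N -> bistellar_flip m t (Ts j.-1) (Ts j)].
Proof.
elim=> [A g|A B C g b _ [k [Ts [t0 tk tg tb]]]].
  by exists 0%N, (fun => A); split=> // j /andP[/leq_trans h /h].
exists k.+1, (fun j : nat => if j is j'.+1 then Ts j' else A); split=> //.
  by case=> // j; apply: tg.
case=> // -[|j] jk /=; first by rewrite t0.
exact: (tb j.+1).
Qed.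

Hypothesis hN : (m.+2 <= N)%N.

Let hM : (1 < M)%N.
Proof. by move: hN d0; case: (d) => // d'; lia. Qed.

Lemma good_no_interior T : good T -> no_interior_simplex d t T.
Proof.
case=> hT C1; case: (hT) => C0 _ _; apply: (no_interior_simplex_of_sep ht d0 hN _ C1).
by move=> s /C0[].
Qed.

Lemma good_admissible T : good T -> admissible d T.
Proof.
by move=> g; case: (g) => hT _; apply: (admissible_of_triangulation ht d0 hT);
  apply: good_no_interior.
Qed.

(** The sheet of the cyclic cover that contains the arc C of s. *)
Definition level k s C : int := k s + (lap_in s C)%:Z.

(** An arc is in final position at level 0 if it contains vertex 0; no arc is
beyond. *)
Definition nonpositive k T := forall s C, s \in T -> sep C -> #|C| = d.+1 -> C \subset s ->
  level k s C < 0 \/ (level k s C = 0 /\ ord0 \in C).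

Definition flag T s C := [&& s \in T, sep C, #|C| == d.+1 & C \subset s].

Definition val_sum C : nat := \sum_(x in C) x.

(** The sum of the labels of the arc in the cyclic cover, up to a multiple of
N; it grows when vertices step forward. *)
Definition weight k s C : int := (N%:Z * level k s C + (val_sum C)%:Z)%R.

(** If C is not the base of s, some vertex of C can step back inside s
([retreat_exists]), which decreases the weight and does not increase the
level. *)
Lemma min_weight_base T k s C : good T -> flag T s C -> level k s C < 0 ->
  (forall s' C', flag T s' C' -> level k s' C' < 0 -> weight k s C <= weight k s' C') ->
  base_of s = C.
Proof.
move=> g /and4P[sT sC /eqP cC Cs] lt mn; have cT := good_admissible g.
have [b cb] := admissible_base hN cT sT; case: (cT) => C0 _ _ _.
have cs2 : (#|s| < 2 * #|base_of s|)%N by rewrite cb (C0 _ sT); lia.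
case/and3P: (b) => sB Bs _.
apply/eqP; rewrite eqEcard cb cC leqnn andbT; apply/subsetP => b0 b0B.
apply: contraT => b0C.
have [b' [b'B _ b'C Sb' sD]] := retreat_exists b Cs Bs sC sB (etrans cC (esym cb)) erefl cs2 b0B
  b0B b0C.
set D := b' |: (C :\ ordS b') in sD.
have b'S : b' != ordS b' by apply: contraNneq b'C => ->.
have cD : #|D| = d.+1.
  by rewrite cardsU1 !inE (negbTE b'C) andbF -cC (cardsD1 (ordS b') C) Sb'.
have Ds : D \subset s by rewrite subUset sub1set (subsetP Bs) //= (subset_trans (subD1set _ _)).
have b'D : b' \in D by rewrite !inE eqxx.
have e : advance D b' = C.
  apply/setP => y; rewrite !inE; case: (eqVneq y (ordS b')) => [->|_] /=; first by rewrite Sb'.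
  by case: (eqVneq y b') => //= ->; rewrite (negbTE b'C).
have om : lap_in s C = (lap_in s D + (ordS b' == ord0))%N.
  by rewrite -[in LHS]e; apply: (lap_advance hM b) => //; rewrite ?e // cD cb.
have fD : flag T s D by rewrite /flag sT sD cD eqxx Ds.
have lD : level k s D < 0 by apply: le_lt_trans lt; rewrite /level om PoszD addrA lerDl.
have := mn _ _ fD lD; rewrite /weight.
have -> : level k s C = level k s D + (ordS b' == ord0)%:Z by rewrite /level om PoszD addrA.
have sumC : (val_sum C = ordS b' + \sum_(x in C :\ ordS b') x)%N.
  by rewrite /val_sum (big_setD1 (ordS b')).
have sumD : (val_sum D = b' + \sum_(x in C :\ ordS b') x)%N.
  by rewrite /val_sum big_setU1 //= !inE (negbTE b'C) andbF.
rewrite sumC sumD; move: (level k s D) (\sum_(x in _) _)%N => l S.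
have [eM|nM] := eqVneq b' ord_max.
  rewrite eM ordS_max eqxx /= add0n; clear; nia.
have -> : (ordS b' == ord0) = false.
  by apply/negbTE; apply: contra_neq nM => h; apply: ordS_inj; rewrite h ordS_max.
by rewrite val_ordS // addr0 lerD2l !PoszD lerD2r lez_nat ltnn.
Qed.

(** An advance inside s passes vertex 0 with respect to the base of s exactly
when it does with respect to A, as s is contained in both twins. *)
Lemma lap_diff_twin T s A C C' : admissible d T -> s != setT -> #|s| = m.+1 ->
  #|base_of s| = d.+1 ->
  sep A -> #|A| = d.+1 ->
  s \subset twin A -> C \subset s -> C' \subset s -> sep C -> sep C' -> #|C| = d.+1 ->
    #|C'| = d.+1 ->
  (lap_in s C)%:Z - (lap A C)%:Z = (lap_in s C')%:Z - (lap A C')%:Z :> int.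
Proof.
move=> cT sn cs cb sA cA sE Cs C's sC sC' cC cC'; have b := base_ofP sn.
have bA : base A (twin A) by rewrite /base sA subsetUl subxx.
apply: (@advance_invariant _ _ (fun C => (lap_in s C)%:Z - (lap A C)%:Z)%R _ _ s _ _ b);
  rewrite ?cb ?cs ?subxx //; first by lia.
move=> D x DF sD cD xD mF smD.
have := lap_advance hM b DF sD (etrans cD (esym cb)) xD mF smD.
have := lap_advance hM bA (subset_trans DF sE) sD (etrans cD (esym cA)) xD (subset_trans mF sE)
  smD.
by rewrite /lap_in => -> ->; rewrite !PoszD opprD addrACA subrr addr0.
Qed.

(** A measure of how far the bases can still move; N * N bounds the sum of the
labels of an arc, which makes all terms nonnegative as long as the levels are
nonpositive. *)
Definition energy k T : int := \sum_(s in T) ((N * N)%:Z - weight k s (base_of s)).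

(** Flip the arc A of negative level and minimal weight. *)
Lemma flip_down T k s0 C0 : good T -> valid_heights d k T -> nonpositive k T ->
  flag T s0 C0 -> level k s0 C0 < 0 ->
  exists T1 k1, [/\ good T1, valid_heights d k1 T1, nonpositive k1 T1,
    bistellar_flip m t T T1 & energy k1 T1 < energy k T].
Proof.
move=> g vk bk f0 l0; have cT := good_admissible g; case: (g) => hT hsep.
case: (cT) => Ccard _ C2 C3.
pose P (f : {set 'I_N} * {set 'I_N}) := flag T f.1 f.2 && (level k f.1 f.2 < 0).
have P0 : P (s0, C0) by rewrite /P f0.
case: (@arg_minP _ _ _ (s0, C0) P (fun f => weight k f.1 f.2) P0) => -[s A] /andP[/= fA lA] mn.
have mn' s' C' : flag T s' C' -> level k s' C' < 0 -> weight k s A <= weight k s' C'.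
  by move=> f l; apply: (mn (s', C')); rewrite /P f.
have bA := min_weight_base g fA lA mn'; case/and4P: (fA) => sT sA /eqP cA As.
have sn : s != setT := admissible_neq_setT hN cT sT.
have b : base A s by rewrite -bA; apply: base_ofP.
pose E := twin A; have cE : #|E| = m.+2 by rewrite card_twin // cA mulnS.
have sE : s \subset E by case/and3P: b.
pose h0 := level k s A.
(* One simplex of the lower half is the given s, which omits some v + 1. Its
neighbour across the facet that omits a + 1 contains A, gives it the same
level, so has A as its base too, and can only be E minus (a + 1). *)
have lowT a : a \in A -> E :\ ordS a \in T /\ level k (E :\ ordS a) A = h0.
  have [v vA es] : exists2 v, v \in A & s = E :\ ordS v.
    have [e eD] : exists e, e \in E :\: s.
      by apply/set0Pn; rewrite -card_gt0 cardsD (setIidPr sE) cE (Ccard _ sT) subSn ?subnn.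
    move: eD; rewrite inE => /andP[es]; rewrite inE => /orP[/(subsetP As)|/imsetP[v vA ev]].
      by rewrite (negbTE es).
    exists v => //; apply/eqP; rewrite eqEcard subsetD1 sE -ev es (Ccard _ sT) /=.
    have eE : e \in E by rewrite inE ev mem_imset_ordS vA orbT.
    by have := cE; rewrite (cardsD1 e) eE add1n => -[->].
  move=> aA; have [->|av] := eqVneq a v; first by rewrite -es.
  have SaS : ordS a \in s.
    by rewrite es in_setD1 in_setU mem_imset_ordS aA orbT andbT; apply: contra_neq av;
      apply: ordS_inj.
  have AF : A \subset s :\ ordS a by rewrite subsetD1 As (sepP _ sA).
  have [y ys yT] := C3 s (ordS a) A sT SaS sA cA AF.
  set s' := y |: _ in yT; have SaF : ordS a \notin s :\ ordS a by rewrite !inE eqxx.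
  have yF : y \notin s :\ ordS a by rewrite !inE (negbTE ys) andbF.
  have ya : ordS a != y by apply: contraNneq ys => <-.
  have cap : s :&: s' = s :\ ordS a by rewrite -{1}(setD1K SaS) setI_setU1.
  have cF : #|s :\ ordS a| = m by have := Ccard _ sT; rewrite (cardsD1 (ordS a)) SaS => -[].
  have ns : s != s' by apply: contraNneq ys => ->; rewrite !inE eqxx.
  have lev : level k s' A = h0.
    by apply/esym; apply: (vk s s' sT yT ns _ A sA cA); rewrite cap.
  have As' : A \subset s' by apply: subset_trans AF (subsetUr _ _).
  have fA' : flag T s' A by rewrite /flag yT sA cA eqxx As'.
  have bA' : base_of s' = A.
    apply: (@min_weight_base _ k _ _ g fA'); first by rewrite lev.
    by move=> s2 C2' f2 l2; have := mn' _ _ f2 l2; rewrite /weight lev.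
  have yE : y \in E.
    have := base_ofP (admissible_neq_setT hN cT yT); rewrite bA' => /and3P[_ _ /subsetP]; apply.
    by rewrite !inE eqxx.
  have yv : y = ordS v by apply/eqP; apply: contraNT ys => yv; rewrite es !inE yv -in_setU yE.
  have e' : E :\ ordS a = s'.
    apply/setP => z; rewrite /s' es yv in_setU1 !in_setD1;
      case: (eqVneq z (ordS v)) => [->|_] //=.
    by rewrite in_setU mem_imset_ordS vA orbT andbT; apply: contra_neq av => /ordS_inj.
  by rewrite e'.
have hE a : a \in A -> E :\ ordS a \in T by move=> /lowT[].
pose T1 := flip T A.
have T1T : triangulation m t T1 := triangulation_flip ht hT sA cA hE.
have nset e : e \in E -> E :\ e != setT.
  by move=> eE; apply: contraTneq (in_setT e) => <-; rewrite !inE eqxx.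
have cardE e : e \in E -> #|E :\ e| = m.+1.
  by move=> eE; have := cE; rewrite (cardsD1 e) eE => -[].
have AE a : a \in A -> a \in E by move=> aA; rewrite inE aA.
have SE a : a \in A -> ordS a \in E by move=> aA; rewrite inE mem_imset_ordS aA orbT.
have g1 : good T1.
  split=> // u C; rewrite !inE => /orP[/andP[_ uT]|/imsetP[a aA ->]]; first exact: hsep uT.
  by move=> sC CE; rewrite -cA; apply: leq_card_sep_twin => //;
    apply: subset_trans CE (subD1set _ _).
have cT1 := good_admissible g1.
have oldE u : u \in T -> u \notin lower_half A -> ~~ (u \subset E).
  move=> uT; apply: contraNN => uE; rewrite -(setI_powerset_twin ht hT sA cA hE).
  by rewrite inE uT powersetE.
have upT1 a : a \in A -> E :\ a \in T1.
  by move=> aA; rewrite inE; apply/orP; right; apply: imset_f.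
have sSA : sep (@ordS N @: A).
  by apply/sepP => _ /imsetP[a aA ->]; rewrite mem_imset_ordS (sepP _ sA).
have cSA : #|@ordS N @: A| = d.+1 by rewrite card_imset_ordS.
(* On the upper half, the height is chosen so that every arc C of E has the
level h0 + lap A C that it has on the lower half; the arc A + 1 serves as
reference since it belongs to all simplices of the upper half. *)
pose k1 (u : {set 'I_N}) := if u \subset E then h0 + (lap A (@ordS N @: A))%:Z -
  (lap_in u (@ordS N @: A))%:Z else k u.
have lev_up a C : a \in A -> sep C -> #|C| = d.+1 -> C \subset E :\ a ->
    level k1 (E :\ a) C = h0 + (lap A C)%:Z.
  move=> aA sC cC CE; have [_ cb] := admissible_base hN cT1 (upT1 a aA).
  have := lap_diff_twin cT1 (nset _ (AE _ aA)) (cardE _ (AE _ aA)) cb sA cA (subD1set _ _) CE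
    (succ_sub_upper_half sA aA) sC sSA cC cSA.
  rewrite /level /k1 subD1set; clear; move: (lap_in _ _) (lap_in _ _) (lap _ _) (lap _ _) h0 =>
    *; lia.
have lev_low a C : a \in A -> sep C -> #|C| = d.+1 -> C \subset E :\ ordS a ->
    level k (E :\ ordS a) C = h0 + (lap A C)%:Z.
  move=> aA sC cC CE; have [aT al] := lowT a aA; have [_ cb] := admissible_base hN cT aT.
  have := lap_diff_twin cT (nset _ (SE _ aA)) (cardE _ (SE _ aA)) cb sA cA (subD1set _ _) CE
    (sub_lower_half sA aA) sC sA cC cA.
  have -> : lap A A = 0%N by rewrite /lap andbN.
  rewrite -al /level; clear; move: (lap_in _ _) (lap_in _ _) (lap _ _) (k _) => *; lia.
have lev_old u C : u \in T -> u \notin lower_half A -> level k1 u C = level k u C.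
  by move=> uT un; rewrite /level /k1 (negbTE (oldE u uT un)).
exists T1, k1; split=> //.
(* A new simplex u = E minus a and an old one u' share a facet E minus {a, x}.
The arc A + 1 crosses A and so is not in u'; hence x is not in A but x = v + 1
for some v in A, and the facet also bounds the old simplex E minus x, where the
levels agree. *)
- have mixed u u' : u \in upper_half A -> u' \in T -> u' \notin lower_half A ->
  #|u :&: u'| = m -> agree d k1 u u'.
    move=> /imsetP[a aA ->] uT' un' cF C sC cC CF.
    rewrite -/(level k1 _ C) -/(level k1 u' C) (lev_old u') //.
    have CE := subset_trans CF (subsetIl _ _); have Cu' := subset_trans CF (subsetIr _ _).
    rewrite lev_up //; set F := _ :&: u' in cF CF.
    have [x xF ex] := setU1_of_card (subsetIl (E :\ a) u')
      (etrans (cardE _ (AE _ aA)) (congr1 succn (esym cF))).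
    rewrite -/F in xF ex.
    have /setD1P[xa xE] : x \in E :\ a by rewrite ex setU11.
    have FE : F = E :\ a :\ x by rewrite ex setU1K.
    have Fu' : F \subset u' by apply: subsetIr.
    have xnA : x \notin A.
      apply/negP => xA; have SAu' : @ordS N @: A \subset u'.
        apply: subset_trans Fu'; rewrite FE subsetD1 (succ_sub_upper_half sA aA) /=.
        by rewrite (disjointFr (sep_disjoint sA)).
      apply: (C2 _ _ (hE a aA) uT'); exact: ordS_cross sA cA (sub_lower_half sA aA) SAu'.
    move: (xE); rewrite inE (negbTE xnA) => /imsetP[v vA xv].
    have FEx : F \subset E :\ x.
      by rewrite FE subsetD1 (subset_trans (subD1set _ _)) ?subD1set // !inE eqxx.
    have n' : E :\ x != u'.
      by apply: contraNneq (oldE u' uT' un') => <-; apply: subD1set.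
    have cF' : #|(E :\ x) :&: u'| = m.
      apply/eqP; rewrite eqn_leq -[X in (_ && (X <= _))%N]cF subset_leq_card ?andbT; last first.
        by rewrite subsetI FEx.
      rewrite -ltnS -[X in (_ < X)%N](Ccard _ uT'); apply: proper_card.
      rewrite properE subsetIr /=; apply: contraNN n' => h.
      rewrite eq_sym eqEcard (subset_trans h) ?subsetIl //= (Ccard _ uT') cardE //.
    have xT : E :\ x \in T by rewrite xv; apply: hE.
    have := vk _ _ xT uT' n' cF' C sC cC; rewrite -/(level k _ C) -/(level k u' C) => h.
    rewrite -h; first by rewrite xv lev_low // -xv; apply: subset_trans FEx.
    by rewrite subsetI Cu' andbT; apply: subset_trans FEx.
  move=> u u'; rewrite !inE => /orP[/andP[un uT]|uu] /orP[/andP[un' uT']|uu'] n cF.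
  + move=> C sC cC CF; rewrite -/(level k1 u C) -/(level k1 u' C) !lev_old //.
    exact: (vk u u' uT uT' n cF).
  + by apply: agree_sym; apply: mixed => //; rewrite setIC.
  + exact: mixed.
  + case/imsetP: uu => a aA ->; case/imsetP: uu' => a' a'A -> C sC cC CF.
    rewrite -/(level k1 _ C) -/(level k1 (_ :\ a') C) !lev_up //.
      exact: subset_trans CF (subsetIr _ _).
    exact: subset_trans CF (subsetIl _ _).
(* Arcs of the upper half rise by at most one level, and reach level 0 only by
taking vertex 0. *)
- move=> u C; rewrite !inE => /orP[/andP[un uT]|/imsetP[a aA ->]] sC cC Cu.
    by rewrite lev_old //; apply: bk.
  rewrite lev_up //; have : h0 < 0 by [].
  rewrite /lap; case: (ord0 \in C) => /=; last by rewrite addr0; left.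
  case: (ord0 \in A) => /= h; first by rewrite addr0; left.
  have [e|ne] := eqVneq (h0 + 1) 0; [by right|left].
  by move: h ne; clear; move: h0 => h; lia.
- exact: (bistellar_flip_flip ht hT sA cA hE).
(* Old simplices keep their weights, and each of the |A| = d + 1 flipped ones
has a base of larger weight than A. *)
have T1E : T1 = (T :\: lower_half A) :|: upper_half A by [].
have lowsub : lower_half A \subset T by apply/subsetP => _ /imsetP[a aA ->]; apply: hE.
have eT : energy k T = \sum_(u in T :\: lower_half A) ((N * N)%:Z - weight k u (base_of u))
    + \sum_(a in A) ((N * N)%:Z - weight k s A).
  rewrite /energy (big_setID (lower_half A)) /= addrC (setIidPr lowsub); congr (_ + _).
  rewrite big_imset /=; last first.
    move=> a a' aA a'A e; apply/ordS_inj/eqP; apply: contraFT (setD11 (ordS a) E) => n.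
    by rewrite e in_setD1 n SE.
  apply: eq_bigr => a aA; have [aT al] := lowT a aA.
  have ba : base_of (E :\ ordS a) = A.
    apply: (base_uniq (nset _ (SE _ aA)) (base_ofP (nset _ (SE _ aA)))).
    by rewrite /base sA (sub_lower_half sA aA) subD1set.
  by rewrite /weight ba al.
have disj : [disjoint T :\: lower_half A & upper_half A].
  rewrite disjoint_subset; apply/subsetP => u; rewrite !inE => /andP[_ uT].
  apply: contraTN uT => /imsetP[a aA ->]; exact: (upper_half_notin ht hT sA cA hE aA).
have eT1 : energy k1 T1 = \sum_(u in T :\: lower_half A) ((N * N)%:Z - weight k u (base_of u))
    + \sum_(a in A) ((N * N)%:Z - weight k1 (E :\ a) (base_of (E :\ a))).
  rewrite /energy T1E (eq_bigl _ _ (fun u => in_setU u _ _)) bigU //=; congr (_ + _).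
    apply: eq_bigr => u; rewrite inE => /andP[un uT].
    by rewrite /weight lev_old.
  rewrite big_imset //= => a a' aA a'A e.
  by apply/eqP; apply: contraFT (setD11 a E) => n; rewrite e in_setD1 n AE.
rewrite eT eT1 ltrD2l.
have lt a : a \in A -> (N * N)%:Z - weight k1 (E :\ a) (base_of (E :\ a)) < (N * N)%:Z - weight k
  s A.
  move=> aA; rewrite ltrD2l ltrN2; have aT1 := upT1 a aA.
  have [ba cb] := admissible_base hN cT1 aT1; case/and3P: (ba) => sB Bs _.
  rewrite /weight lev_up // -/h0 (mulrDr _ h0) -addrA ltrD2l -PoszM -PoszD ltz_nat.
  apply: val_sum_lap_lt => //; first exact: subset_trans Bs (subD1set _ _).
    by rewrite cb cA.
  by apply: contraTneq aA => e; apply/negP => aA; move: (subsetP Bs a);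
    rewrite e aA !inE eqxx => /(_ isT).
have [a aA] : exists a, a \in A by apply/set0Pn; rewrite -card_gt0 cA.
rewrite (bigD1 a) //= [X in _ < X](bigD1 a) //=; apply: ltr_leD; first exact: lt.
by apply: ler_sum => a' /andP[a'A _]; apply: ltW; apply: lt.
Qed.

Definition terminal T := forall s C, flag T s C -> ord0 \in C.

Lemma energy_ge0 k T : good T -> nonpositive k T -> 0 <= energy k T.
Proof.
move=> g bk; apply: sumr_ge0 => s sT; have cT := good_admissible g.
have [b cb] := admissible_base hN cT sT; case/and3P: (b) => sB Bs _.
have l0 : level k s (base_of s) <= 0.
  by case: (bk s _ sT sB cb Bs) => [/ltW//|[-> _]].
have vs : (val_sum (base_of s) <= N * N)%N.
  rewrite /val_sum; apply: (@leq_trans (\sum_(x in base_of s) N)%N).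
    by apply: leq_sum => x _; apply: ltnW.
  by rewrite sum_nat_const leq_mul2r; apply/orP; right;
    rewrite -[X in (_ <= X)%N](card_ord N) max_card.
rewrite subr_ge0 /weight; apply: (@le_trans _ _ (val_sum (base_of s))%:Z);
  last by rewrite lez_nat.
by rewrite gerDr mulr_ge0_le0.
Qed.

(** Induction on the energy. *)
Lemma flips_to_terminal_from T k : good T -> valid_heights d k T -> nonpositive k T ->
  exists2 T', flips T T' & terminal T'.
Proof.
have [n] : exists n : nat, energy k T <= n%:Z by exists `|energy k T|%N; lia.
elim: n T k => [|n IH] T k en g vk bk.
all: have [[s [C [f l]]]|no] := pselect (exists s C, flag T s C /\ level k s C < 0).
- have [T1 [k1 [g1 v1 b1 fl lt]]] := flip_down g vk bk f l.
  have := energy_ge0 g1 b1; lia.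
- exists T; first exact: flips_refl.
  move=> s C f; case/and4P: (f) => sT sC /eqP cC Cs.
  by case: (bk s C sT sC cC Cs) => [l|[]//]; case: no; exists s, C.
- have [T1 [k1 [g1 v1 b1 fl lt]]] := flip_down g vk bk f l.
  have [|T' f' t'] := IH T1 k1 _ g1 v1 b1; first by lia.
  by exists T' => //; apply: flips_step fl f'.
- exists T; first exact: flips_refl.
  move=> s C f; case/and4P: (f) => sT sC /eqP cC Cs.
  by case: (bk s C sT sC cC Cs) => [l|[]//]; case: no; exists s, C.
Qed.

Lemma flips_to_terminal T : good T -> exists2 T', flips T T' & terminal T'.
Proof.
move=> g; have cT := good_admissible g.
have [k vk] := has_heights_admissible d0 hN cT.
pose K : int := \sum_s `|k s|.
pose k' s := k s - (K + 2).
apply: (@flips_to_terminal_from T k') => //.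
  move=> s s' sT s'T n cF C sC cC CF; have := vk s s' sT s'T n cF C sC cC CF.
  rewrite /k'; clear; move: (k s) (k s') (lap_in _ _) (lap_in _ _) K => *; lia.
move=> s C _ _ _ _; left.
have ks : `|k s| <= K by rewrite /K (bigD1 s) //= lerDl sumr_ge0.
have om : (lap_in s C <= 1)%N by rewrite /lap_in /lap leq_b1.
rewrite /level /k'; move: ks om; clear; move: (k s) (lap_in _ _) K => a b c; lia.
Qed.

(** Split a hypothetical alternating sequence of 2d + 2 vertices by the parity
of their ranks. Both halves are separated, so both have d + 1 elements and are
arcs, one of T and one of T'; as such both contain vertex 0, but the halves are
disjoint. *)
Lemma terminal_nocross T T' s s' : good T -> good T' -> terminal T -> terminal T' ->
  s \in T -> s' \in T' -> ~ cross d s s'.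
Proof.
move=> g g' tT tT' sT s'T [w [sw zw aw]].
pose Z := [set x in w]; pose X b := [set x in Z | odd (rk Z x) == b].
have cZ : #|Z| = m.+2 by rewrite cardsE (card_uniqP (sorted_ltord_uniq sw)).
(* Consecutive vertices of Z have ranks of different parity, including the last
vertex and 0 as |Z| is even. *)
have sX b : sep (X b).
  apply/sepP => x; rewrite !inE => /andP[xw /eqP ox]; apply/negP => /andP[Sw /eqP oS].
  have [xM|xM] := eqVneq x ord_max; last first.
    by move: oS; rewrite rk_ordS // inE xw addn1 /= ox; case: (b).
  move: oS ox; rewrite xM ordS_max.
  have -> : rk Z ord0 = 0%N.
    by rewrite /rk; apply/eqP; rewrite cards_eq0; apply/eqP/setP => y; rewrite !inE ltn0 andbF.
  have -> : rk Z ord_max = m.+1.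
    rewrite /rk (_ : [set _ in _ | _] = Z :\ ord_max).
      have mZ : ord_max \in Z by rewrite inE -xM.
      by have := cZ; rewrite (cardsD1 ord_max) mZ => -[].
    apply/setP => y; rewrite in_set in_setD1 andbC; congr andb.
    by rewrite -val_eqE /= ltn_neqAle -ltnS ltn_ord andbT.
  by rewrite /= mul2n odd_double => <-.
have cX : (#|X false| + #|X true| = m.+2)%N.
  rewrite -cZ -(cardsID (X false) Z) (setIidPr _); last by apply/subsetP => x;
    rewrite !inE => /andP[].
  congr (_ + _)%N; apply: eq_card => x; rewrite !inE.
  by case: (x \in w) => //=; case: odd.
have memX (s1 s2 : {set 'I_N}) : alternating s1 s2 w -> X false \subset s1 /\ X true \subset s2.
  rewrite (sorted_eq_enum sw) => a; split; apply/subsetP => x; rewrite inE => /andP[xZ /eqP o];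
  by have := alternating_enum_mem a xZ; rewrite -/Z o.
have fin (s1 s2 : {set 'I_N}) (T1 T2 : {set {set 'I_N}}) : good T1 -> good T2 ->
    terminal T1 -> terminal T2 -> s1 \in T1 -> s2 \in T2 -> alternating s1 s2 w -> False.
  move=> [_ g1] [_ g2] t1 t2 s1T s2T /memX[X1 X2].
  have c1 := g1 _ _ s1T (sX false) X1; have c2 := g2 _ _ s2T (sX true) X2.
  have e1 : #|X false| = d.+1 by move: cX c1 c2; move: #|X false| #|X true| => a b; clear; lia.
  have e2 : #|X true| = d.+1 by move: cX c1 c2; move: #|X false| #|X true| => a b; clear; lia.
  have f1 : flag T1 s1 (X false) by rewrite /flag s1T sX e1 eqxx X1.
  have f2 : flag T2 s2 (X true) by rewrite /flag s2T sX e2 eqxx X2.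
  have := t1 _ _ f1; have := t2 _ _ f2; rewrite !inE => /andP[_ /eqP->] /andP[].
  by [].
case/orP: aw; [exact: fin g g' tT tT' sT s'T|exact: fin g' g tT' tT s'T sT].
Qed.

Lemma terminal_uniq T T' : good T -> good T' -> terminal T -> terminal T' -> T = T'.
Proof.
move=> g g' tT tT'; case: (g) => hT _; case: (g') => hT' _.
apply/eqP; rewrite eqEsubset (nocross_triangulation_sub ht hT hT')
  ?(nocross_triangulation_sub ht hT' hT) //.
  by move=> s s'; apply: terminal_nocross.
by move=> s s'; apply: terminal_nocross.
Qed.

Lemma good_connected T T' : good T -> good T' -> flips T T'.
Proof.
move=> g g'; have [T1 f1 t1] := flips_to_terminal g; have [T2 f2 t2] := flips_to_terminal g'.
have [_ g1] := flips_good f1; have [_ g2] := flips_good f2.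
apply: flips_trans f1 _; rewrite (terminal_uniq g1 g2 t1 t2); exact: flips_sym.
Qed.
End Main.

Lemma triangulation_simplex (R : realType) (m : nat) (t : 'I_m.+1 -> R)
    (T : {set {set 'I_m.+1}}) : triangulation m t T -> T = [set [set: 'I_m.+1]]%SET.
Proof.
case=> card _ cover.
have full s : s \in T -> s = [set: 'I_m.+1]%SET.
  by move=> /card[_ cs]; apply/eqP; rewrite eqEcard subsetT cardsT card_ord cs leqnn.
have : hull m t [set: 'I_m.+1]%SET (moment_point m (t ord0)).
  by apply: hull_vertex; rewrite in_setT.
rewrite -cover => -[s /= sT _]; apply/setP => u; rewrite in_set1.
by apply/idP/eqP => [/full//|->]; rewrite -(full s sT).
Qed.

Theorem corollary3p17 (R : realType) (d n : nat) (hd : (1 <= d)%N)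
    (t : 'I_(n + 2 * d + 1) -> R)
    (ht : forall i j : 'I_(n + 2 * d + 1), (i < j)%N -> (t i < t j)%R)
    (T T' : {set {set 'I_(n + 2 * d + 1)}})
    (hT : triangulation (2 * d) t T) (hTint : no_interior_simplex d t T)
    (hT' : triangulation (2 * d) t T') (hT'int : no_interior_simplex d t T') :
  exists (k : nat) (Ts : nat -> {set {set 'I_(n + 2 * d + 1)}}),
    [/\ Ts 0%N = T,
        Ts k = T',
        forall j : nat, (j <= k)%N ->
          triangulation (2 * d) t (Ts j) /\ no_interior_simplex d t (Ts j) &
        forall j : nat, (1 <= j <= k)%N ->
          bistellar_flip (2 * d) t (Ts j.-1) (Ts j)].
Proof.
move: t ht T T' hT hTint hT' hT'int; rewrite addn1.
case: n => [|n] t ht T T' hT hTint hT' hT'int.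
  (* The polytope is a simplex, with only the trivial triangulation. *)
  exists 0%N, (fun _ : nat => T); split=> //; last by case.
  by rewrite (triangulation_simplex hT) (triangulation_simplex hT').
have hN : (2 * d).+2 <= (n.+1 + 2 * d).+1 by rewrite !ltnS leq_addl.
have isgood T0 : triangulation (2 * d) t T0 -> no_interior_simplex d t T0 -> good t d T0.
  move=> h no; split=> // s A sT sA As.
  by case: (admissible_of_triangulation ht hd h no) => _ C1 _ _; apply: (C1 s).
have [k [Ts [e0 ek g b]]] :=
  flips_seq (good_connected ht hd hN (isgood _ hT hTint) (isgood _ hT' hT'int)).
exists k, Ts; split=> // j jk; split; first by case: (g j jk).
exact: (good_no_interior ht hd hN (g j jk)).
Qed.
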